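(* Let $I$ be an interpolating Blaschke product with zeros $\Lambda=\{\lambda_n\}_{n\ge1}$, and let $h\in H^2$ be such that the truncated Toeplitz operator $A_{\overline{h}}$ is bounded on $K_I$. Let $\zeta\in\mathbb{T}$. Then every function in $\operatorname{Rng}A_{\overline{h}}$ has a finite non-tangential limit at $\zeta$ if and only if $$\sum_{n\ge1}(1-|\lambda_n|^2)\left|\frac{h(\lambda_n)}{\zeta-\lambda_n}\right|^2<\infty .$$
   Context: $\mathbb{D}$ is the open unit disk, $\mathbb{T}$ the unit circle, $H^2$ the Hardy space of $\mathbb{D}$ (viewed inside $L^2(\mathbb{T},d\theta/2\pi)$ via boundary values). For an inner function $I$, $K_I=H^2\ominus IH^2$ and $P_I$ is the orthogonal projection of $L^2$ onto $K_I$. For $h\in H^2$, $A_{\overline{h}}f=P_I(\overline{h}f)$, initially defined on the dense set of bounded functions in $K_I$; ''bounded'' means it extends to a bounded operator on $K_I$, and $\operatorname{Rng}A_{\overline{h}}$ is the range of this extension. An interpolating Blaschke product is a Blaschke product whose zero sequence $\{\lambda_n\}$ (distinct points) satisfies $\inf_n\prod_{k\ne n}\left|\frac{\lambda_n-\lambda_k}{1-\overline{\lambda_k}\lambda_n}\right|>0$. *)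

(* Defs.v *)
(* MathComp-Analysis over an abstract R : realType,
   complex numbers C := R[i] (mathcomp-real-closed 'complex'). *)
From HB Require Import structures.
From mathcomp Require Import all_boot all_order all_algebra.
From mathcomp Require Import all_classical all_reals all_analysis.
From mathcomp Require Import complex.
Set Implicit Arguments. Unset Strict Implicit. Unset Printing Implicit Defensive.
Import Order.TTheory GRing.Theory Num.Theory.
Import numFieldNormedType.Exports.
Local Open Scope classical_set_scope.
Local Open Scope ring_scope.
Local Open Scope complex_scope.

Section HardyDefs.
Variable R : realType.
Local Notation C := R[i].

(* squared modulus and modulus of a complex number, as reals *)
Definition sqn (z : C) : R := (complex.Re z) ^+ 2 + (complex.Im z) ^+ 2.
Definition modc (z : C) : R := Num.sqrt (sqn z).

(* e^{it} *)
Definition expi (t : R) : C := (cos t +i* sin t).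

(* the circle T is parametrized by t in [0, 2pi], with measure dt/2pi *)
Definition Tdom : set R := `[0, 2 * pi]%classic.
Definition mu := @lebesgue_measure R.

(* L^2(T, dt/2pi) membership of F (a representative function) *)
Definition L2 (F : R -> C) : Prop :=
  [/\ measurable_fun Tdom (fun t => complex.Re (F t)),
      measurable_fun Tdom (fun t => complex.Im (F t)) &
      (\int[mu]_(t in Tdom) (sqn (F t))%:E < +oo)%E].

(* the L^2 inner product <F, G> = (1/2pi) int F conj(G) dt *)
Definition ip (F G : R -> C) : C :=
  ((Rintegral mu Tdom (fun t => complex.Re (F t * (G t)^*)) / (2 * pi))
   +i* (Rintegral mu Tdom (fun t => complex.Im (F t * (G t)^*)) / (2 * pi))).

(* the L^2 norm *)
Definition l2n (F : R -> C) : R :=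
  Num.sqrt (Rintegral mu Tdom (fun t => sqn (F t)) / (2 * pi)).

(* convergence in L^2 *)
Definition l2cvg (Fk : nat -> R -> C) (F : R -> C) : Prop :=
  (fun k => l2n (fun t => Fk k t - F t)) @ \oo --> (0 : R).

(* H^2 as the subspace of L^2 with vanishing negative Fourier coefficients *)
Definition H2 (F : R -> C) : Prop :=
  L2 F /\ forall n : nat, (0 < n)%N ->
    ip F (fun t => expi (- (n%:R * t))) = 0.

(* essential boundedness *)
Definition ess_bdd (F : R -> C) : Prop :=
  exists M : R, {ae mu, forall t, Tdom t -> sqn (F t) <= M}.

(* the analytic extension of F in H^2 to the disk:
   f(z) = <F, k_z>, k_z(e^{it}) = 1/(1 - conj(z) e^{it})  (Cauchy integral) *)
Definition ext (F : R -> C) (z : C) : C :=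
  ip F (fun t => (1 - z^* * expi t)^-1).

(* Blaschke factor with zero a (normalized) *)
Definition bfac (a z : C) : C :=
  if a == 0 then z else (`|a| / a) * ((a - z) / (1 - a^* * z)).

(* the Blaschke product with zeros lam on the disk: limit of partial products *)
Definition blaschke (lam : nat -> C) (z : C) : C :=
  (limn (fun N => complex.Re (\prod_(k < N) bfac (lam k) z)))
  +i* (limn (fun N => complex.Im (\prod_(k < N) bfac (lam k) z))).

(* its boundary values: radial limits at e^{it} *)
Definition blaschke_bd (lam : nat -> C) (t : R) : C :=
  (lim (complex.Re (blaschke lam ((r%:C) * expi t)) @[r --> (1:R)^'-]))
  +i* (lim (complex.Im (blaschke lam ((r%:C) * expi t)) @[r --> (1:R)^'-])).

(* interpolating Blaschke sequence: distinct points of the disk, uniformly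
   separated: inf_n prod_{k<>n} |(l_n - l_k)/(1 - conj(l_k) l_n)| > 0
   (partial products are nonincreasing, so the infinite product is >= d iff all
   finite partial products are >= d) *)
Definition interpolating (lam : nat -> C) : Prop :=
  [/\ injective lam, (forall n, sqn (lam n) < 1) &
      exists2 d : R, 0 < d & forall n N : nat,
        d <= \prod_(k < N | k != n :> nat)
               modc ((lam n - lam k) / (1 - (lam k)^* * lam n))].

(* model space K_I = H^2 minus I H^2 *)
Definition KI (lam : nat -> C) (F : R -> C) : Prop :=
  H2 F /\ forall G, H2 G -> ip F (fun t => blaschke_bd lam t * G t) = 0.

(* V = P_I U (orthogonal projection of U in L^2 onto K_I) *)
Definition isPI (lam : nat -> C) (U V : R -> C) : Prop :=
  KI lam V /\ forall G, KI lam G -> ip (fun t => U t - V t) G = 0.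

(* V = A_{conj h} F, for F a bounded function of K_I *)
Definition tto_val (lam : nat -> C) (H F V : R -> C) : Prop :=
  isPI lam (fun t => (H t)^* * F t) V.

(* A_{conj h} extends to a bounded operator on K_I *)
Definition tto_bounded (lam : nat -> C) (H : R -> C) : Prop :=
  exists Cst : R, forall F V, KI lam F -> ess_bdd F -> tto_val lam H F V ->
    l2n V <= Cst * l2n F.

(* range of the bounded extension: V = (extension)(F), computed as the L^2
   limit of A_{conj h} F_k along bounded F_k in K_I converging to F *)
Definition tto_range (lam : nat -> C) (H V : R -> C) : Prop :=
  L2 V /\ exists F, KI lam F /\
    exists (Fk Vk : nat -> R -> C),
      [/\ forall k, KI lam (Fk k) /\ ess_bdd (Fk k) /\ tto_val lam H (Fk k) (Vk k),
          l2cvg Fk F & l2cvg Vk V].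

(* finite non-tangential limit at zeta in T of f : D -> C *)
Definition nt_limit (f : C -> C) (zeta : C) : Prop :=
  exists L : C, forall M : R, 1 < M -> forall eps : R, 0 < eps ->
    exists2 delta : R, 0 < delta & forall z : C, sqn z < 1 ->
      modc (zeta - z) <= M * (1 - modc z) -> modc (zeta - z) < delta ->
      modc (f z - L) < eps.

End HardyDefs.

(* Main.v *)
(* The normalized kernels khat_n = (1 - |lam_n|^2)^(1/2) / (1 - conj(lam_n) z) form a Riesz basis
   of K_I, and A_{conj h} acts on it diagonally, with eigenvalues conj(c_n), c_n = h(lam_n).
   Hence for V = A_{conj h} F with F = sum_n a_n khat_n,
     V(z) = sum_n a_n w_n(z),
     w_n(z) = conj(c_n) (1 - |lam_n|^2)^(1/2) / (1 - conj(lam_n) z),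
   where a ranges over l^2, and the condition of the theorem says (w_n(zeta)) is in l^2.
   If so, |w_n(z)| <= (1+M) |w_n(zeta)| in a Stolz angle and w(z) -> w(zeta) in l^2, whence the
   limit.  If not, take a_n = conj(w_n(zeta)) / S_n with S_n the partial sums of |w_n(zeta)|^2
   (Abel-Dini): then Re V(r zeta) dominates sums tending to the divergent sum |w_n(zeta)|^2 / S_n.
   The Riesz property comes from interpolating signs at finitely many lam_n by functions bounded
   on the circle by a constant depending only on the separation (P. Jones's explicit formula):
   multiplication by the interpolant bounds every change of signs of the coefficients, and
   averaging over signs compares the norm with the l^2 norm of the coefficients. *)
Require Import Defs.
From HB Require Import structures.
From mathcomp Require Import all_boot all_order all_algebra.
From mathcomp Require Import all_classical all_reals all_analysis.
From mathcomp Require Import measurable_realfun complex ring lra.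
Set Implicit Arguments. Unset Strict Implicit. Unset Printing Implicit Defensive.
Import Order.TTheory GRing.Theory Num.Theory.
Import numFieldNormedType.Exports.
Local Open Scope classical_set_scope.
Local Open Scope ring_scope.

(** Elements of $H^2$ are represented by boundary functions, and their values in the disk by the
    Cauchy integral [ext]. Two facts carry the weight: radial limits of [ext F] return [F] almost
    everywhere, which comes from Lebesgue points, and [ext] is multiplicative. The first is needed
    because the model space is defined through radial limits of the Blaschke product, to be
    identified with the $L^2$ limit of the finite products; it also gives the density of
    polynomials, from which multiplicativity follows. Other analytic functions enter only as
    rational functions, gathered in the class [holo]; interpolating finitely many values with a
    constant independent of their number replaces any compactness argument. The operator is given
    directly only on bounded functions, and a general element of its range has no expansion at hand.
    Every estimate is therefore made on finite kernel combinations, which are bounded, and carried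
    to the range by continuity. No value at $\zeta$ is then available, so differences between two
    points of a Stolz angle are controlled and the limit comes from a Cauchy criterion. *)

Local Notation "x %:C" := (real_complex _ x) : ring_scope.

(** * Complex arithmetic *)

Section Cplx.
Variable R : realType.
Local Notation C := R[i].
Implicit Types (x y z : C).
Local Notation Re := complex.Re.
Local Notation Im := complex.Im.

Lemma cpxP x y : Re x = Re y -> Im x = Im y -> x = y.
Proof. by case: x => a b; case: y => c d /= -> ->. Qed.
Lemma cReD x y : Re (x + y) = Re x + Re y. Proof. by case: x; case: y. Qed.
Lemma cImD x y : Im (x + y) = Im x + Im y. Proof. by case: x; case: y. Qed.
Lemma cReN x : Re (- x) = - Re x. Proof. by case: x. Qed.
Lemma cImN x : Im (- x) = - Im x. Proof. by case: x. Qed.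
Lemma cReM x y : Re (x * y) = Re x * Re y - Im x * Im y.
Proof. by case: x; case: y. Qed.
Lemma cImM x y : Im (x * y) = Re x * Im y + Im x * Re y.
Proof. by case: x; case: y. Qed.
Lemma cReJ x : Re (x^* ) = Re x. Proof. by case: x. Qed.
Lemma cImJ x : Im (x^* ) = - Im x. Proof. by case: x. Qed.
Lemma cReV x : Re x^-1 = Re x / sqn x. Proof. by case: x. Qed.
Lemma cImV x : Im x^-1 = - (Im x / sqn x).
Proof. by case: x => a b. Qed.
Lemma cReC (a : R) : Re a%:C = a. Proof. by []. Qed.
Lemma cImC (a : R) : Im a%:C = 0. Proof. by []. Qed.
Definition cRI := (cReD, cImD, cReN, cImN, cReM, cImM, cReJ, cImJ, cReC, cImC).

Lemma cjD x y : (x + y)^* = x^* + y^*.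
Proof. by apply: cpxP; rewrite !cRI // opprD. Qed.
Lemma cjN x : (- x)^* = - x^*.
Proof. by apply: cpxP; rewrite !cRI. Qed.
Lemma cjM x y : (x * y)^* = x^* * y^*.
Proof. by apply: cpxP; rewrite !cRI; ring. Qed.
Lemma cjK x : x^*^* = x.
Proof. by apply: cpxP; rewrite !cRI ?opprK. Qed.
Lemma cj0 : (0 : C)^* = 0. Proof. by apply: cpxP; rewrite //= oppr0. Qed.
Lemma cj1 : (1 : C)^* = 1. Proof. by apply: cpxP; rewrite //= oppr0. Qed.
Lemma cjC (a : R) : (a%:C)^* = a%:C. Proof. by apply: cpxP; rewrite //= oppr0. Qed.
Lemma cjV x : (x^-1)^* = (x^*)^-1. Proof. exact: fmorphV. Qed.
Lemma cj_sum (I : Type) (r : seq I) (P : pred I) (F : I -> C) :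
  (\sum_(i <- r | P i) F i)^* = \sum_(i <- r | P i) (F i)^*.
Proof. by apply: (big_morph _ cjD cj0). Qed.
Lemma CVr (a : R) : (a^-1)%:C = a%:C^-1 :> C.
Proof. exact: fmorphV. Qed.

Lemma sqn_ge0 x : 0 <= sqn x.
Proof. by rewrite /sqn addr_ge0 ?sqr_ge0. Qed.
Lemma sqnM x y : sqn (x * y) = sqn x * sqn y.
Proof. by rewrite /sqn !cRI; ring. Qed.
Lemma sqnJ x : sqn (x^* ) = sqn x.
Proof. by rewrite /sqn !cRI sqrrN. Qed.
Lemma sqnN x : sqn (- x) = sqn x.
Proof. by rewrite /sqn !cRI !sqrrN. Qed.
Lemma sqn_eq0 x : (sqn x == 0) = (x == 0).
Proof.
rewrite /sqn paddr_eq0 ?sqr_ge0// !sqrf_eq0.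
apply/andP/eqP => [[/eqP a /eqP b]|->//]; exact: cpxP.
Qed.
Lemma sqn0 : sqn (0 : C) = 0. Proof. by apply/eqP; rewrite sqn_eq0. Qed.
Lemma sqn1 : sqn (1 : C) = 1. Proof. by rewrite /sqn /= expr1n expr0n addr0. Qed.
Lemma sqn_gt0 x : (0 < sqn x) = (x != 0).
Proof. by rewrite lt0r sqn_eq0 sqn_ge0 andbT. Qed.
Lemma sqnV x : sqn x^-1 = (sqn x)^-1.
Proof.
have [->|x0] := eqVneq x 0; first by rewrite invr0 sqn0 invr0.
apply: (@mulIf _ (sqn x)); first by rewrite sqn_eq0.
by rewrite -sqnM !mulVf ?sqn1 ?sqn_eq0.
Qed.
Lemma sqnC (a : R) : sqn a%:C = a ^+ 2.
Proof. by rewrite /sqn /= expr0n addr0. Qed.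
Lemma mulcJ x : x * x^* = (sqn x)%:C.
Proof. by apply: cpxP; rewrite !cRI /sqn; ring. Qed.
Lemma normrc x : `|x| = (modc x)%:C. Proof. by rewrite normc_def. Qed.

Lemma modc_ge0 x : 0 <= modc x. Proof. exact: sqrtr_ge0. Qed.
Lemma modc_sqr x : modc x ^+ 2 = sqn x.
Proof. by rewrite sqr_sqrtr ?sqn_ge0. Qed.
Lemma modcM x y : modc (x * y) = modc x * modc y.
Proof. by rewrite /modc sqnM sqrtrM ?sqn_ge0. Qed.
Lemma modcD x y : modc (x + y) <= modc x + modc y.
Proof. by rewrite -lecR rmorphD /= -!normrc ler_normD. Qed.
Lemma modcN x : modc (- x) = modc x. Proof. by rewrite /modc sqnN. Qed.
Lemma modcB x y : modc (x - y) = modc (y - x). Proof. by rewrite -modcN opprB. Qed.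
Lemma modcJ x : modc (x^* ) = modc x. Proof. by rewrite /modc sqnJ. Qed.
Lemma modc0 : modc (0 : C) = 0. Proof. by rewrite /modc sqn0 sqrtr0. Qed.
Lemma modc1 : modc (1 : C) = 1. Proof. by rewrite /modc sqn1 sqrtr1. Qed.
Lemma modcV x : modc x^-1 = (modc x)^-1.
Proof. by rewrite /modc sqnV sqrtrV ?sqn_ge0. Qed.
Lemma modcC (a : R) : modc a%:C = `|a|.
Proof. by rewrite /modc sqnC sqrtr_sqr. Qed.
Lemma modc_eq0 x : (modc x == 0) = (x == 0).
Proof. by rewrite -sqn_eq0 -modc_sqr sqrf_eq0. Qed.
Lemma modc_gt0 x : (0 < modc x) = (x != 0).
Proof. by rewrite lt0r modc_eq0 modc_ge0 andbT. Qed.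
Lemma modcX x n : modc (x ^+ n) = modc x ^+ n.
Proof. by elim: n => [|n IH]; rewrite ?expr0 ?modc1// !exprS modcM IH. Qed.
Lemma modc_le_sqn x (a : R) : 0 <= a -> (modc x <= a) = (sqn x <= a ^+ 2).
Proof. by move=> a0; rewrite -modc_sqr ler_sqr ?nnegrE ?modc_ge0. Qed.
Lemma modc_lt1 x : (modc x < 1) = (sqn x < 1).
Proof. by rewrite -modc_sqr expr_lt1 ?modc_ge0. Qed.
Lemma Re_le_modc x : `|Re x| <= modc x.
Proof. by rewrite -sqrtr_sqr /modc ler_sqrt ?sqn_ge0// /sqn lerDl sqr_ge0. Qed.
Lemma Im_le_modc x : `|Im x| <= modc x.
Proof. by rewrite -sqrtr_sqr /modc ler_sqrt ?sqn_ge0// /sqn lerDr sqr_ge0. Qed.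
Lemma modc_le_ReIm x : modc x <= `|Re x| + `|Im x|.
Proof.
rewrite modc_le_sqn ?addr_ge0// /sqn sqrrD !real_normK ?num_real//.
by rewrite lerD2r lerDl mulrn_wge0 ?mulr_ge0.
Qed.
Lemma modc_sum (I : Type) (r : seq I) (P : pred I) (F : I -> C) :
  modc (\sum_(i <- r | P i) F i) <= \sum_(i <- r | P i) modc (F i).
Proof.
elim/big_ind2: _ => // [|x a y b xa yb]; first by rewrite modc0.
by apply: le_trans (modcD _ _) _; rewrite lerD.
Qed.
Lemma modc_prod (I : Type) (r : seq I) (P : pred I) (F : I -> C) :
  modc (\prod_(i <- r | P i) F i) = \prod_(i <- r | P i) modc (F i).
Proof. by apply: (big_morph _ modcM modc1). Qed.
Lemma modc_subr x y : modc x - modc y <= modc (x - y).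
Proof. by rewrite lerBlDr -{1}(subrK y x) modcD. Qed.

Lemma sqnE x : sqn x = Re x ^+ 2 + Im x ^+ 2. Proof. by []. Qed.
Lemma modcE x : modc x = Num.sqrt (sqn x). Proof. by []. Qed.

End Cplx.
Global Opaque sqn modc.

(** * The space L^2 of the circle *)

Section Integral.
Variable R : realType.
Local Notation C := R[i].
Local Notation Re := complex.Re.
Local Notation Im := complex.Im.
Local Notation T := (@Tdom R).
Local Notation mu := (@lebesgue_measure R).
Implicit Types (F G H : R -> C) (f g : R -> R).

Lemma mT : measurable T. Proof. exact: measurable_itv. Qed.
Hint Resolve mT : core.

Lemma muT : mu T = (2 * pi)%:E.
Proof.
rewrite /Tdom lebesgue_measure_itv /= lte_fin mulr_gt0 ?pi_gt0//.
by rewrite sube0.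
Qed.

Lemma aeS (P Q : R -> Prop) : (forall t, P t -> Q t) ->
  {ae mu, forall t, P t} -> {ae mu, forall t, Q t}.
Proof. by move=> PQ; apply: negligibleS => t /= nQ /PQ. Qed.
Lemma aeI (P Q : R -> Prop) : {ae mu, forall t, P t} -> {ae mu, forall t, Q t} ->
  {ae mu, forall t, P t /\ Q t}.
Proof.
move=> a b; have : mu.-negligible (~` [set t | P t] `|` ~` [set t | Q t]) by exact: negligibleU.
apply: negligibleS => t /= nPQ; apply: contrapT => /not_orP[/contrapT p /contrapT q].
exact: nPQ.
Qed.
Lemma aeT (P : R -> Prop) : (forall t, P t) -> {ae mu, forall t, P t}.
Proof. by move=> h; apply: (negligibleS _ (negligible_set0 mu)) => t /=; apply; exact: h. Qed.

Definition cmeas F := measurable_fun T (fun t => Re (F t)) /\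
  measurable_fun T (fun t => Im (F t)).

Lemma cmeas_cst c : cmeas (fun=> c).
Proof. by split; exact: measurable_cst. Qed.
Lemma cmeasD F G : cmeas F -> cmeas G -> cmeas (fun t => F t + G t).
Proof.
move=> [a b] [c d]; split.
  by under eq_fun do rewrite cReD; exact: measurable_funD.
by under eq_fun do rewrite cImD; exact: measurable_funD.
Qed.
Lemma cmeasN F : cmeas F -> cmeas (fun t => - F t).
Proof.
move=> [a b]; split.
  by under eq_fun do rewrite cReN; exact: measurable_funN.
by under eq_fun do rewrite cImN; exact: measurable_funN.
Qed.
Lemma cmeasJ F : cmeas F -> cmeas (fun t => (F t)^*).
Proof.
move=> [a b]; split; first by under eq_fun do rewrite cReJ.
by under eq_fun do rewrite cImJ; exact: measurable_funN.
Qed.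
Lemma cmeasM F G : cmeas F -> cmeas G -> cmeas (fun t => F t * G t).
Proof.
move=> [a b] [c d]; split.
  by under eq_fun do rewrite cReM; apply: measurable_funB; exact: measurable_funM.
by under eq_fun do rewrite cImM; apply: measurable_funD; exact: measurable_funM.
Qed.
Lemma cmeas_sqn F : cmeas F -> measurable_fun T (fun t => sqn (F t)).
Proof. by move=> [a b]; apply: measurable_funD; exact: measurable_funX. Qed.

Definition rinte f := mu.-integrable T (EFin \o f).

Lemma rinteP f : rinte f <-> measurable_fun T f /\ (\int[mu]_(t in T) `|f t|%:E < +oo)%E.
Proof.
split; first by move=> /integrableP[/measurable_EFinP a b].
by move=> [a b]; apply/integrableP; split => //; exact/measurable_EFinP.
Qed.
Lemma rinte_fin f : rinte f -> (\int[mu]_(x in T) (f x)%:E)%E \is a fin_num.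
Proof. by move=> h; exact: (@integrable_fin_num _ _ _ mu T mT _ h). Qed.
Lemma rinte_meas f : rinte f -> measurable_fun T f.
Proof. by move/rinteP => []. Qed.
Lemma rinte_le f g : measurable_fun T f -> (forall t, T t -> `|f t| <= `|g t|) ->
  rinte g -> rinte f.
Proof.
move=> mf fg; apply: le_integrable => //; first exact/measurable_EFinP.
Qed.
Lemma rinteD f g : rinte f -> rinte g -> rinte (fun t => f t + g t).
Proof. by move=> a b; have := @integrableD _ _ _ mu T mT _ _ a b. Qed.
Lemma rinteN f : rinte f -> rinte (fun t => - f t).
Proof. by move=> a; have := @integrableN _ _ _ mu T _ a. Qed.
Lemma rinteB f g : rinte f -> rinte g -> rinte (fun t => f t - g t).
Proof. by move=> a b; apply: rinteD => //; exact: rinteN. Qed.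
Lemma rinteZ c f : rinte f -> rinte (fun t => c * f t).
Proof. by move=> a; have := @integrableZl _ _ _ mu T mT c _ a. Qed.
Lemma rinte_bd f c : measurable_fun T f -> (forall t, T t -> `|f t| <= c) -> rinte f.
Proof.
move=> mf fc; apply: measurable_bounded_integrable => //.
  by rewrite [X in (X < _)%E]muT ltry.
exists `|c|; split; first exact: num_real.
by move=> x cx t /= Tt; apply: le_trans (fc _ Tt) _; apply: le_trans (ltW cx); exact: ler_norm.
Qed.
Lemma rinte_cst c : rinte (fun=> c).
Proof. by apply: (@rinte_bd _ `|c|) => //; exact: measurable_cst. Qed.

Definition rI f : R := Rintegral mu T f / (2 * pi).

Lemma twopi_gt0 : 0 < 2 * pi :> R. Proof. by rewrite mulr_gt0 ?pi_gt0. Qed.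
Lemma twopi_neq0 : 2 * pi != 0 :> R. Proof. by rewrite gt_eqF ?twopi_gt0. Qed.
Lemma rID f g : rinte f -> rinte g -> rI (fun t => f t + g t) = rI f + rI g.
Proof. by move=> a b; rewrite /rI RintegralD// mulrDl. Qed.
Lemma rIZ c f : rinte f -> rI (fun t => c * f t) = c * rI f.
Proof. by move=> a; rewrite /rI RintegralZl// mulrA. Qed.
Lemma rIN f : rinte f -> rI (fun t => - f t) = - rI f.
Proof. by move=> a; under [fun t => _]eq_fun do rewrite -mulN1r; rewrite rIZ// mulN1r. Qed.
Lemma rIB f g : rinte f -> rinte g -> rI (fun t => f t - g t) = rI f - rI g.
Proof. by move=> a b; rewrite rID ?rIN//; exact: rinteN. Qed.
Lemma rI_ge0 f : (forall t, T t -> 0 <= f t) -> 0 <= rI f.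
Proof. by move=> f0; rewrite divr_ge0 ?(ltW twopi_gt0)// Rintegral_ge0. Qed.
Lemma rI_le f g : rinte f -> rinte g -> (forall t, T t -> f t <= g t) -> rI f <= rI g.
Proof. by move=> a b fg; rewrite ler_pM2r ?invr_gt0 ?twopi_gt0// le_Rintegral. Qed.
Lemma rI_norm f : rinte f -> `|rI f| <= rI (fun t => `|f t|).
Proof.
move=> a; rewrite /rI normrM [X in _ * X]ger0_norm ?invr_ge0 ?(ltW twopi_gt0)//.
by rewrite ler_pM2r ?invr_gt0 ?twopi_gt0// le_normr_Rintegral.
Qed.
Lemma rI_cst c : rI (fun=> c) = c.
Proof.
by rewrite /rI Rintegral_cst// [X in fine X]muT /= mulfK// twopi_neq0.
Qed.
Lemma rI_eq f g : (forall t, T t -> f t = g t) -> rI f = rI g.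
Proof. by move=> fg; congr (_ / _); apply: eq_Rintegral => t; rewrite inE => /fg. Qed.
Lemma rinte_eq f g : (forall t, T t -> f t = g t) -> rinte f -> rinte g.
Proof. by move=> fg; apply: eq_integrable => // t; rewrite inE => Tt /=; rewrite fg. Qed.
Lemma rinte_norm f : rinte f -> rinte (fun t => `|f t|).
Proof.
move=> a; apply: (rinte_le _ _ a); last by move=> t _; rewrite normr_id.
exact: (measurableT_comp (@normr_measurable R setT) (rinte_meas a)).
Qed.
Lemma rI_aeeq f g : measurable_fun T f -> measurable_fun T g ->
  {ae mu, forall t, T t -> f t = g t} -> rI f = rI g.
Proof.
move=> mf mg fg; congr (_ / _); congr fine; apply: ae_eq_integral => //.
- exact/measurable_EFinP.
- exact/measurable_EFinP.
- by apply: aeS fg => t /= fg /fg ->.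
Qed.

Definition cinte F := rinte (fun t => Re (F t)) /\ rinte (fun t => Im (F t)).
Definition cI F : C := Complex (rI (fun t => Re (F t))) (rI (fun t => Im (F t))).

Lemma cI_Re F : Re (cI F) = rI (fun t => Re (F t)). Proof. by []. Qed.
Lemma cI_Im F : Im (cI F) = rI (fun t => Im (F t)). Proof. by []. Qed.
Lemma ipE F G : ip F G = cI (fun t => F t * (G t)^*).
Proof. by []. Qed.
Arguments rI : simpl never.
Arguments cI : simpl never.
Arguments ip : simpl never.
Arguments sqn : simpl never.
Arguments cinte : simpl never.
Arguments Defs.L2 : simpl never.
Lemma cinteD F G : cinte F -> cinte G -> cinte (fun t => F t + G t).
Proof.
move=> [a b] [c d]; split.
  by under eq_fun do rewrite cReD; exact: rinteD.
by under eq_fun do rewrite cImD; exact: rinteD.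
Qed.
Lemma cinteN F : cinte F -> cinte (fun t => - F t).
Proof.
move=> [a b]; split.
  by under eq_fun do rewrite cReN; exact: rinteN.
by under eq_fun do rewrite cImN; exact: rinteN.
Qed.
Lemma cinteZ c F : cinte F -> cinte (fun t => c * F t).
Proof.
move=> [a b]; split.
  by under eq_fun do rewrite cReM; apply: rinteB; exact: rinteZ.
by under eq_fun do rewrite cImM; apply: rinteD; exact: rinteZ.
Qed.
Lemma cinte_cst c : cinte (fun=> c).
Proof. by split; exact: rinte_cst. Qed.
Lemma cID F G : cinte F -> cinte G -> cI (fun t => F t + G t) = cI F + cI G.
Proof.
move=> [a b] [c d]; apply: cpxP; rewrite !(cRI, cI_Re, cI_Im) -rID//.
  by apply: rI_eq => t _; rewrite cReD.
by apply: rI_eq => t _; rewrite cImD.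
Qed.
Lemma cIN F : cinte F -> cI (fun t => - F t) = - cI F.
Proof.
move=> [a b]; apply: cpxP; rewrite !(cRI, cI_Re, cI_Im) -rIN//.
  by apply: rI_eq => t _; rewrite cReN.
by apply: rI_eq => t _; rewrite cImN.
Qed.
Lemma cIB F G : cinte F -> cinte G -> cI (fun t => F t - G t) = cI F - cI G.
Proof. by move=> a b; rewrite cID ?cIN//; exact: cinteN. Qed.
Lemma cIZ c F : cinte F -> cI (fun t => c * F t) = c * cI F.
Proof.
move=> [a b]; apply: cpxP; rewrite !(cRI, cI_Re, cI_Im) -!rIZ//.
  by rewrite -rIB; [apply: rI_eq => t _; rewrite cReM|exact: rinteZ|exact: rinteZ].
by rewrite -rID; [apply: rI_eq => t _; rewrite cImM|exact: rinteZ|exact: rinteZ].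
Qed.
Lemma cIJ F : cinte F -> cI (fun t => (F t)^*) = (cI F)^*.
Proof.
move=> [a b]; apply: cpxP; rewrite !(cRI, cI_Re, cI_Im).
  by apply: rI_eq => t _; rewrite cReJ.
by rewrite -rIN//; apply: rI_eq => t _; rewrite cImJ.
Qed.
Lemma cI_cst c : cI (fun=> c) = c.
Proof. by apply: cpxP; rewrite !(cI_Re, cI_Im) rI_cst. Qed.
Lemma cI_eq F G : (forall t, T t -> F t = G t) -> cI F = cI G.
Proof. by move=> FG; apply: cpxP; rewrite !(cI_Re, cI_Im); apply: rI_eq => t /FG ->. Qed.
Lemma cI_sum (I : Type) (r : seq I) (P : pred I) (F : I -> R -> C) :
  (forall i, P i -> cinte (F i)) ->
  cinte (fun t => \sum_(i <- r | P i) F i t) /\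
  cI (fun t => \sum_(i <- r | P i) F i t) = \sum_(i <- r | P i) cI (F i).
Proof.
move=> iF; elim: r => [|i r [IH1 IH2]].
  rewrite big_nil; under eq_fun do rewrite big_nil.
  by split; [exact: cinte_cst|exact: cI_cst].
rewrite big_cons; under eq_fun do rewrite big_cons.
case: ifP => Pi; last by [].
by split; [apply: cinteD => //; exact: iF|rewrite cID ?IH2//; exact: iF].
Qed.

Lemma L2P F : L2 F <-> cmeas F /\ rinte (fun t => sqn (F t)).
Proof.
split.
  move=> [a b c]; split => //; apply/rinteP; split; first exact: cmeas_sqn.
  rewrite (eq_integral (mu := mu) (D := T) (fun t => (sqn (F t))%:E))// => t _.
  by rewrite ger0_norm ?sqn_ge0.
move=> [[a b] /rinteP[_ c]]; split => //; move: c.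
rewrite (eq_integral (mu := mu) (D := T) (fun t => (sqn (F t))%:E))// => t _.
by rewrite ger0_norm ?sqn_ge0.
Qed.
Lemma L2_meas F : L2 F -> cmeas F. Proof. by move/L2P => []. Qed.
Lemma L2_sqn F : L2 F -> rinte (fun t => sqn (F t)). Proof. by move/L2P => []. Qed.

Lemma L2_le F G c : cmeas F -> (forall t, T t -> sqn (F t) <= c * sqn (G t)) -> L2 G -> L2 F.
Proof.
move=> mF FG /L2P[mG iG]; apply/L2P; split => //.
apply: (rinte_le _ _ (rinteZ c iG)); first exact: cmeas_sqn.
move=> t Tt /=; rewrite ger0_norm ?sqn_ge0//.
by apply: le_trans (FG _ Tt) _; exact: ler_norm.
Qed.
Lemma L2D F G : L2 F -> L2 G -> L2 (fun t => F t + G t).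
Proof.
move=> /L2P[mF iF] /L2P[mG iG]; apply/L2P; split; first exact: cmeasD.
apply: (rinte_le _ _ (rinteZ 2 (rinteD iF iG))); first by apply: cmeas_sqn; exact: cmeasD.
move=> t Tt /=; rewrite ger0_norm ?sqn_ge0// ger0_norm; last first.
  by rewrite mulr_ge0// addr_ge0 ?sqn_ge0.
rewrite ?sqnE !cRI; set a := Re (F t); set b := Im (F t); set c := Re (G t); set d := Im (G t).
by have := sqr_ge0 (a - c); have := sqr_ge0 (b - d); lra.
Qed.
Lemma L2Z c F : L2 F -> L2 (fun t => c * F t).
Proof.
move=> h; apply: (@L2_le _ F (sqn c)) => //; last by move=> t _; rewrite sqnM.
by apply: cmeasM; [exact: cmeas_cst|exact: L2_meas].
Qed.
Lemma L2N F : L2 F -> L2 (fun t => - F t).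
Proof.
move=> h; apply: (@L2_le _ F 1) => //; last by move=> t _; rewrite sqnN mul1r.
by apply: cmeasN; exact: L2_meas.
Qed.
Lemma L2B F G : L2 F -> L2 G -> L2 (fun t => F t - G t).
Proof. by move=> a b; apply: L2D => //; exact: L2N. Qed.
Lemma L2J F : L2 F -> L2 (fun t => (F t)^*).
Proof.
move=> h; apply: (@L2_le _ F 1) => //; last by move=> t _; rewrite sqnJ mul1r.
by apply: cmeasJ; exact: L2_meas.
Qed.
Lemma L2_cst (c : C) : L2 (fun _ : R => c).
Proof. by apply/L2P; split; [exact: cmeas_cst|exact: rinte_cst]. Qed.
Lemma L2_sum (I : Type) (r : seq I) (P : pred I) (F : I -> R -> C) :
  (forall i, P i -> L2 (F i)) -> L2 (fun t => \sum_(i <- r | P i) F i t).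
Proof.
move=> iF; elim: r => [|i r IH].
  by under eq_fun do rewrite big_nil; exact: L2_cst.
under eq_fun do rewrite big_cons.
case: (boolP (P i)) => Pi; last exact: IH.
by apply: L2D => //; exact: iF.
Qed.

(** The bound holds at every point of the circle, so products stay in $L^2$ without any
    almost-everywhere argument. *)
Definition bmeas F := cmeas F /\ exists M, forall t, T t -> sqn (F t) <= M.
Lemma L2M F G : bmeas F -> L2 G -> L2 (fun t => F t * G t).
Proof.
move=> [mF [M FM]] h; apply: (@L2_le _ G M) => //.
  by apply: cmeasM => //; exact: L2_meas.
by move=> t Tt; rewrite sqnM ler_wpM2r ?sqn_ge0 ?FM.
Qed.
Lemma bmeasM F G : bmeas F -> bmeas G -> bmeas (fun t => F t * G t).
Proof.
move=> [a [M FM]] [b [N GN]]; split; first exact: cmeasM.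
by exists (M * N) => t Tt; rewrite sqnM ler_pM ?sqn_ge0 ?FM ?GN.
Qed.
Lemma bmeasJ F : bmeas F -> bmeas (fun t => (F t)^*).
Proof. by move=> [a [M FM]]; split; [exact: cmeasJ|exists M => t; rewrite sqnJ; exact: FM]. Qed.
Lemma bmeas_cst c : bmeas (fun=> c).
Proof. by split; [exact: cmeas_cst|exists (sqn c)]. Qed.
Lemma bmeasD F G : bmeas F -> bmeas G -> bmeas (fun t => F t + G t).
Proof.
move=> [a [M FM]] [b [N GN]]; split; first exact: cmeasD.
exists (2 * (M + N)) => t Tt; have := FM _ Tt; have := GN _ Tt.
rewrite ?sqnE !cRI; set x := Re (F t); set y := Im (F t); set z := Re (G t); set w := Im (G t).
by move=> h1 h2; have := sqr_ge0 (x - z); have := sqr_ge0 (y - w); lra.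
Qed.
Lemma bmeas_L2 F : bmeas F -> L2 F.
Proof.
move=> h; have := L2M h (L2_cst 1); congr L2.
by apply: funext => t; rewrite mulr1.
Qed.

Lemma cinteM F G : L2 F -> L2 G -> cinte (fun t => F t * G t).
Proof.
move=> LF LG; have h := rinteD (L2_sqn LF) (L2_sqn LG).
have [m1 m2] := cmeasM (L2_meas LF) (L2_meas LG).
split; apply: (rinte_le _ _ h) => // t Tt /=.
  rewrite [leRHS](ger0_norm (addr_ge0 (sqn_ge0 _) (sqn_ge0 _))).
  apply: (le_trans (Re_le_modc _)).
  by rewrite modcM -!modc_sqr; have := sqr_ge0 (modc (F t) - modc (G t));
    have := sqr_ge0 (modc (F t) + modc (G t)); lra.
rewrite [leRHS](ger0_norm (addr_ge0 (sqn_ge0 _) (sqn_ge0 _))); apply: (le_trans (Im_le_modc _)).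
by rewrite modcM -!modc_sqr; have := sqr_ge0 (modc (F t) - modc (G t));
  have := sqr_ge0 (modc (F t) + modc (G t)); lra.
Qed.
Lemma cinte_ip F G : L2 F -> L2 G -> cinte (fun t => F t * (G t)^*).
Proof. by move=> a b; apply: cinteM => //; exact: L2J. Qed.
Lemma L2_cinte F : L2 F -> cinte F.
Proof.
move=> h; have := cinteM h (L2_cst 1); congr cinte.
by apply: funext => t; rewrite mulr1.
Qed.

Lemma ip_eq F F' G G' : (forall t, F t = F' t) -> (forall t, G t = G' t) -> ip F G = ip F' G'.
Proof. by move=> /funext -> /funext ->. Qed.
Lemma ipDl F G H : L2 F -> L2 G -> L2 H -> ip (fun t => F t + G t) H = ip F H + ip G H.
Proof.
move=> a b c; rewrite !ipE -cID; [|exact: cinte_ip|exact: cinte_ip].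
by apply: cI_eq => t _; rewrite mulrDl.
Qed.
Lemma ipZl c F H : L2 F -> L2 H -> ip (fun t => c * F t) H = c * ip F H.
Proof.
move=> a b; rewrite !ipE -cIZ; last exact: cinte_ip.
by apply: cI_eq => t _; rewrite mulrA.
Qed.
Lemma ipJ F G : L2 F -> L2 G -> ip G F = (ip F G)^*.
Proof.
move=> a b; rewrite !ipE -cIJ; last exact: cinte_ip.
by apply: cI_eq => t _; rewrite cjM cjK mulrC.
Qed.
Lemma ipNl F H : L2 F -> L2 H -> ip (fun t => - F t) H = - ip F H.
Proof.
by move=> a b; rewrite -mulN1r -ipZl//; apply: ip_eq => // t; rewrite mulN1r.
Qed.
Lemma ipBl F G H : L2 F -> L2 G -> L2 H -> ip (fun t => F t - G t) H = ip F H - ip G H.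
Proof. by move=> a b c; rewrite ipDl ?ipNl//; exact: L2N. Qed.
Lemma ipDr F G H : L2 F -> L2 G -> L2 H -> ip H (fun t => F t + G t) = ip H F + ip H G.
Proof.
move=> a b c; by rewrite (ipJ (L2D a b) c) ipDl// cjD -!ipJ.
Qed.
Lemma ipZr c F H : L2 F -> L2 H -> ip H (fun t => c * F t) = c^* * ip H F.
Proof.
move=> a b; by rewrite (ipJ (L2Z c a) b) ipZl// cjM -!ipJ.
Qed.
Lemma ipNr F H : L2 F -> L2 H -> ip H (fun t => - F t) = - ip H F.
Proof. by move=> a b; rewrite (ipJ (L2N a) b) ipNl// cjN -ipJ. Qed.
Lemma ipBr F G H : L2 F -> L2 G -> L2 H -> ip H (fun t => F t - G t) = ip H F - ip H G.
Proof. by move=> a b c; rewrite ipDr ?ipNr//; exact: L2N. Qed.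
Lemma ip_suml (I : Type) (r : seq I) (P : pred I) (F : I -> R -> C) H :
  (forall i, P i -> L2 (F i)) -> L2 H ->
  ip (fun t => \sum_(i <- r | P i) F i t) H = \sum_(i <- r | P i) ip (F i) H.
Proof.
move=> iF LH; rewrite ipE.
have := @cI_sum I r P (fun i t => F i t * (H t)^*) (fun i Pi => cinte_ip (iF i Pi) LH).
move=> [_ <-]; apply: cI_eq => t _; rewrite mulr_suml//.
Qed.
Lemma ip_sumr (I : Type) (r : seq I) (P : pred I) (F : I -> R -> C) H :
  (forall i, P i -> L2 (F i)) -> L2 H ->
  ip H (fun t => \sum_(i <- r | P i) F i t) = \sum_(i <- r | P i) ip H (F i).
Proof.
move=> iF LH; rewrite (ipJ (L2_sum r iF) LH) ip_suml// cj_sum.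
by apply: eq_bigr => i Pi; rewrite -ipJ//; exact: iF.
Qed.

Definition nsq F : R := rI (fun t => sqn (F t)).
Lemma nsq_ge0 F : 0 <= nsq F.
Proof. by apply: rI_ge0 => t _; exact: sqn_ge0. Qed.
Lemma ip_nsq F : ip F F = (nsq F)%:C.
Proof.
rewrite ipE; apply: cpxP => /=.
  by apply: rI_eq => t _; rewrite mulcJ.
by rewrite -[RHS](rI_cst 0); apply: rI_eq => t _; rewrite mulcJ.
Qed.
Lemma l2n_sqr F : l2n F ^+ 2 = nsq F.
Proof. by rewrite sqr_sqrtr//; exact: nsq_ge0. Qed.
Lemma l2n_ge0 F : 0 <= l2n F. Proof. exact: sqrtr_ge0. Qed.
Lemma nsqD F G : L2 F -> L2 G ->
  nsq (fun t => F t + G t) = nsq F + nsq G + 2 * Re (ip F G).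
Proof.
move=> a b; have : ((nsq (fun t => F t + G t))%:C : C) =
    (nsq F + nsq G + 2 * Re (ip F G))%:C.
  rewrite -ip_nsq ipDl ?ipDr//; try exact: L2D.
  rewrite (ipJ a b) !ip_nsq; apply: cpxP; rewrite !cRI //; last by rewrite /=; ring.
  by ring.
by move/complexI.
Qed.
Lemma nsqZ c F : L2 F -> nsq (fun t => c * F t) = sqn c * nsq F.
Proof.
move=> a; rewrite /nsq -rIZ; last exact: L2_sqn.
by apply: rI_eq => t _; rewrite sqnM.
Qed.
Lemma nsqN F : nsq (fun t => - F t) = nsq F.
Proof. by apply: rI_eq => t _; rewrite sqnN. Qed.
Lemma nsqB F G : L2 F -> L2 G ->
  nsq (fun t => F t - G t) = nsq F + nsq G - 2 * Re (ip F G).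
Proof.
move=> a b; rewrite nsqD ?nsqN ?ipNr//; last exact: L2N.
by rewrite cReN mulrN.
Qed.

(** Functions are representatives, so [nsq G = 0] does not make [G] zero. Expanding $\|F-\bar
    c\,G\|^2\ge0$ leaves an upper bound on $2\operatorname{Re}(c\langle F,G\rangle)$ valid for every
    $c$, which forces the inner product to vanish. *)
Lemma nsq0_ip F G : L2 F -> L2 G -> nsq G = 0 -> ip F G = 0.
Proof.
move=> a b G0.
have h (c : C) : 2 * Re (c * ip F G) <= nsq F.
  have := nsq_ge0 (fun t => F t - (c^* * G t)).
  rewrite nsqB ?nsqZ ?G0 ?mulr0 ?addr0 ?ipZr ?subr_ge0//; last exact: L2Z.
  by rewrite cjK.
apply/eqP; rewrite -sqn_eq0; apply: contraT => nz.
have p : 0 < sqn (ip F G) by rewrite lt0r nz sqn_ge0.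
(* With $c=k\overline{\langle F,G\rangle}$ the bounded quantity equals $2(\|F\|^2+1)$, above its
   bound $\|F\|^2$. *)
pose k := (nsq F + 1) / sqn (ip F G).
have := h (k%:C * (ip F G)^*).
rewrite -mulrA [_^* * _]mulrC mulcJ !cRI mul0r subr0 /k divfK ?gt_eqF//.
by have := nsq_ge0 F; lra.
Qed.

Lemma CS_sqn F G : L2 F -> L2 G -> sqn (ip F G) <= nsq F * nsq G.
Proof.
move=> a b; have [G0|G0] := eqVneq (nsq G) 0.
  by rewrite nsq0_ip// sqn0 G0 mulr0.
have p : 0 < nsq G by rewrite lt0r G0 nsq_ge0.
have := nsq_ge0 (fun t => F t - ((ip F G / (nsq G)%:C) * G t)).
rewrite nsqB ?nsqZ// ?ipZr//; last exact: L2Z.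
have -> : (ip F G / (nsq G)%:C)^* * ip F G = (sqn (ip F G) / nsq G)%:C.
  by rewrite [RHS]rmorphM /= -mulcJ CVr cjM cjV cjC mulrC mulrA.
rewrite cReC sqnM sqnV sqnC => h.
have : 0 <= nsq F * nsq G - sqn (ip F G).
  have -> : nsq F * nsq G - sqn (ip F G) = nsq G * (nsq F + sqn (ip F G) / nsq G ^+ 2 * nsq G -
     2 * (sqn (ip F G) / nsq G)) by field.
  by rewrite mulr_ge0 ?(ltW p).
by rewrite subr_ge0.
Qed.
Lemma CS F G : L2 F -> L2 G -> modc (ip F G) <= l2n F * l2n G.
Proof.
move=> a b; rewrite modc_le_sqn ?mulr_ge0 ?l2n_ge0//.
by rewrite exprMn !l2n_sqr CS_sqn.
Qed.
Lemma l2nD F G : L2 F -> L2 G -> l2n (fun t => F t + G t) <= l2n F + l2n G.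
Proof.
move=> a b; rewrite -(@ler_pXn2r _ 2) ?nnegrE ?addr_ge0 ?l2n_ge0//.
rewrite l2n_sqr nsqD// sqrrD !l2n_sqr.
have : Re (ip F G) <= l2n F * l2n G.
  by apply: le_trans (CS a b); apply: le_trans (Re_le_modc _); exact: ler_norm.
rewrite -mulr_natl; lra.
Qed.
Lemma l2nN F : l2n (fun t => - F t) = l2n F.
Proof. by rewrite /l2n; congr Num.sqrt; have := nsqN F. Qed.
Lemma l2n_sub F G : l2n (fun t => F t - G t) = l2n (fun t => G t - F t).
Proof. by rewrite -l2nN; congr l2n; apply: funext => t; rewrite opprB. Qed.
Lemma l2n_dist F G : L2 F -> L2 G -> l2n F - l2n G <= l2n (fun t => F t - G t).
Proof.
move=> a b; rewrite lerBlDr; have := l2nD (L2B a b) b; congr (l2n _ <= _).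
by apply: funext => t; rewrite subrK.
Qed.
Lemma l2nM F G M : bmeas F -> L2 G -> 0 <= M -> (forall t, T t -> sqn (F t) <= M ^+ 2) ->
  l2n (fun t => F t * G t) <= M * l2n G.
Proof.
move=> a b M0 FM; rewrite -(@ler_pXn2r _ 2) ?nnegrE ?mulr_ge0 ?l2n_ge0//.
rewrite exprMn !l2n_sqr -rIZ; last exact: L2_sqn.
apply: rI_le; [by apply: L2_sqn; exact: L2M|by apply: rinteZ; exact: L2_sqn|].
by move=> t Tt; rewrite sqnM ler_wpM2r ?sqn_ge0 ?FM.
Qed.
End Integral.
#[export] Hint Resolve mT : core.

(** * Completeness of L^2 *)

Section Complete.
Variable R : realType.
Local Notation C := R[i].
Local Notation Re := complex.Re.
Local Notation Im := complex.Im.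
Local Notation T := (@Tdom R).
Local Notation mu := (@lebesgue_measure R).
Implicit Types (F G H : R -> C) (f g : R -> R).

Definition ccvg (u : nat -> C) (l : C) : Prop :=
  ((fun k => Re (u k)) @ \oo --> Re l) /\ ((fun k => Im (u k)) @ \oo --> Im l).

Lemma ccvg_cst (c : C) : ccvg (fun=> c) c.
Proof. by split; exact: cvg_cst. Qed.
Lemma ccvgD u v a b : ccvg u a -> ccvg v b -> ccvg (fun k => u k + v k) (a + b).
Proof.
move=> [p q] [r s]; split; rewrite ?cReD ?cImD.
  by under eq_fun do rewrite cReD; exact: cvgD.
by under eq_fun do rewrite cImD; exact: cvgD.
Qed.
Lemma ccvgN u a : ccvg u a -> ccvg (fun k => - u k) (- a).
Proof.
move=> [p q]; split; rewrite ?cReN ?cImN.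
  by under eq_fun do rewrite cReN; exact: cvgN.
by under eq_fun do rewrite cImN; exact: cvgN.
Qed.
Lemma ccvgB u v a b : ccvg u a -> ccvg v b -> ccvg (fun k => u k - v k) (a - b).
Proof. by move=> p q; apply: ccvgD => //; exact: ccvgN. Qed.
Lemma ccvgM u v a b : ccvg u a -> ccvg v b -> ccvg (fun k => u k * v k) (a * b).
Proof.
move=> [p q] [r s]; split; rewrite ?cReM ?cImM.
  by under eq_fun do rewrite cReM; apply: cvgB; exact: cvgM.
by under eq_fun do rewrite cImM; apply: cvgD; exact: cvgM.
Qed.
Lemma ccvg_sqn u a : ccvg u a -> (fun k => sqn (u k)) @ \oo --> sqn a.
Proof.
move=> [p q]; rewrite sqnE; under eq_fun do rewrite sqnE.
by apply: cvgD; rewrite expr2; under eq_fun do rewrite expr2; exact: cvgM.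
Qed.
Lemma ccvg_modc u a : ccvg u a -> (fun k => modc (u k)) @ \oo --> modc a.
Proof.
move=> /ccvg_sqn h; rewrite modcE; under eq_fun do rewrite modcE.
by apply: continuous_cvg => //; exact: sqrt_continuous.
Qed.
Lemma ccvg_unique u a b : ccvg u a -> ccvg u b -> a = b.
Proof.
by move=> [p q] [r s]; apply: cpxP; [exact: cvg_unique p r|exact: cvg_unique q s].
Qed.
Lemma ccvg_sub u a (n_ : nat -> nat) : ccvg u a -> (forall k, (k <= n_ k)%N) ->
  ccvg (fun k => u (n_ k)) a.
Proof.
move=> [p q] kn; split; apply/cvgrPdist_le => e e0.
  move/cvgrPdist_le : p => /(_ e e0)[N _ hN]; exists N => // k /= Nk.
  by apply: hN; exact: leq_trans (kn k).
move/cvgrPdist_le : q => /(_ e e0)[N _ hN]; exists N => // k /= Nk.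
by apply: hN; exact: leq_trans (kn k).
Qed.
Lemma ccvg_dist u a : (fun k => modc (u k - a)) @ \oo --> (0 : R) -> ccvg u a.
Proof.
move=> h; split; apply/cvgrPdist_le => e e0; move/cvgrPdist_le: h => /(_ e e0);
 apply: filterS => k; rewrite sub0r normrN ger0_norm ?modc_ge0// => le.
  by rewrite distrC -cReN -cReD; apply: le_trans le; exact: Re_le_modc.
by rewrite distrC -cImN -cImD; apply: le_trans le; exact: Im_le_modc.
Qed.

(** Fatou's lemma for the $L^2$ norm: it turns almost-everywhere convergence into membership in
    $L^2$ and norm estimates for the limit. *)
Lemma nsq_fatou (G_ : nat -> R -> C) G c : (forall k, L2 (G_ k)) -> cmeas G ->
  (forall k, nsq (G_ k) <= c) ->
  {ae mu, forall t, T t -> ccvg (G_ ^~ t) (G t)} -> L2 G /\ nsq G <= c.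
Proof.
move=> LG mG Gc GG.
pose f k t : \bar R := (sqn (G_ k t))%:E.
have mf k : measurable_fun T (f k).
  by have := measurable_int mu (L2_sqn (LG k)).
have f0 k t : T t -> (0 <= f k t)%E by rewrite lee_fin sqn_ge0.
have := @fatou _ _ _ mu T (@mT R) f mf f0.
have intf k : (\int[mu]_(x in T) f k x = (2 * pi * nsq (G_ k))%:E)%E.
  rewrite /nsq /rI mulrC divfK ?twopi_neq0// /Rintegral fineK//.
  exact: (rinte_fin (L2_sqn (LG k))).
have ub : (limn_einf (fun n => \int[mu]_(x in T) f n x) <= (2 * pi * c)%:E)%E.
  rewrite limn_einf_lim; apply: lime_le; first exact: is_cvg_einfs.
  apply: nearW => n; apply: le_trans (_ : (\int[mu]_(x in T) f n x <= _)%E).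
    by apply: ereal_inf_lbound; exists n => /=.
  by rewrite intf lee_fin ler_pM2l ?twopi_gt0.
move=> /le_trans /(_ ub).
(* Measurability of the lower limit is deduced from that of upper limits by a change of sign. *)
have mlim : measurable_fun T (fun t => limn_einf (f^~ t)).
  have -> : (fun t => limn_einf (f^~ t)) =
      (fun t => - limn_esup ((fun k t => - f k t) ^~ t))%E.
    apply: funext => t; rewrite -limn_einfN; congr limn_einf.
    by apply: funext => k; exact/esym/oppeK.
  apply: measurableT_comp => //; apply: measurable_fun_limn_esup => k.
  by apply: measurableT_comp => //; exact: mf.
have ms := cmeas_sqn mG.
have -> : (\int[mu]_(x in T) limn_einf (f^~ x) = \int[mu]_(x in T) (sqn (G x))%:E)%E.
  apply: ge0_ae_eq_integral => //.
  - exact: mT.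
  - by move/measurable_EFinP : ms.
  - move=> t Tt; rewrite limn_einf_lim; apply: lime_ge; first exact: is_cvg_einfs.
    by apply: nearW => n; apply: le_ereal_inf_tmp => _ [k /= _ <-]; exact: f0.
  - by move=> t Tt; rewrite lee_fin sqn_ge0.
  - apply: aeS GG => t /= h Tt; have := ccvg_sqn (h Tt) => {}h.
    have hh : (fun k => f k t) @ \oo --> (sqn (G t))%:E.
      by apply: cvg_EFin => //; exact: nearW.
    by rewrite (cvg_limn_einf_sup hh).1.
move=> le.
have LL : L2 G by split; [exact: mG.1|exact: mG.2|exact: le_lt_trans le (ltry _)].
split => //; rewrite /nsq /rI ler_pdivrMr ?twopi_gt0// mulrC /Rintegral -lee_fin fineK//.
exact: (rinte_fin (L2_sqn LL)).
Qed.

(** Integrating termwise shows that the sum has a finite integral, hence is finite almost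
    everywhere. *)
Lemma rI_nneseries (f_ : nat -> R -> R) (M : R) : (forall k, rinte (f_ k)) -> (forall k t, 0 <= f_ k t) ->
  (forall n, \sum_(k < n) rI (f_ k) <= M) ->
  {ae mu, forall t, T t -> cvgn (series (f_ ^~ t))}.
Proof.
move=> If f0 fM.
pose g t : \bar R := (\sum_(0 <= k <oo) (f_ k t)%:E)%E.
have mf k : measurable_fun T (fun t => (f_ k t)%:E).
  by have := measurable_int mu (If k).
have := @integral_nneseries _ _ _ mu T (@mT R) (fun k t => (f_ k t)%:E) mf
  (fun k t _ => f0 k t).
set S := (X in _ = X -> _) => eqS.
have SM : (S <= (2 * pi * M)%:E)%E.
  apply: lime_le.
    by apply: is_cvg_nneseries => n _ _; apply: integral_ge0 => t _; rewrite lee_fin.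
  apply: nearW => n; rewrite big_mkord.
  have -> : (\sum_(i < n) \int[mu]_(x in T) (f_ i x)%:E)%E =
     (2 * pi * \sum_(i < n) rI (f_ i))%:E.
    rewrite mulr_sumr -sumEFin; apply: eq_bigr => i _.
    rewrite /rI mulrC divfK ?twopi_neq0// /Rintegral fineK//.
    exact: (rinte_fin (If i)).
  by rewrite lee_fin ler_pM2l ?twopi_gt0.
have mg : measurable_fun T g.
  apply: ge0_emeasurable_sum => //.
  by move=> k t Tt _; rewrite lee_fin.
have Ig : mu.-integrable T g.
  apply/integrableP; split => //.
  rewrite (eq_integral (mu := mu) (D := T) g); last first.
    by move=> t _; rewrite gee0_abs//; apply: nneseries_ge0 => k _ _; rewrite lee_fin.
  by rewrite eqS; apply: le_lt_trans SM _; exact: ltry.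
have := @integrable_ae _ _ _ mu T (@mT R) g Ig; apply: aeS => t /= h Tt.
apply: nnseries_is_cvg => //; have := h Tt.
by rewrite ge0_fin_numE//; apply: nneseries_ge0 => k _ _; rewrite lee_fin.
Qed.

(** Cauchy-Schwarz against the constant 1, whose norm is 1 because the measure is normalized. *)
Lemma rI_modc F : L2 F -> rinte (fun t => modc (F t)) /\ rI (fun t => modc (F t)) <= l2n F.
Proof.
move=> LF; have mm : measurable_fun T (fun t => modc (F t)).
  have := cmeas_sqn (L2_meas LF); under [X in _ -> measurable_fun _ X]eq_fun do rewrite modcE.
  by move=> h; apply: measurableT_comp => //; apply: continuous_measurable_fun; exact: sqrt_continuous.
have I1 : rinte (fun t => modc (F t)).
  apply: (rinte_le mm _ (rinteD (L2_sqn LF) (rinte_cst 1))) => t _.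
  rewrite ger0_norm ?modc_ge0// (ger0_norm (addr_ge0 (sqn_ge0 _) ler01)) -modc_sqr.
  by have := sqr_ge0 (modc (F t) - 1); have := sqr_ge0 (modc (F t)); lra.
split => //.
have LL : L2 (fun t => (modc (F t))%:C).
  apply: (@L2_le _ _ F 1) => //; last by move=> t _; rewrite sqnC modc_sqr mul1r.
have := CS LL (@L2_cst R 1).
have -> : l2n (fun=> 1 : C) = 1.
  by rewrite /l2n -/(rI _) rI_cst sqn1 sqrtr1.
have -> : l2n (fun t => (modc (F t))%:C) = l2n F.
  congr Num.sqrt; apply: rI_eq => t _; by rewrite sqnC modc_sqr.
rewrite mulr1; apply: le_trans.
apply: le_trans (Re_le_modc _); apply: le_trans (ler_norm _).
by rewrite ipE cI_Re le_eqVlt; apply/orP; left; apply/eqP; apply: rI_eq => t _; rewrite cj1 mulr1.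
Qed.

Definition l2cauchy (Fk : nat -> R -> C) := forall e, 0 < e -> exists N, forall m n,
  (N <= m)%N -> (N <= n)%N -> l2n (fun t => Fk m t - Fk n t) <= e.

(** Riesz-Fischer. The almost-everywhere convergent subsequence stays in the statement because
    $|b|=1$ on the circle is later read off from pointwise limits. *)
Theorem L2_complete (Fk : nat -> R -> C) : (forall k, L2 (Fk k)) -> l2cauchy Fk ->
  exists F, [/\ L2 F, l2cvg Fk F & exists n_ : nat -> nat, (forall k, (k <= n_ k)%N) /\
    {ae mu, forall t, T t -> ccvg (fun k => Fk (n_ k) t) (F t)}].
Proof.
move=> LF cF.
have [N hN] : {N : nat -> nat & forall k m n, (N k <= m)%N -> (N k <= n)%N ->
    l2n (fun t => Fk m t - Fk n t) <= 2^-1 ^+ k}.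
  apply: (@choice _ _ (fun k N => forall m n, (N <= m)%N -> (N <= n)%N ->
    l2n (fun t => Fk m t - Fk n t) <= 2^-1 ^+ k)) => k.
  by apply: cF; rewrite exprn_gt0.
(* The maximum over $j\le k$ spares any monotonicity of [N]; adding [k] makes the indices tend to
   infinity. *)
pose n_ k := (\max_(j < k.+1) N j + k)%N.
have nN j k : (j <= k)%N -> (N j <= n_ k)%N.
  move=> jk; apply: leq_trans (leq_addr _ _).
  by have := @leq_bigmax _ (fun j : 'I_k.+1 => N j) (Ordinal (jk : (j < k.+1)%N)).
pose D k t := Fk (n_ k.+1) t - Fk (n_ k) t.
have LD k : L2 (D k) by exact: L2B.
have sumD n : \sum_(k < n) rI (fun t => modc (D k t)) <= 2.
  apply: (@le_trans _ _ (\sum_(k < n) 2^-1 ^+ k)).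
    apply: ler_sum => k _; apply: le_trans (rI_modc (LD k)).2 _.
    by apply: hN; apply: nN.
  have : forall n, \sum_(k < n) (2^-1 : R) ^+ k = 2 - 2 * 2^-1 ^+ n.
    elim=> [|m IH]; first by rewrite big_ord0 expr0 mulr1 subrr.
    by rewrite big_ord_recr /= IH exprS; field.
  by move=> ->; rewrite lerBlDr lerDl mulr_ge0// exprn_ge0.
have := rI_nneseries (fun k => (rI_modc (LD k)).1) (fun k t => modc_ge0 _) sumD.
move=> cvD.
(* An upper limit is measurable whether or not the sequence converges; its value on the exceptional
   null set is irrelevant. *)
pose Fr t := fine (limn_esup (fun k => (Re (Fk (n_ k) t))%:E)).
pose Fi t := fine (limn_esup (fun k => (Im (Fk (n_ k) t))%:E)).
pose F t : C := Complex (Fr t) (Fi t).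
have mF : cmeas F.
  split => /=.
    apply: (measurableT_comp (fine_measurable measurableT)).
    apply: measurable_fun_limn_esup => k; apply/measurable_EFinP.
    exact: (L2_meas (LF _)).1.
  apply: (measurableT_comp (fine_measurable measurableT)).
  apply: measurable_fun_limn_esup => k; apply/measurable_EFinP.
  exact: (L2_meas (LF _)).2.
have lim1 (u : nat -> R) : cvgn u -> u @ \oo --> fine (limn_esup (fun k => (u k)%:E)).
  move=> cu; have h : (fun k => (u k)%:E) @ \oo --> (limn u)%:E.
    by apply: cvg_EFin; [exact: nearW|exact: cu].
  by rewrite (cvg_limn_einf_sup h).2.
have aeF : {ae mu, forall t, T t -> ccvg (fun k => Fk (n_ k) t) (F t)}.
  apply: aeS cvD => t /= h /h {}h.
  have cv1 (p : C -> R) : (forall x y, p (x - y) = p x - p y) ->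
     (forall x, `|p x| <= modc x) -> cvgn (fun k => p (Fk (n_ k) t)).
    move=> pB pM.
    have tel : cvgn (series (telescope (fun k => p (Fk (n_ k) t)))).
      apply: normed_cvg; apply: (series_le_cvg _ _ _ h) => k //=.
      - exact: modc_ge0.
      - have -> : telescope (fun k => p (Fk (n_ k) t)) k = p (D k t) by rewrite pB.
        exact: pM.
    have -> : (fun k => p (Fk (n_ k) t)) =
       (fun k => p (Fk (n_ 0%N) t) + series (telescope (fun k => p (Fk (n_ k) t))) k).
      by apply: funext => k; rewrite -eq_sum_telescope.
    by apply: is_cvgD => //; exact: is_cvg_cst.
  split; apply: lim1.
    by apply: cv1 => [x y|x]; [rewrite cReD cReN|exact: Re_le_modc].
  by apply: cv1 => [x y|x]; [rewrite cImD cImN|exact: Im_le_modc].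
(* Fatou's lemma for the differences with the fixed term [Fk m] yields both $F-F_m\in L^2$ and the
   norm bound. *)
have key m e : 0 <= e -> (forall k, (m <= k)%N -> l2n (fun t => Fk k t - Fk m t) <= e) ->
    L2 (fun t => F t - Fk m t) /\ l2n (fun t => F t - Fk m t) <= e.
  move=> e0 he; have := @nsq_fatou (fun k t => Fk (n_ (k + m)%N) t - Fk m t)
    (fun t => F t - Fk m t) (e ^+ 2).
  case.
  - by move=> k; exact: L2B.
  - by apply: cmeasD => //; apply: cmeasN; exact: L2_meas.
  - move=> k; rewrite -l2n_sqr ler_sqr ?nnegrE ?l2n_ge0//; apply: he.
    by rewrite /n_ addnA leq_addl.
  - apply: aeS aeF => t /= h /h {}h; apply: ccvgB; last exact: ccvg_cst.
    have {}h : ccvg (fun k => Fk (n_ k) t) (F t) by [].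
    by apply: (@ccvg_sub _ _ (fun k => (k + m)%N) h) => k; exact: leq_addr.
  - by move=> L le; split => //; rewrite -(@ler_pXn2r _ 2) ?nnegrE ?l2n_ge0// l2n_sqr.
exists F; split.
- have [N0 h0] := cF 1 ltr01.
  have [|L _] := key N0 1 ler01; first by move=> k Nk; exact: h0.
  have := L2D L (LF N0); congr L2; by apply: funext => t; rewrite subrK.
- apply/cvgrPdist_le => e e0; have [N0 h0] := cF e e0.
  exists N0 => // k /= Nk; rewrite sub0r normrN ger0_norm ?l2n_ge0// l2n_sub.
  by have [|_] := key k e (ltW e0); first by move=> j kj; apply: h0 => //; exact: leq_trans kj.
- by exists n_; split => // k; exact: leq_addl.
Qed.

Lemma ip_cvgl (Fk : nat -> R -> C) F G : (forall k, L2 (Fk k)) -> L2 F -> L2 G ->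
  l2cvg Fk F -> ccvg (fun k => ip (Fk k) G) (ip F G).
Proof.
move=> LFk LF LG h; apply: ccvg_dist.
apply: (@squeeze_cvgr _ _ _ _ (fun=> 0) (fun k => l2n (fun t => Fk k t - F t) * l2n G)).
- apply: nearW => k; rewrite modc_ge0 /= -ipBl//; apply: CS => //; exact: L2B.
- exact: cvg_cst.
- by rewrite -[X in _ --> X](mul0r (l2n G)); apply: cvgM => //; exact: cvg_cst.
Qed.
Lemma l2n_cvg (Fk : nat -> R -> C) F : (forall k, L2 (Fk k)) -> L2 F ->
  l2cvg Fk F -> (fun k => l2n (Fk k)) @ \oo --> l2n F.
Proof.
move=> LFk LF h; apply/cvgrPdist_le => e e0.
move/cvgrPdist_le : h => /(_ e e0); apply: filterS => k.
rewrite sub0r normrN ger0_norm ?l2n_ge0// => le; rewrite ler_norml; apply/andP; split.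
  by rewrite lerNl opprB; apply: le_trans le; exact: l2n_dist.
by apply: le_trans le; rewrite l2n_sub; exact: l2n_dist.
Qed.

End Complete.

(** * Hardy space and Cauchy integral *)

Section Hardy.
Variable R : realType.
Local Notation C := R[i].
Local Notation Re := complex.Re.
Local Notation Im := complex.Im.
Local Notation T := (@Tdom R).
Local Notation mu := (@lebesgue_measure R).
Implicit Types (F G H : R -> C) (f g : R -> R) (z w : C).

Lemma expiD (a b : R) : expi (a + b) = expi a * expi b :> C.
Proof. by apply: cpxP; rewrite !cRI /= ?cosD ?sinD//; ring. Qed.
Lemma expi0 : expi 0 = 1 :> C. Proof. by rewrite /expi cos0 sin0. Qed.
Lemma expiX (a : R) n : expi (n%:R * a) = expi a ^+ n :> C.
Proof.
elim: n => [|n IH]; first by rewrite mul0r expi0 expr0.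
by rewrite -natr1 mulrDl mul1r expiD IH exprSr.
Qed.
Lemma expiJ (a : R) : (expi a)^* = expi (- a) :> C.
Proof. by apply: cpxP; rewrite !cRI /= ?cosN ?sinN. Qed.
Lemma sqn_expi (a : R) : sqn (expi a : C) = 1.
Proof. by rewrite sqnE /= cos2Dsin2. Qed.
Lemma modc_expi (a : R) : modc (expi a : C) = 1.
Proof. by rewrite modcE sqn_expi sqrtr1. Qed.
Lemma expi_neq0 (a : R) : expi a != 0 :> C.
Proof. by rewrite -sqn_eq0 sqn_expi oner_eq0. Qed.
Lemma expi_mulJ (a : R) : expi a * (expi a)^* = 1 :> C.
Proof. by rewrite mulcJ sqn_expi. Qed.
Lemma expi2pi : expi (2 * pi) = 1 :> C.
Proof. by rewrite mulr_natl /expi cos2pi sin2pi. Qed.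

Definition ccts F := continuous (fun t => Re (F t)) /\ continuous (fun t => Im (F t)).
Lemma ccts_meas F : ccts F -> cmeas F.
Proof.
move=> [a b]; split; apply: measurable_funTS; exact: continuous_measurable_fun.
Qed.
Lemma ccts_cst c : ccts (fun=> c).
Proof. by split => t; exact: cst_continuous. Qed.
Lemma ccts_expi : ccts (fun t : R => expi t).
Proof. by split => t; [exact: continuous_cos|exact: continuous_sin]. Qed.
Lemma cctsD F G : ccts F -> ccts G -> ccts (fun t => F t + G t).
Proof.
move=> [a b] [c d]; split => t.
  by under [fun t => Re _]eq_fun do rewrite cReD; apply: continuousD; [exact: a|exact: c].
by under [fun t => Im _]eq_fun do rewrite cImD; apply: continuousD; [exact: b|exact: d].
Qed.
Lemma cctsN F : ccts F -> ccts (fun t => - F t).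
Proof.
move=> [a b]; split => t.
  by under [fun t => Re _]eq_fun do rewrite cReN; apply: continuousN; exact: a.
by under [fun t => Im _]eq_fun do rewrite cImN; apply: continuousN; exact: b.
Qed.
Lemma cctsM F G : ccts F -> ccts G -> ccts (fun t => F t * G t).
Proof.
move=> [a b] [c d]; split => t.
  rewrite (_ : (fun x => Re (F x * G x)) = (fun x => Re (F x) * Re (G x) - Im (F x) * Im (G x))).
    exact: (@continuousB _ _ _ _ _ _ (continuousM (a t) (c t)) (continuousM (b t) (d t))).
  by apply: funext => x; rewrite cReM.
rewrite (_ : (fun x => Im (F x * G x)) = (fun x => Re (F x) * Im (G x) + Im (F x) * Re (G x))).
  exact: (@continuousD _ _ _ _ _ _ (continuousM (a t) (d t)) (continuousM (b t) (c t))).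
by apply: funext => x; rewrite cImM.
Qed.
Lemma cctsV F : ccts F -> (forall t, F t != 0) -> ccts (fun t => (F t)^-1).
Proof.
move=> [a b] F0.
have cs t : {for t, continuous (fun t => (sqn (F t))^-1)}.
  apply: (@continuousV _ _ (fun t => sqn (F t))); first by rewrite sqn_eq0.
  rewrite (_ : (fun t => sqn (F t)) = (fun t => Re (F t) * Re (F t) + Im (F t) * Im (F t))); last first.
    by apply: funext => x; rewrite sqnE !expr2.
  exact: (@continuousD _ _ _ _ _ _ (continuousM (a t) (a t)) (continuousM (b t) (b t))).
split => t.
  rewrite (_ : (fun x => Re (F x)^-1) = (fun x => Re (F x) * (sqn (F x))^-1)).
    exact: (continuousM (a t) (cs t)).
  by apply: funext => x; rewrite cReV.
rewrite (_ : (fun x => Im (F x)^-1) = (fun x => - (Im (F x) * (sqn (F x))^-1))).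
  exact: (continuousN (continuousM (b t) (cs t))).
by apply: funext => x; rewrite cImV.
Qed.

Lemma cI_expiX n : (0 < n)%N -> cI (fun t => expi t ^+ n) = 0 :> C.
Proof.
move=> n0; have nR : n%:R != 0 :> R by rewrite pnatr_eq0 -lt0n.
have e2 : expi (n%:R * (2 * pi)) = 1 :> C by rewrite expiX expi2pi expr1n.
have dl (x : R) : is_derive x 1 (fun t : R => n%:R * t) n%:R.
  by have := is_deriveZ n%:R (is_derive_id x 1); rewrite /GRing.scale/= mulr1.
have FTC (f F : R -> R) : (forall x : R, is_derive (x : R^o) (1 : R) (F : R^o -> R^o) (f x)) -> continuous f ->
    F (2 * pi) = F 0 -> rI f = 0.
  move=> dF cf F2; rewrite /rI /Rintegral.
  rewrite (@continuous_FTC2 _ f F) ?twopi_gt0//.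
  - by rewrite F2 -EFinB subrr mul0r.
  - by apply: continuous_subspaceT.
  - split.
    + by move=> x _; exact: (@ex_derive _ _ _ _ _ _ _ (dF x)).
    + apply: cvg_at_right_filter; apply: differentiable_continuous.
      by apply/derivable1_diffP; exact: (@ex_derive _ _ _ _ _ _ _ (dF 0)).
    + apply: cvg_at_left_filter; apply: differentiable_continuous.
      by apply/derivable1_diffP; exact: (@ex_derive _ _ _ _ _ _ _ (dF (2 * pi))).
  - by move=> x _; rewrite derive1E; exact: (@derive_val _ _ _ _ _ _ _ (dF x)).
have cl : continuous (fun t : R => n%:R * t).
  by move=> t; apply: (@continuousM _ _ (fun=> n%:R) id t); [exact: cst_continuous|exact: cvg_id].
apply: cpxP; rewrite ?cI_Re ?cI_Im /=.
  rewrite (_ : (fun t => _) = (fun t : R => cos (n%:R * t))); last first.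
    by apply: funext => t; rewrite -expiX.
  apply: (FTC _ (fun t => n%:R^-1 * sin (n%:R * t))).
  - move=> x; have h := is_derive1_comp (is_derive_sin _) (dl x).
    have := is_deriveZ n%:R^-1 h; rewrite /GRing.scale/= mulrCA mulVf// mulr1.
    by [].
  - by move=> t; apply: continuous_comp; [exact: cl|exact: continuous_cos].
  - have e2i : Im (expi (n%:R * (2 * pi)) : C) = 0 by rewrite e2.
    by rewrite mulr0 sin0; move: e2i => /= ->.
rewrite (_ : (fun t => _) = (fun t : R => sin (n%:R * t))); last first.
  by apply: funext => t; rewrite -expiX.
apply: (FTC _ (fun t => - n%:R^-1 * cos (n%:R * t))).
- move=> x; have h := is_derive1_comp (is_derive_cos _) (dl x).
  have := is_deriveZ (- n%:R^-1) h; rewrite /GRing.scale/= mulNr mulNr mulrN opprK mulrCA mulVf// mulr1.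
  by [].
- by move=> t; apply: continuous_comp; [exact: cl|exact: continuous_sin].
- have e2r : Re (expi (n%:R * (2 * pi)) : C) = 1 by rewrite e2.
  by rewrite mulr0 cos0; move: e2r => /= ->.
Qed.

Lemma bmeas_expiX n : bmeas (fun t : R => expi t ^+ n : C).
Proof.
split; last by exists 1 => t _; rewrite -modc_sqr modcX modc_expi !expr1n.
elim: n => [|n IH]; first by under [X in cmeas X]eq_fun do rewrite expr0; exact: cmeas_cst.
under [X in cmeas X]eq_fun do rewrite exprS.
by apply: cmeasM => //; apply: ccts_meas; exact: ccts_expi.
Qed.

Lemma H2P F : H2 F <-> L2 F /\ forall n, (0 < n)%N -> cI (fun t => F t * expi t ^+ n) = 0.
Proof.
have E n : ip F (fun t => expi (- (n%:R * t))) = cI (fun t => F t * expi t ^+ n).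
  by rewrite ipE; apply: cI_eq => t _; rewrite expiJ opprK expiX.
by split => -[LF h]; split => // n n0; [rewrite -E|rewrite E]; exact: h.
Qed.
Lemma H2_L2 F : H2 F -> L2 F. Proof. by case. Qed.

Definition ker z (t : R) : C := (1 - z^* * expi t)^-1.
Lemma modc_1sub z w : modc w <= 1 -> 1 - modc z <= modc (1 - z^* * w).
Proof.
move=> w1; apply: (le_trans _ (modc_subr _ _)); rewrite modc1 modcM modcJ lerD2l lerN2.
by rewrite ler_piMr ?modc_ge0.
Qed.
Lemma sub1_neq0 z w : sqn z < 1 -> modc w <= 1 -> 1 - z^* * w != 0.
Proof.
move=> z1 w1; rewrite -modc_gt0; apply: lt_le_trans (modc_1sub z w1).
by rewrite subr_gt0 modc_lt1.
Qed.
Lemma kerd_neq0 z t : sqn z < 1 -> 1 - z^* * expi t != 0.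
Proof. by move=> z1; apply: sub1_neq0 => //; rewrite modc_expi. Qed.
Lemma ker_le z t : sqn z < 1 -> modc (ker z t) <= (1 - modc z)^-1.
Proof.
move=> z1; have z1' : modc z < 1 by rewrite modc_lt1.
rewrite modcV lef_pV2 ?posrE ?subr_gt0//.
  by apply: modc_1sub; rewrite modc_expi.
by rewrite modc_gt0 kerd_neq0.
Qed.
Lemma ker_bmeas z : sqn z < 1 -> bmeas (ker z).
Proof.
move=> z1; split.
  apply: ccts_meas; apply: cctsV; last by move=> t; exact: kerd_neq0.
  by apply: cctsD; [exact: ccts_cst|apply: cctsN; apply: cctsM; [exact: ccts_cst|exact: ccts_expi]].
exists ((1 - modc z)^-1 ^+ 2) => t _; rewrite -modc_sqr lerXn2r ?nnegrE ?modc_ge0 ?ker_le//.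
by rewrite invr_ge0 subr_ge0 ltW// modc_lt1.
Qed.
Lemma ker_L2 z : sqn z < 1 -> L2 (ker z).
Proof. by move=> z1; exact/bmeas_L2/ker_bmeas. Qed.
Lemma kerE z t : sqn z < 1 -> ker z t = 1 + z^* * (expi t * ker z t).
Proof. by move=> z1; rewrite /ker; field; exact: kerd_neq0. Qed.

(** The geometric series of the kernel is unrolled one term at a time: each step produces a
    vanishing coefficient and a factor $\bar z$, so the integral is $\bar z^j$ times a quantity
    bounded in $j$. *)
Lemma gtail F z m : L2 F -> sqn z < 1 ->
  (forall n, (m <= n)%N -> cI (fun t => F t * expi t ^+ n) = 0) ->
  cI (fun t => F t * (expi t ^+ m * ker z t)) = 0.
Proof.
move=> LF z1 h; have z1' : modc z < 1 by rewrite modc_lt1.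
pose I j := cI (fun t => F t * (expi t ^+ (m + j) * ker z t)).
have bm j : bmeas (fun t => expi t ^+ j * ker z t : C).
  by apply: bmeasM; [exact: bmeas_expiX|exact: ker_bmeas].
have step j : I j = z^* * I j.+1.
  rewrite /I -cIZ; last by apply: cinteM => //; exact/bmeas_L2.
  rewrite -[LHS]subr0 -(h (m + j)%N (leq_addr _ _)) -cIB.
  - apply: cI_eq => t _; rewrite {1}(kerE t z1) addnS exprS; ring.
  - by apply: cinteM => //; exact/bmeas_L2.
  - by apply: cinteM => //; exact/bmeas_L2/bmeas_expiX.
have I0 j : I 0%N = z^* ^+ j * I j.
  elim: j => [|j IH]; first by rewrite expr0 mul1r.
  by rewrite IH step exprSr mulrA.
have bd j : modc (I j) <= l2n F * (1 - modc z)^-1.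
  have -> : I j = ip F (fun t => (expi t ^+ (m + j) * ker z t)^*).
    by rewrite ipE; apply: cI_eq => t _; rewrite cjK.
  apply: le_trans (CS LF _) _; first by apply: L2J; exact/bmeas_L2.
  rewrite ler_wpM2l ?l2n_ge0//.
  have e1 : l2n (fun=> 1 : C) = 1 by rewrite /l2n -/(rI _) rI_cst sqn1 sqrtr1.
  apply: (@le_trans _ _ ((1 - modc z)^-1 * l2n (fun=> 1 : C))); last by rewrite e1 mulr1.
  have -> : l2n (fun t => (expi t ^+ (m + j) * ker z t)^*) =
     l2n (fun t => (expi t ^+ (m + j) * ker z t)^* * 1).
    by congr l2n; apply: funext => t; rewrite mulr1.
  apply: l2nM; [by apply: bmeasJ|exact: L2_cst|by rewrite invr_ge0 subr_ge0 ltW|].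
  move=> t _; rewrite sqnJ -modc_sqr lerXn2r ?nnegrE ?modc_ge0 ?invr_ge0 ?subr_ge0 ?(ltW z1')//.
  by rewrite modcM modcX modc_expi expr1n mul1r ker_le.
suff : modc (I 0%N) <= 0.
  rewrite le_eqVlt ltNge modc_ge0 orbF modc_eq0 => /eqP <-.
  by apply: cI_eq => t _; rewrite addn0.
have cv : (fun n => modc z ^+ n * (l2n F * (1 - modc z)^-1)) @ \oo --> (0 * (l2n F * (1 - modc z)^-1) : R).
  apply: cvgM; last exact: cvg_cst.
  by apply: cvg_expr; rewrite ger0_norm ?modc_ge0.
rewrite mul0r in cv; rewrite -(cvg_lim _ cv)//; apply: limr_ge.
  by apply/cvg_ex; exists 0.
apply: nearW => j; rewrite (I0 j) modcM modcX modcJ.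
by rewrite ler_wpM2l ?exprn_ge0 ?modc_ge0.
Qed.

Lemma H2D F G : H2 F -> H2 G -> H2 (fun t => F t + G t).
Proof.
move=> /H2P[a b] /H2P[c d]; apply/H2P; split; first exact: L2D.
move=> n n0; rewrite (cI_eq (G := fun t => F t * expi t ^+ n + G t * expi t ^+ n)); last first.
  by move=> t _; rewrite mulrDl.
by rewrite cID ?b ?d ?addr0//; apply: cinteM => //; exact/bmeas_L2/bmeas_expiX.
Qed.
Lemma H2Z c F : H2 F -> H2 (fun t => c * F t).
Proof.
move=> /H2P[a b]; apply/H2P; split; first exact: L2Z.
move=> n n0; rewrite (cI_eq (G := fun t => c * (F t * expi t ^+ n))); last first.
  by move=> t _; rewrite mulrA.
by rewrite cIZ ?b ?mulr0//; apply: cinteM => //; exact/bmeas_L2/bmeas_expiX.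
Qed.
Lemma H2_eq F G : (forall t, F t = G t) -> H2 F -> H2 G.
Proof. by move=> /funext ->. Qed.
Lemma H2N F : H2 F -> H2 (fun t => - F t).
Proof. by move=> h; apply: (H2_eq _ (H2Z (-1) h)) => t; rewrite mulN1r. Qed.
Lemma H2B F G : H2 F -> H2 G -> H2 (fun t => F t - G t).
Proof. by move=> a b; apply: H2D => //; exact: H2N. Qed.
Lemma H2_cst (c : C) : H2 (fun _ : R => c).
Proof.
apply/H2P; split; first exact: L2_cst.
by move=> n n0; rewrite cIZ ?cI_expiX ?mulr0//; exact/L2_cinte/bmeas_L2/bmeas_expiX.
Qed.
Lemma H2_sum (I : Type) (r : seq I) (P : pred I) (F : I -> R -> C) :
  (forall i, P i -> H2 (F i)) -> H2 (fun t => \sum_(i <- r | P i) F i t).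
Proof.
move=> iF; elim: r => [|i r IH].
  by apply: (H2_eq _ (H2_cst 0)) => t; rewrite big_nil.
case: (boolP (P i)) => Pi; last by apply: (H2_eq _ IH) => t; rewrite big_cons (negbTE Pi).
by apply: (H2_eq _ (H2D (iF _ Pi) IH)) => t; rewrite big_cons Pi.
Qed.
Lemma H2_mulX F n : H2 F -> H2 (fun t => F t * expi t ^+ n).
Proof.
move=> /H2P[a b]; apply/H2P; split.
  by have := L2M (bmeas_expiX n) a; congr Defs.L2; apply: funext => t; rewrite mulrC.
move=> m m0; rewrite (cI_eq (G := fun t => F t * expi t ^+ (n + m))).
  by apply: b; rewrite addn_gt0 m0 orbT.
by move=> t _; rewrite -mulrA -exprD.
Qed.
Lemma H2_lim (Fk : nat -> R -> C) F : (forall k, H2 (Fk k)) -> L2 F -> l2cvg Fk F -> H2 F.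
Proof.
move=> h LF c; split => // n n0.
have L : L2 (fun t : R => expi (- (n%:R * t)) : C).
  have := bmeas_L2 (bmeasJ (bmeas_expiX n)); congr Defs.L2.
  by apply: funext => t; rewrite -expiX expiJ.
apply: (ccvg_unique (ip_cvgl (fun k => H2_L2 (h k)) LF L c)).
have -> : (fun k => ip (Fk k) (fun t => expi (- (n%:R * t)))) = fun=> 0.
  by apply: funext => k; case: (h k) => _; apply.
exact: ccvg_cst.
Qed.
Lemma H2_expiker F z : H2 F -> sqn z < 1 -> cI (fun t => F t * (expi t * ker z t)) = 0.
Proof. by move=> /H2P[a b] z1; apply: (gtail (m := 1%N)). Qed.
Lemma H2_ker z : sqn z < 1 -> H2 (ker z).
Proof.
move=> z1; apply/H2P; split; first exact: ker_L2.
move=> n n0; rewrite -[RHS](gtail (m := n) (L2_cst 1) z1).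
  by apply: cI_eq => t _; rewrite mul1r mulrC.
by move=> m nm; rewrite -[RHS](cI_expiX (leq_trans n0 nm)); apply: cI_eq => t _; rewrite mul1r.
Qed.

Lemma extE F z : ext F z = ip F (ker z). Proof. by []. Qed.
Lemma kerJE z t : sqn z < 1 -> (ker z t)^* * expi t = expi t + z * (ker z t)^*.
Proof.
move=> z1; rewrite {1}(kerE t z1) cjD cj1 !cjM cjK mulrDl mul1r; congr (_ + _).
rewrite -!mulrA; congr (_ * _); rewrite mulrC -mulrA expi_mulJ mulr1 //.
Qed.
(** Multiplication by $e^{it}$ becomes multiplication by $z$: by [kerJE] the two sides of one
    induction step differ by a negative Fourier coefficient of [F]. *)
Lemma ext_mulX F n z : H2 F -> sqn z < 1 -> ext (fun t => F t * expi t ^+ n) z = z ^+ n * ext F z.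
Proof.
move=> HF z1; elim: n => [|n IH].
  by rewrite expr0 mul1r; apply: ip_eq => // t; rewrite mulr1.
have HFn := H2_mulX n HF; have LFn := H2_L2 HFn.
rewrite exprS -mulrA -IH !extE !ipE.
rewrite -cIZ; last by apply: cinte_ip => //; exact: ker_L2.
rewrite -[RHS]add0r; have /H2P[_ /(_ n.+1 isT) <-] := HF.
rewrite -cID.
- apply: cI_eq => t _; rewrite exprSr -!mulrA; rewrite [expi t * _]mulrC kerJE//.
  by ring.
- by apply: cinteM; [exact: H2_L2|exact/bmeas_L2/bmeas_expiX].
- by apply: cinteZ; apply: cinte_ip => //; exact: ker_L2.
Qed.
Lemma extD F G z : H2 F -> H2 G -> sqn z < 1 -> ext (fun t => F t + G t) z = ext F z + ext G z.
Proof. by move=> a b z1; rewrite !extE ipDl//; [exact: H2_L2|exact: H2_L2|exact: ker_L2]. Qed.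
Lemma extZ c F z : H2 F -> sqn z < 1 -> ext (fun t => c * F t) z = c * ext F z.
Proof. by move=> a z1; rewrite !extE ipZl//; [exact: H2_L2|exact: ker_L2]. Qed.
Lemma ext_sum (I : Type) (r : seq I) (P : pred I) (F : I -> R -> C) z :
  (forall i, P i -> H2 (F i)) -> sqn z < 1 ->
  ext (fun t => \sum_(i <- r | P i) F i t) z = \sum_(i <- r | P i) ext (F i) z.
Proof. by move=> h z1; rewrite extE ip_suml//; [move=> i /h/H2_L2|exact: ker_L2]. Qed.
Lemma ext_cst c z : sqn z < 1 -> ext (fun=> c) z = c.
Proof.
move=> z1.
have h : ext (fun=> 1 : C) z = 1.
  rewrite extE (ipJ (ker_L2 z1) (L2_cst 1)) ipE.
  rewrite (cI_eq (G := fun t => 1 + z^* * (1 * (expi t * ker z t)))); last first.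
    by move=> t _; rewrite cj1 mulr1 {1}(kerE t z1) mul1r.
  have L : L2 (fun t => 1 * (expi t * ker z t)).
    apply: L2M; first exact: bmeas_cst.
    apply: L2M; last exact: ker_L2.
    by have := bmeas_expiX 1; congr bmeas.
  have e0 := H2_expiker (H2_cst 1) z1.
  rewrite cID; [|exact: cinte_cst|by apply: cinteZ; exact: L2_cinte].
  rewrite cIZ; last exact: L2_cinte.
  by rewrite e0 mulr0 addr0 cI_cst cj1.
rewrite -[RHS](mulr1 c) -h -extZ//; last exact: H2_cst.
by apply: ip_eq => // t; rewrite mulr1.
Qed.
(** The value $x$ solves $x=1+\bar w z\,x$, the extension of [kerE] to the disk. *)
Lemma ext_ker w z : sqn w < 1 -> sqn z < 1 -> ext (ker w) z = (1 - w^* * z)^-1.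
Proof.
move=> w1 z1.
have nz : 1 - w^* * z != 0 by apply: sub1_neq0 => //; rewrite ltW// modc_lt1.
have H2k := H2_mulX 1 (H2_ker w1).
have : ext (ker w) z = 1 + w^* * (z * ext (ker w) z).
  have := ext_mulX 1 (H2_ker w1) z1; rewrite expr1 => <-.
  rewrite -extZ// -{1}(ext_cst 1 z1) -extD//; [|exact: H2_cst|exact: H2Z].
  apply: ip_eq => // t; rewrite {1}(kerE t w1) expr1; congr (_ + _ * _); exact: mulrC.
set x := ext _ _ => e; apply: (mulfI nz); rewrite mulfV//.
by rewrite mulrBl mul1r {1}e; ring.
Qed.
Lemma ext_cvg (Fk : nat -> R -> C) F z : (forall k, L2 (Fk k)) -> L2 F -> l2cvg Fk F ->
  sqn z < 1 -> ccvg (fun k => ext (Fk k) z) (ext F z).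
Proof. by move=> a b c z1; apply: ip_cvgl => //; exact: ker_L2. Qed.

End Hardy.

(** * Radial limits *)

Section Fatou.
Variable R : realType.
Local Notation C := R[i].
Local Notation Re := complex.Re.
Local Notation Im := complex.Im.
Local Notation T := (@Tdom R).
Local Notation mu := (@lebesgue_measure R).
Implicit Types (F G H : R -> C) (f g u : R -> R) (z w : C).

Definition poisson z (t : R) : R := (1 - sqn z) * sqn (ker z t).

Lemma poissonE z t : sqn z < 1 ->
  (poisson z t)%:C = ker z t + (ker z t)^* - 1.
Proof.
move=> z1; have nz := kerd_neq0 t z1.
have nzJ : 1 - z * (expi t)^* != 0.
  rewrite -sqn_eq0 -sqnJ sqn_eq0 cjD cj1 cjN cjM cjK //.
rewrite /poisson rmorphM /= -mulcJ rmorphB /= -mulcJ /ker cjV cjD cj1 cjN cjM cjK.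
have eE := expi_mulJ t; have e0 := expi_neq0 t.
have eJ : (expi t)^* = (expi t)^-1 :> C by apply: (mulfI e0); rewrite eE mulfV.
rewrite eJ in nzJ *; field.
apply/and3P; split => //.
by move: nzJ; apply: contraNN => /eqP h; apply/eqP; rewrite -(subrK z (expi t)) h add0r divff ?subrr//;
  apply: contraNneq e0 => z0; move: h; rewrite z0 subr0 => ->.
Qed.

Lemma poisson_ge0 z t : sqn z < 1 -> 0 <= poisson z t.
Proof. by move=> z1; rewrite mulr_ge0 ?sqn_ge0// subr_ge0 ltW. Qed.
Lemma poisson_meas z : sqn z < 1 -> measurable_fun T (poisson z).
Proof.
move=> z1; apply: measurable_funM; first exact: measurable_cst.
by apply: cmeas_sqn; case: (ker_bmeas z1).
Qed.
Lemma poisson_le z t : sqn z < 1 -> poisson z t <= (1 - sqn z) * (1 - modc z)^-1 ^+ 2.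
Proof.
move=> z1; rewrite ler_wpM2l ?subr_ge0 ?(ltW z1)// -modc_sqr lerXn2r ?nnegrE ?modc_ge0 ?ker_le//.
by rewrite invr_ge0 subr_ge0 ltW// modc_lt1.
Qed.
Lemma rinteM_poisson u z : sqn z < 1 -> rinte u -> rinte (fun t => u t * poisson z t).
Proof.
move=> z1 iu; have := rinteZ ((1 - sqn z) * (1 - modc z)^-1 ^+ 2) iu.
apply: rinte_le.
  by apply: measurable_funM; [exact: rinte_meas|exact: poisson_meas].
move=> t _; rewrite normrM [leRHS]normrM [leRHS]mulrC ler_wpM2l// (ger0_norm (poisson_ge0 t z1)).
by apply: le_trans (ler_norm _); exact: poisson_le.
Qed.

(** The Poisson kernel is the conjugate of [ker z] plus $\bar z e^{it}$ times [ker z], and functions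
    of $H^2$ integrate to zero against the second term. *)
Lemma ext_poisson F z : H2 F -> sqn z < 1 ->
  Re (ext F z) = rI (fun t => Re (F t) * poisson z t) /\
  Im (ext F z) = rI (fun t => Im (F t) * poisson z t).
Proof.
move=> HF z1; have LF := H2_L2 HF.
suff -> : ext F z = cI (fun t => F t * (poisson z t)%:C).
  by split; rewrite ?cI_Re ?cI_Im; apply: rI_eq => t _; rewrite !cRI; ring.
have e0 := H2_expiker HF z1.
have L : L2 (fun t => expi t * ker z t).
  by apply: L2M; [have := bmeas_expiX R 1|exact: ker_L2].
rewrite extE ipE -[LHS]addr0 -(mulr0 (z^* )) -e0 -cIZ; last exact: cinteM.
rewrite -cID.
- apply: cI_eq => t _; rewrite (poissonE t z1) {3}(kerE t z1); ring.
- exact: cinte_ip (ker_L2 z1).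
- by apply: cinteZ; exact: cinteM.
Qed.

Lemma rI_poisson z : sqn z < 1 -> rI (poisson z) = 1.
Proof.
move=> z1; have [+ _] := ext_poisson (H2_cst 1) z1; rewrite ext_cst//= => ->.
by apply: rI_eq => t _; rewrite mul1r.
Qed.

Lemma sqn_1subr (r s : R) : sqn (1 - r%:C * expi s) = (1 - r) ^+ 2 + 2 * r * (1 - cos s).
Proof. by rewrite sqnE !cRI /=; have := cos2Dsin2 s; nra. Qed.

Lemma poisson_radial (r th t : R) :
  poisson (r%:C * expi th) t = (1 - r ^+ 2) / ((1 - r) ^+ 2 + 2 * r * (1 - cos (t - th))).
Proof.
rewrite /poisson /ker sqnM sqn_expi mulr1 sqnC sqnV; congr (_ / _).
by rewrite cjM cjC expiJ -mulrA -expiD [- th + t]addrC sqn_1subr.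
Qed.

(** Near 0 the cosine exceeds $1/2$, so the mean value theorem gives $\sin(s/2)\ge s/4$ for $s\ge0$;
    then $1-\cos s=2\sin^2(s/2)\ge s^2/8$. *)
Lemma cos_lower : exists2 e : R, 0 < e & forall s, `|s| < e -> s ^+ 2 / 8 <= 1 - cos s.
Proof.
have /cvgrPdist_lt /(_ (1 / 2)) : cos @ (0 : R) --> (1 : R) by rewrite -cos0; exact: continuous_cos.
move=> /(_ ltac:(lra)) [e /= e0 he]; exists e => // s se.
wlog s0 : s se / 0 <= s.
  move=> h; have [/h|/ltW s0] := leP 0 s; first exact.
  by have := h (- s); rewrite normrN cosN sqrrN oppr_ge0; exact.
rewrite ger0_norm// in se.
have sinh : s / 4 <= sin (s / 2).
  move: s0; rewrite le_eqVlt => /orP[/eqP <-|s0]; first by rewrite !mul0r sin0.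
  have s2 : 0 < s / 2 by lra.
  have [|c] := @MVT _ sin cos 0 (s / 2) s2 (fun x _ => is_derive_sin x).
    by apply: continuous_subspaceT; exact: continuous_sin.
  rewrite in_itv /= => /andP[c0 cs]; rewrite sin0 !subr0 => ->.
  have := he c; rewrite /= sub0r normrN ger0_norm; last exact: ltW.
  move=> /(_ ltac:(lra)); rewrite ltr_norml => /andP[_ h].
  by nra.
have -> : cos s = 1 - 2 * sin (s / 2) ^+ 2.
  have := cos_mulr2n (s / 2); rewrite -[(s / 2) *+ 2]mulr_natr divfK//.
  by move=> ->; have := cos2Dsin2 (s / 2); rewrite -mulr_natr; lra.
by nra.
Qed.

(** The upper restriction on $|s|$ keeps away from the zeros $\pm2\pi$ of $1-\cos$, which matter
    because the circle is cut open into $[0,2\pi]$. *)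
Lemma cos_upper (e : R) : 0 < e -> e <= pi -> exists2 c : R, 0 < c &
  forall s, e <= `|s| -> `|s| <= 2 * pi - e -> c <= 1 - cos s.
Proof.
move=> e0 epi.
have le : e / 2 <= pi - e / 2 by lra.
have [m mI mP] := @EVT_min _ sin _ _ le (continuous_subspaceT (@continuous_sin R)).
have m0 : 0 < sin m.
  by apply: sin_gt0_pi; move: mI; rewrite in_itv /= => /andP[h1 h2]; lra.
exists (2 * sin m ^+ 2); first by rewrite mulr_gt0// exprn_gt0.
move=> s es se.
have := mP (`|s| / 2); rewrite in_itv /= => /(_ ltac:(apply/andP; split; lra)) h.
have -> : cos s = 1 - 2 * sin (`|s| / 2) ^+ 2.
  have -> : cos s = cos `|s| by case: (ger0P s) => // _; rewrite cosN.
  have := cos_mulr2n (`|s| / 2); rewrite -[(`|s| / 2) *+ 2]mulr_natr divfK//.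
  by move=> ->; have := cos2Dsin2 (`|s| / 2); rewrite -mulr_natr; lra.
by nra.
Qed.

Definition chi (th rho t : R) : R := ((`|t - th| < rho)%R)%:R.

Lemma chi_restrict u th rho t : u t * chi th rho t = (u \_ (ball th rho)) t.
Proof.
rewrite /patch /chi; case: ifPn => [|] /=; rewrite ?inE ?notin_setE /ball /= distrC.
  by move=> ->; rewrite mulr1.
by move=> /negP/negbTE ->; rewrite mulr0.
Qed.

Lemma rinte_chi u th rho : rinte u -> rinte (fun t => u t * chi th rho t).
Proof.
move=> iu; apply: (rinte_le _ _ iu).
  apply: measurable_funM; first exact: rinte_meas.
  rewrite (_ : chi th rho = \1_(ball th rho)).
    by apply: measurable_indic; exact: measurable_ball.
  apply: funext => t; rewrite indicE /chi; congr (_%:R); congr (nat_of_bool _).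
  by apply/idP/idP; rewrite inE /ball /= distrC.
move=> t _; rewrite normrM ler_piMr// ger0_norm ?ler0n// /chi.
by case: (_ < _); rewrite ?ler01.
Qed.

Lemma lebesgue_pt_avg u th (e : R) : rinte u -> lebesgue_pt (u \_ T) th ->
  0 < th -> th < 2 * pi -> 0 < e ->
  exists2 eta : R, 0 < eta & forall rho, 0 < rho -> rho < eta ->
    2 * pi * rI (fun t => `|u t - u th| * chi th rho t) <= e * (rho * 2).
Proof.
move=> iu /fine_cvgP [[e1 /= e10 fin] /cvgrPdist_lt /(_ e) lim] th0 th1 e0.
have [e2 /= e20 he2] := lim e0.
pose m := Num.min (Num.min e1 e2) (Num.min th (2 * pi - th)).
exists m; first by rewrite !lt_min e10 e20 th0 subr_gt0 th1.
move=> rho rho0; rewrite !lt_min => /andP[/andP[r1 r2] /andP[r3 r4]].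
have iv : rinte (fun t => `|u t - u th|).
  by apply: rinte_norm; apply: rinteB => //; exact: rinte_cst.
have sub : ball th rho `<=` T.
  rewrite /Tdom => t; rewrite /ball /= in_itv /= ltr_distlC => /andP[a b]; apply/andP; split; lra.
have TB : T `&` ball th rho = ball th rho by apply/seteqP; split => x; [case|move=> h; split => //; exact: sub].
set v := fun t => `|u t - u th| in iv *.
have E : 2 * pi * rI (fun t => v t * chi th rho t) =
    fine (\int[mu]_(t in ball th rho) (v t)%:E)%E.
  rewrite /rI mulrC divfK ?twopi_neq0//.
  under [LHS]eq_Rintegral do rewrite chi_restrict.
  by rewrite -Rintegral_mkcondr TB.
have iB : (\int[mu]_(t in ball th rho) (v t)%:E)%E \is a fin_num.
  apply: (@integrable_fin_num _ _ _ mu); first exact: measurable_ball.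
  exact: (@integrableS _ _ _ mu T (ball th rho) _ (@mT R) (measurable_ball _ _) sub iv).
have nb : `|0 - rho| < e2 by rewrite sub0r normrN gtr0_norm.
have := he2 rho nb rho0; rewrite /= sub0r normrN.
have thT : th \in T by rewrite inE /Tdom /= in_itv /=; apply/andP; split; lra.
have D : davg (u \_ T) th rho = ((rho *+ 2)^-1%:E * \int[mu]_(t in ball th rho) (v t)%:E)%E.
  rewrite /davg /iavg lebesgue_measure_ball ?(ltW rho0)// inver mulrn_eq0 /= gt_eqF//.
  congr (_ * _)%E; apply: eq_integral => t; rewrite inE => Bt /=.
  by rewrite /v !patchE thT mem_set//; exact: sub.
rewrite D fineM// E /=; set I := fine _.
have I0 : 0 <= I by apply: fine_ge0; apply: integral_ge0 => t _; rewrite lee_fin normr_ge0.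
rewrite ger0_norm; last by rewrite mulr_ge0// invr_ge0 mulrn_wge0// ltW.
by rewrite mulrC ltr_pdivrMr ?mulrn_wgt0// mulr_natr => /ltW.
Qed.

(** A step-function majorant of the Poisson profile: the smallest $j$ with $s<2^jd$ satisfies
    $2^{j-1}d\le s$ unless $j=0$, so its single term already dominates. Averages over the balls of
    radius $2^jd$ then apply. *)
Lemma dyadic_bound (d s eta : R) n : 0 < d -> 0 <= s -> d < eta -> s < eta / 2 -> eta <= 2 ^+ n * d ->
  d / Num.max (d ^+ 2) (s ^+ 2) <=
  \sum_(j < n | 2 ^+ j * d < eta) 4 / (4 ^+ j * d) * ((s < 2 ^+ j * d)%R)%:R.
Proof.
move=> d0 s0 de se nd.
have exj : exists j, s < 2 ^+ j * d by exists n; lra.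
pose j := ex_minn exj.
have [jP jmin] : s < 2 ^+ j * d /\ forall k, s < 2 ^+ k * d -> (j <= k)%N.
  by rewrite /j; case: ex_minnP.
have jeta : 2 ^+ j * d < eta.
  case: (posnP j) => [->|j0]; first by rewrite expr0 mul1r.
  have : 2 ^+ j.-1 * d <= s.
    by rewrite leNgt; apply/negP => /jmin; rewrite leqNgt prednK// leqnn.
  by rewrite -{2}(prednK j0) exprS; lra.
have jn : (j < n)%N.
  rewrite ltnNge; apply/negP => nj.
  have : (2 : R) ^+ n <= 2 ^+ j by rewrite ler_eXn2l// ltr1n.
  by move=> /(ler_wpM2r (ltW d0)); lra.
rewrite (bigD1 (Ordinal jn)) //= jP mulr1 -[leLHS]addr0 lerD//; last first.
  by apply: sumr_ge0 => k _; rewrite mulr_ge0// ?ler0n// divr_ge0// mulr_ge0 ?exprn_ge0// ltW.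
case: (posnP j) => [->|j0].
  rewrite expr0 mul1r ler_pdivrMr; last by rewrite lt_max exprn_gt0.
  rewrite mulrAC ler_pdivlMr//; apply: le_trans (_ : 4 * d ^+ 2 <= _).
    by have := exprn_gt0 2 d0; rewrite expr2; nra.
  by rewrite ler_wpM2l// le_max lexx.
have js : 2 ^+ j.-1 * d <= s.
  by rewrite leNgt; apply/negP => /jmin; rewrite leqNgt prednK// leqnn.
have p0 : 0 < (2 : R) ^+ j.-1 * d by rewrite mulr_gt0 ?exprn_gt0.
have e4 : (4 : R) ^+ j * d ^+ 2 = 4 * (2 ^+ j.-1 * d) ^+ 2.
  rewrite -{1}(prednK j0) exprS exprMn -exprM mulnC exprM.
  by rewrite -[2 ^+ 2 : R]/(2 * 2) (_ : 2 * 2 = 4 :> R) ?mulrA//; ring.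
rewrite ler_pdivrMr; last by rewrite lt_max exprn_gt0.
rewrite mulrAC ler_pdivlMr ?mulr_gt0 ?exprn_gt0//.
apply: le_trans (_ : 4 * s ^+ 2 <= _); last by rewrite ler_wpM2l// le_max lexx orbT.
rewrite mulrCA -expr2 e4 ler_wpM2l//.
by rewrite lerXn2r ?nnegrE ?(ltW p0).
Qed.

Lemma sum_half n : \sum_(j < n) (2^-1 : R) ^+ j <= 2.
Proof.
have : \sum_(k < n) (2^-1 : R) ^+ k = 2 - 2 * 2^-1 ^+ n.
  elim: n => [|m IH]; first by rewrite big_ord0 expr0 mulr1 subrr.
  by rewrite big_ord_recr /= IH exprS; field.
by move=> ->; rewrite lerBlDr lerDl mulr_ge0// exprn_ge0.
Qed.

Lemma exp2_ge (x : R) : exists n : nat, x <= 2 ^+ n.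
Proof.
have [N hN] : exists N : nat, x <= N%:R.
  exists (Num.bound `|x|); apply: ltW; apply: le_lt_trans (ler_norm x) _.
  exact: archi_boundP (normr_ge0 x).
exists N; apply: le_trans hN _.
by rewrite -natrX ler_nat ltnW// ltn_expl.
Qed.

Lemma rI_sum (I : Type) (r : seq I) (P : pred I) (f_ : I -> R -> R) :
  (forall i, P i -> rinte (f_ i)) -> rinte (fun t => \sum_(i <- r | P i) f_ i t) /\
  rI (fun t => \sum_(i <- r | P i) f_ i t) = \sum_(i <- r | P i) rI (f_ i).
Proof.
move=> h; elim: r => [|i r [IH1 IH2]].
  rewrite big_nil; under eq_fun do rewrite big_nil.
  by split; [exact: rinte_cst|exact: rI_cst].
rewrite big_cons; under eq_fun do rewrite big_cons.
case: (boolP (P i)) => Pi; last by split.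
by split; [apply: rinteD => //; exact: h|rewrite rID ?IH2//; exact: h].
Qed.

Lemma dyadic_arith (q d e p : R) : q != 0 -> d != 0 -> p != 0 ->
  16 * (4 / (q * q * d)) * (e * p / (16 * 16) * (q * d * 2) / (2 * p)) = e / 4 / q.
Proof. by move=> q0 d0 p0; field; rewrite ?p0 ?q0 ?d0. Qed.

(** Fatou's theorem at a Lebesgue point. With $d=1-r$, the kernel near $\theta$ is at most a
    constant times $d/\max(d^2,s^2)$, hence a combination of dyadic averages; away from $\theta$ it
    is at most a constant times $d$. *)
Lemma poisson_lebesgue_pt u th (e : R) : rinte u -> lebesgue_pt (u \_ T) th ->
  0 < th -> th < 2 * pi -> 0 < e ->
  exists2 d : R, 0 < d & forall r, 1 - d < r -> r < 1 ->
   `|u th - rI (fun t => u t * poisson (r%:C * expi th) t)| <= e.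
Proof.
move=> iu lu th0 th1 e0.
have pi0 := pi_gt0 R.
have k0 : 0 < (16 : R) by [].
(* The factor $1/256$ makes the ball of radius $2^jd$ contribute at most $(e/4)2^{-j}$, for a total
   of $e/2$. *)
have [e' [e'0 e'E]] : exists e', 0 < e' /\ e' * (16 * 16) = e * pi.
  exists (e * pi / (16 * 16)); split; last by rewrite divfK// mulf_neq0// gt_eqF.
  by rewrite divr_gt0 ?mulr_gt0.
have [eta1 eta10 avg] := lebesgue_pt_avg iu lu th0 th1 e'0.
have [eta2 eta20 low] := cos_lower.
pose eta := Num.min (Num.min eta1 eta2) (Num.min th (2 * pi - th)).
have eta0 : 0 < eta by rewrite !lt_min eta10 eta20 th0 subr_gt0 th1.
have [l1 l2 l3 l4] : [/\ eta <= eta1, eta <= eta2, eta <= th & eta <= 2 * pi - th].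
  by rewrite /eta; split; rewrite !ge_min lexx ?orbT.
clearbody eta.
have eta20' : 0 < eta / 2 by lra.
have etapi : eta / 2 <= pi by lra.
have [c c0 upp] := cos_upper eta20' etapi.
pose v t := `|u t - u th|.
have iv : rinte v by apply: rinte_norm; apply: rinteB => //; exact: rinte_cst.
have v0 t : 0 <= v t by exact: normr_ge0.
pose V := rI v.
have V0 : 0 <= V by apply: rI_ge0.
(* The bound $1/2$ gives $2r\ge1$, [eta] makes the ball of radius $d$ admissible, and the last term
   keeps the far part below $e/2$. *)
pose d0 := Num.min (1 / 2) (Num.min eta (c * e / (4 * (V + 1)))).
exists d0.
  rewrite !lt_min eta0 /=; apply/andP; split; first by lra.
  by rewrite divr_gt0 ?mulr_gt0//; lra.
move=> r r1 r2; pose d := 1 - r.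
have d_gt0 : 0 < d by rewrite /d; lra.
have : d < d0 by rewrite /d; lra.
rewrite !lt_min => /andP[d1 /andP[d2 d3]].
have z1 : sqn (r%:C * expi th : C) < 1.
  by rewrite sqnM sqn_expi mulr1 sqnC; rewrite /d in d1; nra.
set P := poisson _.
have P0 t : 0 <= P t by exact: poisson_ge0.
have iuP : rinte (fun t => u t * P t) by exact: rinteM_poisson.
have iP1 : rinte P.
  by have := rinteM_poisson z1 (rinte_cst 1); apply: rinte_eq => t _; rewrite mul1r.
have ivP : rinte (fun t => v t * P t) by exact: rinteM_poisson.
have step1 : `|u th - rI (fun t => u t * P t)| <= rI (fun t => v t * P t).
  have -> : u th - rI (fun t => u t * P t) = rI (fun t => u th * P t - u t * P t).
    by rewrite rIB//; [rewrite rIZ// rI_poisson// mulr1|exact: rinteZ].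
  have ii : rinte (fun t => u th * P t - u t * P t) by apply: rinteB => //; exact: rinteZ.
  apply: le_trans (rI_norm ii) _; apply: rI_le => //; first exact: rinte_norm.
  by move=> t _; rewrite -mulrBl normrM distrC (ger0_norm (P0 t)).
apply: le_trans step1 _.
have [n nd] : exists n : nat, eta <= 2 ^+ n * d.
  have [n hn] := exp2_ge (eta / d); exists n.
  by move: hn; rewrite ler_pdivrMr.
pose a (j : 'I_n) := 16 * (4 / (4 ^+ j * d)).
have a0 j : 0 <= a j by rewrite mulr_ge0// divr_ge0// mulr_ge0 ?exprn_ge0// ltW.
pose f_ (j : 'I_n) t := a j * (v t * chi th (2 ^+ j * d) t).
have if_ j : rinte (f_ j) by apply: rinteZ; exact: rinte_chi.
have [is1 is2] := @rI_sum _ (index_enum 'I_n) (fun j => 2 ^+ j * d < eta) f_ (fun j _ => if_ j).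
have bound : rI (fun t => v t * P t) <= \sum_(j < n | 2 ^+ j * d < eta) rI (f_ j) + 2 * d / c * V.
  rewrite -is2 -rIZ// -rID//; last exact: rinteZ.
  apply: rI_le => //; first by apply: rinteD => //; exact: rinteZ.
  move=> t Tt.
  have -> : \sum_(j < n | 2 ^+ j * d < eta) f_ j t + 2 * d / c * v t = v t *
    (16 * (\sum_(j < n | 2 ^+ j * d < eta) 4 / (4 ^+ j * d) * chi th (2 ^+ j * d) t) + 2 * d / c).
    rewrite (mulrDr (v t)) (mulrC (v t) (2 * d / c)); congr (_ + _).
    rewrite !mulr_sumr; apply: eq_bigr => j _; rewrite /f_ /a; ring.
  apply: ler_wpM2l => //; rewrite /P poisson_radial.
  set s := t - th.
  have num : 1 - r ^+ 2 <= 2 * d by rewrite /d; nra.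
  have num0 : 0 <= 1 - r ^+ 2 by rewrite /d in d1; nra.
  have S0 : 0 <= \sum_(j < n | 2 ^+ j * d < eta) 4 / (4 ^+ j * d) * chi th (2 ^+ j * d) t.
    apply: sumr_ge0 => j _; rewrite mulr_ge0// ?ler0n// divr_ge0// mulr_ge0 ?exprn_ge0//.
    exact: ltW.
  have [ss|ss] := ltP `|s| (eta / 2).
    have ls : s ^+ 2 / 8 <= 1 - cos s by apply: low; lra.
    have := @dyadic_bound d `|s| eta n d_gt0 (normr_ge0 _) d2 ss nd.
    rewrite real_normK ?num_real// => dy.
    set m := Num.max _ _ in dy.
    have m0 : 0 < m by rewrite /m lt_max exprn_gt0.
    have den : m / 8 <= (1 - r) ^+ 2 + 2 * r * (1 - cos s).
      have s2 := sqr_ge0 s; have dd := exprn_gt0 2 d_gt0.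
      have : s ^+ 2 / 8 <= 2 * r * (1 - cos s) by rewrite /d in d1; nra.
      rewrite -/d /m => h; case: (leP (d ^+ 2) (s ^+ 2)) => _; lra.
    apply: (@le_trans _ _ (16 * (d / m))); last first.
      apply: (@le_trans _ _ (16 * (\sum_(j < n | 2 ^+ j * d < eta) 4 / (4 ^+ j * d) * chi th (2 ^+ j * d) t))).
        by rewrite ler_wpM2l.
      by rewrite lerDl divr_ge0 ?mulr_ge0 ?(ltW c0) ?(ltW d_gt0).
    rewrite ler_pdivrMr; last by lra.
    apply: (le_trans num); apply: (@le_trans _ _ (16 * (d / m) * (m / 8))).
      by rewrite (_ : 16 * (d / m) * (m / 8) = 2 * d)//; field; rewrite gt_eqF.
    by apply: ler_wpM2l => //; rewrite mulr_ge0// divr_ge0 ?ltW.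
  have hc : c <= 1 - cos s.
    apply: upp => //; move: Tt; rewrite /Tdom /= in_itv /= => /andP[t0 t1].
    by rewrite /s ler_norml; apply/andP; split; lra.
  have den : c <= (1 - r) ^+ 2 + 2 * r * (1 - cos s).
    have := sqr_ge0 (1 - r); rewrite /d in d1; nra.
  apply: (@le_trans _ _ (2 * d / c)); last by rewrite lerDr mulr_ge0.
  apply: (@le_trans _ _ ((1 - r ^+ 2) / c)).
    by rewrite ler_wpM2l// lef_pV2 ?posrE//; apply: lt_le_trans den.
  by rewrite ler_wpM2r// invr_ge0 ltW.
apply: le_trans bound _.
have b1 : \sum_(j < n | 2 ^+ j * d < eta) rI (f_ j) <= e / 2.
  apply: (@le_trans _ _ (\sum_(j < n | 2 ^+ j * d < eta) e / 4 * 2^-1 ^+ j)).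
    apply: ler_sum => j je; rewrite /f_ rIZ; last exact: rinte_chi.
    have := avg (2 ^+ j * d) ltac:(by rewrite mulr_gt0 ?exprn_gt0) (lt_le_trans je l1).
    rewrite -/v; set X := rI _ => h.
    have h' : X <= e' * (2 ^+ j * d * 2) / (2 * pi) by rewrite ler_pdivlMr ?twopi_gt0// mulrC.
    apply: le_trans (ler_wpM2l (a0 j) h') _.
    have {}e'E : e' = e * pi / (16 * 16) by rewrite -e'E mulfK// mulf_neq0// gt_eqF.
    rewrite /a e'E exprVn le_eqVlt; apply/orP; left; apply/eqP.
    have -> : (4 : R) ^+ j = 2 ^+ j * 2 ^+ j by rewrite -exprMn; congr (_ ^+ _); ring.
    by apply: dyadic_arith; rewrite gt_eqF ?exprn_gt0.
  rewrite -mulr_sumr; apply: (@le_trans _ _ (e / 4 * 2)); last by lra.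
  rewrite ler_wpM2l ?divr_ge0 ?(ltW e0)//; apply: le_trans (sum_half n).
  rewrite [leRHS](bigID (fun j : 'I_n => 2 ^+ j * d < eta)) /= lerDl.
  by apply: sumr_ge0 => j _; rewrite exprn_ge0.
have b2 : 2 * d / c * V <= e / 2.
  move: d3; rewrite ltr_pdivlMr; last by lra.
  move=> h; rewrite mulrAC ler_pdivrMr//; nra.
lra.
Qed.

Theorem radial_limit F : H2 F -> {ae mu, forall t, T t -> forall e : R, 0 < e ->
  exists2 d : R, 0 < d & forall r, 1 - d < r -> r < 1 ->
    modc (F t - ext F (r%:C * expi t)) <= e}.
Proof.
move=> HF; have [iR iI] := L2_cinte (H2_L2 HF).
have l1 := lebesgue_differentiation (integrable_locally_restrict (@mT R) iR).
have l2 := lebesgue_differentiation (integrable_locally_restrict (@mT R) iI).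
(* The endpoints are dropped because the averaging balls must lie inside the parameter interval. *)
have n0 : {ae mu, forall t : R, t <> 0 /\ t <> 2 * pi}.
  have : mu.-negligible [set (0 : R); 2 * pi].
    by apply: negligibleU; apply/negligibleP => //; exact: lebesgue_measure_set1.
  apply: negligibleS => t /=; rewrite not_andP => -[/contrapT ->|/contrapT ->]; [by left|by right].
apply: aeS (aeI n0 (aeI l1 l2)) => t [[t0 t1] [h1 h2]] Tt e e0.
have [p0 p1] : 0 < t /\ t < 2 * pi.
  move: Tt; rewrite /Tdom /= in_itv /= => /andP[a b].
  by split; rewrite lt_neqAle ?a ?b andbT; apply/eqP => // /esym.
have e2 : 0 < e / 2 by lra.
have [d1 d10 k1] := poisson_lebesgue_pt iR h1 p0 p1 e2.
have [d2 d20 k2] := poisson_lebesgue_pt iI h2 p0 p1 e2.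
exists (Num.min 1 (Num.min d1 d2)); first by rewrite !lt_min ltr01 d10 d20.
move=> r; rewrite ltrBlDr -ltrBlDl !lt_min => /andP[ra /andP[rb rc]] r1.
have z1 : sqn (r%:C * expi t : C) < 1.
  by rewrite sqnM sqn_expi mulr1 sqnC; nra.
have [E1 E2] := ext_poisson HF z1.
apply: le_trans (modc_le_ReIm _) _; rewrite cReD cReN cImD cImN E1 E2.
have := k1 r ltac:(lra) r1; have := k2 r ltac:(lra) r1; lra.
Qed.

End Fatou.

(** * Density of polynomials and multiplicativity of the extension *)

Section Product.
Variable R : realType.
Local Notation C := R[i].
Local Notation Re := complex.Re.
Local Notation Im := complex.Im.
Local Notation T := (@Tdom R).
Local Notation mu := (@lebesgue_measure R).
Implicit Types (F G H : R -> C) (f g u : R -> R) (z w : C).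

Lemma mono_cauchy (a : nat -> R) (M : R) : (forall m n, (m <= n)%N -> a m <= a n) ->
  (forall n, a n <= M) -> forall e, 0 < e -> exists N, forall m n, (N <= m)%N -> (m <= n)%N ->
  a n - a m <= e.
Proof.
move=> mono bd e e0.
have ca : cvgn a by apply: nondecreasing_is_cvgn => //; exists M => _ [n _ <-].
have le n : a n <= limn a by apply: nondecreasing_cvgn_le.
move/cvgrPdist_le : ca => /(_ e e0)[N _ hN]; exists N => m n Nm mn.
have := hN m Nm; rewrite ger0_norm ?subr_ge0// => h.
by have := le n; lra.
Qed.

(** A common convergence criterion for orthogonal projections, partial Blaschke products and the
    Abel-Dini series: squared distances are bounded by increments of a bounded sequence. *)
Lemma l2cauchy_mono (Fk : nat -> R -> C) (a : nat -> R) (M : R) :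
  (forall m n, (m <= n)%N -> l2n (fun t => Fk n t - Fk m t) ^+ 2 <= a n - a m) ->
  (forall n, a n <= M) -> l2cauchy Fk.
Proof.
move=> h bd e e0.
have mono m n : (m <= n)%N -> a m <= a n.
  by move=> /h hh; rewrite -subr_ge0; exact: le_trans (sqr_ge0 _) hh.
have [N hN] := mono_cauchy mono bd (exprn_gt0 2 e0); exists N => m n Nm Nn.
wlog mn : m n Nm Nn / (n <= m)%N.
  move=> W; have [/W|/ltnW mn] := leqP n m; first exact.
  by rewrite l2n_sub; exact: W.
rewrite -(@ler_pXn2r _ 2) ?nnegrE ?l2n_ge0 ?(ltW e0)//.
by apply: le_trans (h _ _ mn) _; exact: hN.
Qed.

(** * Orthogonal projection onto the span of a sequence *)

Section Projection.
Variable v : nat -> R -> C.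
Hypothesis Lv : forall n, L2 (v n).
Definition lcomb N (a : nat -> C) t := \sum_(m < N) a m * v m t.
Lemma lcomb_L2 N a : L2 (lcomb N a).
Proof. by apply: L2_sum => m _; exact: L2Z. Qed.
Lemma ip_lcombl N a G : L2 G -> ip (lcomb N a) G = \sum_(m < N) a m * ip (v m) G.
Proof.
move=> LG; rewrite ip_suml//; last by move=> m _; exact: L2Z.
by apply: eq_bigr => m _; rewrite ipZl.
Qed.
Lemma ip_lcombr N a G : L2 G -> ip G (lcomb N a) = \sum_(m < N) (a m)^* * ip G (v m).
Proof.
move=> LG; rewrite ip_sumr//; last by move=> m _; exact: L2Z.
by apply: eq_bigr => m _; rewrite ipZr.
Qed.

(** Gram-Schmidt without linear independence: [w] is the part of [v N] orthogonal to the earlier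
    vectors, and the remainder of [F] is corrected along [w]. *)
Lemma proj_ex N F : L2 F -> exists a, forall n, (n < N)%N ->
  ip (fun t => F t - lcomb N a t) (v n) = 0.
Proof.
elim: N F => [|N IH] F LF; first by exists (fun=> 0).
have [a ha] := IH F LF; have [b hb] := IH (v N) (Lv N).
pose E t := F t - lcomb N a t; pose w t := v N t - lcomb N b t.
have LE : L2 E by apply: L2B => //; exact: lcomb_L2.
have Lw : L2 w by apply: L2B => //; exact: lcomb_L2.
pose c := ip E w / (nsq w)%:C.
pose a' m := if m == N then c else a m - c * b m.
have E' : (fun t => F t - lcomb N.+1 a' t) = (fun t => E t - c * w t).
  apply: funext => t; rewrite /lcomb big_ord_recr /= {2}/a' eqxx /E /w /lcomb.
  have -> : \sum_(i < N) a' i * v i t = \sum_(m < N) a m * v m t - c * \sum_(m < N) b m * v m t.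
    rewrite mulr_sumr -sumrB; apply: eq_bigr => i _.
    by rewrite /a' ltn_eqF//; ring.
  ring.
exists a' => n; rewrite ltnS E' => nN.
have LcW : L2 (fun t => c * w t) by exact: L2Z.
have key k : (k < N)%N -> ip (fun t => E t - c * w t) (v k) = 0.
  by move=> kN; rewrite ipBl// ipZl// ha// hb// mulr0 subr0.
move: nN; rewrite leq_eqVlt => /orP[/eqP ->|]; last exact: key.
have -> : ip (fun t => E t - c * w t) (v N) =
   ip (fun t => E t - c * w t) w + ip (fun t => E t - c * w t) (lcomb N b).
  rewrite -ipDr//; [|exact: lcomb_L2|exact: L2B].
  by apply: ip_eq => // t; rewrite subrK.
rewrite ip_lcombr; last exact: L2B.
rewrite [X in _ + X]big1 ?addr0; last by move=> m _; rewrite key ?mulr0.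
rewrite ipBl// ipZl// ip_nsq /c.
(* If [w] is null, its inner product with [E] vanishes and nothing has to be corrected. *)
have [w0|w0] := eqVneq (nsq w) 0.
  by rewrite w0 nsq0_ip// mul0r mul0r subr0.
by rewrite divfK ?subrr//; apply: contra w0 => /eqP/complexI/eqP.
Qed.

(** The [v n] need not be orthogonal, so the coefficients [a N] change with [N]; by Pythagoras the
    norms of the projections increase and stay bounded, which gives convergence. *)
Lemma proj_lim F : L2 F -> exists (a : nat -> nat -> C) P,
  [/\ L2 P, l2cvg (fun N => lcomb N (a N)) P, forall n, ip (fun t => F t - P t) (v n) = 0 &
   forall N, l2n (lcomb N (a N)) <= l2n F].
Proof.
move=> LF; have [a ha] := @choice _ _ _ (fun N => proj_ex N LF).
pose P N := lcomb N (a N).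
have LP N : L2 (P N) by exact: lcomb_L2.
have orth N M G : (N <= M)%N -> L2 G -> (forall n, (n < N)%N -> ip G (v n) = 0) -> ip G (P N) = 0.
  move=> NM LG h; rewrite ip_lcombr// big1// => m _; rewrite h ?mulr0//.
have pyth F1 G1 : L2 F1 -> L2 G1 -> ip (fun t => F1 t - G1 t) G1 = 0 ->
    nsq F1 = nsq G1 + nsq (fun t => F1 t - G1 t).
  move=> L1 L2' o; have -> : nsq F1 = nsq (fun t => (F1 t - G1 t) + G1 t).
    by congr nsq; apply: funext => t; rewrite subrK.
  by rewrite nsqD ?o ?mulr0 ?addr0 1?addrC//; exact: L2B.
have bd N : nsq (P N) <= nsq F.
  rewrite (pyth F (P N))// ?lerDl ?nsq_ge0//.
  by apply: (orth N N) => //; [exact: L2B|exact: ha].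
have [|P' [LP' cP _]] := @L2_complete _ P LP.
  apply: (@l2cauchy_mono P (fun N => nsq (P N)) (nsq F)) => // m n mn.
  rewrite l2n_sqr [nsq (P n)](pyth _ (P m))//; first by rewrite [X in X - _]addrC addrK.
  apply: (orth m n) => //; first exact: L2B.
  move=> k km; have := ha m k km; have := ha n k (leq_trans km mn).
  rewrite (ipBl LF (LP n) (Lv k)) (ipBl LF (LP m) (Lv k)) (ipBl (LP n) (LP m) (Lv k)).
  move=> /eqP; rewrite subr_eq0 => /eqP <- /eqP.
  by rewrite subr_eq0 => /eqP ->; rewrite subrr.
exists a, P'; split => //; last first.
  move=> N; rewrite -(@ler_pXn2r _ 2) ?nnegrE ?l2n_ge0// !l2n_sqr.
  exact: bd.
move=> n; rewrite ipBl//.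
have c1 := ip_cvgl LP LP' (Lv n) cP.
have c2 : ccvg (fun N => ip (P (N + n.+1)%N) (v n)) (ip P' (v n)).
  by apply: (ccvg_sub c1) => k; exact: leq_addr.
have c3 : ccvg (fun N => ip (P (N + n.+1)%N) (v n)) (ip F (v n)).
  have -> : (fun N => ip (P (N + n.+1)%N) (v n)) = fun=> ip F (v n); last exact: ccvg_cst.
  apply: funext => N; have := ha (N + n.+1)%N n; rewrite -ltnS -addnS leq_addl => /(_ isT).
  by rewrite (ipBl LF (LP (N + n.+1)%N) (Lv n)) => /eqP; rewrite subr_eq0 => /eqP ->.
by rewrite (ccvg_unique c2 c3) subrr.
Qed.
End Projection.

(** Uniqueness of Fourier coefficients by way of the disk: if they all vanish, so does the
    extension, whose radial limits are [F] almost everywhere. *)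
Lemma H2_coef0 F : H2 F -> (forall n, ip F (fun t => expi t ^+ n) = 0) ->
  {ae mu, forall t, T t -> F t = 0}.
Proof.
move=> HF h; have LF := H2_L2 HF.
have e0 z : sqn z < 1 -> ext F z = 0.
  move=> z1; have := @gtail _ (fun t => (F t)^* ) z 0 (L2J LF) z1.
  have hJ : forall n, (0 <= n)%N -> cI (fun t => (F t)^* * expi t ^+ n) = 0.
    move=> n _; rewrite -[RHS](cj0 R) -(h n) ipE -cIJ.
      by apply: cI_eq => t _; rewrite cjM cjK.
    by apply: cinte_ip => //; exact/bmeas_L2/bmeas_expiX.
  move=> /(_ hJ) e; rewrite -[LHS]cjK -[RHS](cj0 R) -e extE ipE -cIJ; last first.
    by apply: cinte_ip => //; exact: ker_L2.
  by congr (_^* ); apply: cI_eq => t _; rewrite cjM cjK expr0 mul1r.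
have := radial_limit HF; apply: aeS => t /= h1 Tt; apply/eqP; rewrite -modc_eq0 eq_le modc_ge0 andbT.
apply/ler_addgt0Pr => e ep; rewrite add0r.
have [d d0 hd] := h1 Tt e ep.
pose r := 1 - Num.min (d / 2) (1 / 2).
have [m1 m2 m3] : [/\ 0 < 1 - r, 1 - r <= d / 2 & 1 - r <= 1 / 2].
  rewrite /r opprB addrCA subrr addr0; split; rewrite ?ge_min ?lexx ?orbT//.
  by rewrite lt_min; apply/andP; split; lra.
have := hd r ltac:(lra) ltac:(lra); rewrite e0 ?subr0//.
by rewrite sqnM sqn_expi mulr1 sqnC; nra.
Qed.

Definition epol := fun n (t : R) => expi t ^+ n : C.
Lemma epol_L2 n : L2 (epol n). Proof. exact/bmeas_L2/bmeas_expiX. Qed.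
Lemma epol_H2 n : H2 (epol n).
Proof. by apply: (H2_eq _ (H2_mulX n (H2_cst (1 : C)))) => t; rewrite mul1r. Qed.
Lemma lcomb_epol_H2 N a : H2 (lcomb epol N a).
Proof. by apply: H2_sum => m _; apply: H2Z; exact: epol_H2. Qed.

Lemma H2_density G : H2 G -> exists a : nat -> nat -> C,
  l2cvg (fun N => lcomb epol N (a N)) G.
Proof.
move=> HG; have LG := H2_L2 HG.
have [a [P [LP cP oP _]]] := proj_lim epol_L2 LG; exists a.
have HP : H2 P by apply: H2_lim cP => // N; exact: lcomb_epol_H2.
have ae0 := H2_coef0 (H2B HG HP) oP.
have E N : l2n (fun t => lcomb epol N (a N) t - G t) = l2n (fun t => lcomb epol N (a N) t - P t).
  have LS : L2 (lcomb epol N (a N)) by exact: lcomb_L2 epol_L2 _ _.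
  congr Num.sqrt; apply: rI_aeeq.
  - by apply: cmeas_sqn; apply: L2_meas; exact: L2B.
  - by apply: cmeas_sqn; apply: L2_meas; exact: L2B.
  - by apply: aeS ae0 => t /= h /h /eqP; rewrite subr_eq0 => /eqP ->.
rewrite /l2cvg (_ : (fun k => l2n _) = (fun k => l2n (fun t => lcomb epol k (a k) t - P t))) //.
exact: funext.
Qed.

(** For a polynomial [G] this is [ext_mulX]. The passage to the limit in [G] works although $FG$ is
    only integrable: the value at [z], as a function of [G], is the inner product with [W], which is
    in $L^2$ because the kernel is bounded. *)
Theorem ext_mul F G z : H2 F -> H2 G -> sqn z < 1 ->
  ext (fun t => F t * G t) z = ext F z * ext G z.
Proof.
move=> HF HG z1; have LF := H2_L2 HF; have LG := H2_L2 HG.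
have [a ca] := H2_density HG.
pose W t := (F t)^* * ker z t.
have LW : L2 W.
  have := L2M (ker_bmeas z1) (L2J LF); congr Defs.L2.
  by apply: funext => t; rewrite mulrC.
have E K : ip K W = ext (fun t => F t * K t) z.
  by rewrite extE !ipE; apply: cI_eq => t _; rewrite /W cjM cjK; ring.
have LP N : L2 (lcomb epol N (a N)) by exact: lcomb_L2 epol_L2 _ _.
have c1 := ip_cvgl LP LG LW ca; rewrite E in c1.
have c2 := ext_cvg LP LG ca z1.
apply: (ccvg_unique c1).
have -> : (fun N => ip (lcomb epol N (a N)) W) = (fun N => ext F z * ext (lcomb epol N (a N)) z).
  apply: funext => N; rewrite ip_lcombl//; last exact: epol_L2.
  rewrite ext_sum//; last by move=> i _; apply: H2Z; exact: epol_H2.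
  rewrite mulr_sumr; apply: eq_bigr => i _; rewrite E ext_mulX// extZ//; last exact: epol_H2.
  have := @ext_mulX _ (fun=> 1) i z (H2_cst 1) z1.
  rewrite ext_cst// mulr1 => <-.
  have -> : ext (fun t => 1 * expi t ^+ i) z = ext (epol i) z by apply: ip_eq => // t; rewrite mul1r.
  ring.
by apply: ccvgM => //; exact: ccvg_cst.
Qed.

Lemma ker0 t : ker (0 : C) t = 1.
Proof. by rewrite /ker cj0 mul0r subr0 invr1. Qed.

(** The $n$-th negative coefficient of $FG$ is the value at 0 of $F\cdot Ge^{int}$, which contains
    the factor $0^n$. *)
Lemma H2M F G : bmeas F -> H2 F -> H2 G -> H2 (fun t => F t * G t).
Proof.
move=> bF HF HG; apply/H2P; split; first by apply: L2M => //; exact: H2_L2.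
move=> n n0; have z0 : sqn (0 : C) < 1 by rewrite sqn0.
have := ext_mul HF (H2_mulX n HG) z0; rewrite ext_mulX// expr0n gtn_eqF// mul0r mulr0 => <-.
by rewrite extE ipE; apply: cI_eq => t _; rewrite ker0 cj1 mulr1 mulrA.
Qed.

(** * Bounded analytic functions given by a formula on the closed disk *)

Implicit Types (k : C).
(** A substitute for the bounded analytic functions: one formula on circle and disk, reproduced by
    its Cauchy integral. The class is an algebra containing the kernels, hence every rational
    function used below. *)
Definition holo (f : C -> C) := [/\ bmeas (fun t => f (expi t)),
  H2 (fun t => f (expi t)) & forall z, sqn z < 1 -> ext (fun t => f (expi t)) z = f z].
Lemma holo_cst c : holo (fun=> c).
Proof. by split; [exact: bmeas_cst|exact: H2_cst|move=> z; exact: ext_cst]. Qed.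
Lemma holo_id : holo id.
Proof.
split.
- by have := bmeas_expiX R 1.
- by have := epol_H2 1.
- move=> z z1; have := @ext_mulX _ (fun=> 1) 1 z (H2_cst 1) z1.
  rewrite ext_cst// mulr1 expr1 => h; rewrite -[RHS]h.
  by apply: ip_eq => // t; rewrite mul1r.
Qed.
Lemma holoD (f g : C -> C) : holo f -> holo g -> holo (fun z => f z + g z).
Proof.
move=> [a b c] [d e h]; split; [exact: bmeasD|exact: H2D|].
by move=> z z1; rewrite extD// c// h.
Qed.
Lemma holoM (f g : C -> C) : holo f -> holo g -> holo (fun z => f z * g z).
Proof.
move=> [a b c] [d e h]; split; [exact: bmeasM|exact: H2M|].
by move=> z z1; rewrite ext_mul// c// h.
Qed.
Lemma holoZ k (f : C -> C) : holo f -> holo (fun z => k * f z).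
Proof. by move=> h; apply: (holoM (holo_cst k)). Qed.
Lemma holoN (f : C -> C) : holo f -> holo (fun z => - f z).
Proof.
move=> h; have -> : (fun z => - f z) = (fun z => -1 * f z).
  by apply: funext => z; rewrite mulN1r.
exact: holoZ.
Qed.
Lemma holoB (f g : C -> C) : holo f -> holo g -> holo (fun z => f z - g z).
Proof. by move=> a b; apply: holoD => //; exact: holoN. Qed.
Lemma holo_ker w : sqn w < 1 -> holo (fun z => (1 - w^* * z)^-1).
Proof.
move=> w1; split; [exact: ker_bmeas|exact: H2_ker|].
by move=> z z1; exact: ext_ker.
Qed.
Lemma holo_prod (I : Type) (r : seq I) (P : pred I) (f : I -> C -> C) :
  (forall i, P i -> holo (f i)) -> holo (fun z => \prod_(i <- r | P i) f i z).
Proof.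
move=> h; elim: r => [|i r IH].
  by under eq_fun do rewrite big_nil; exact: holo_cst.
under eq_fun do rewrite big_cons.
by case: (boolP (P i)) => Pi; [apply: holoM => //; exact: h|exact: IH].
Qed.
Lemma holo_sum (I : Type) (r : seq I) (P : pred I) (f : I -> C -> C) :
  (forall i, P i -> holo (f i)) -> holo (fun z => \sum_(i <- r | P i) f i z).
Proof.
move=> h; elim: r => [|i r IH].
  by under eq_fun do rewrite big_nil; exact: holo_cst.
under eq_fun do rewrite big_cons.
by case: (boolP (P i)) => Pi; [apply: holoD => //; exact: h|exact: IH].
Qed.

End Product.

(** * Bounded interpolation of finitely many values *)

Section Jones.
Variable R : realType.
Local Notation C := R[i].
Local Notation Re := complex.Re.
Local Notation Im := complex.Im.
Implicit Types (z w : C).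

(** Remove an element of smallest [rho]: its product runs over all of [A], and
    $\frac{a}{1+a}Q+1-Q=1-\frac{Q}{1+a}$. This is the rational counterpart of the bound $\sum_j
    a_j\exp(-\sum_{k\ge j}a_k)\le1$ in Jones's argument. *)
Lemma telescope_prod (I : finType) (rho a : I -> R) (A : {set I}) : (forall i, 0 <= a i) ->
  \sum_(j in A) a j * \prod_(k in A | rho j <= rho k) (1 + a k)^-1 <=
  1 - \prod_(k in A) (1 + a k)^-1.
Proof.
move=> a0; have [n] := ubnP #|A|; elim: n A => // n IH A.
rewrite ltnS => cA; have [->|[i0 i0A]] := set_0Vmem A.
  by rewrite !big_set0 subrr.
have [j0 j0A jmin] := @arg_minP _ _ _ i0 (fun i => i \in A) rho i0A.
have f0 k : 0 <= (1 + a k)^-1 by rewrite invr_ge0 addr_ge0.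
have f1 k : (1 + a k)^-1 <= 1 by rewrite invf_le1 ?lerDl ?ltr_wpDr.
have IHA := IH (A :\ j0) _.
rewrite (big_setD1 j0)//= [X in 1 - X](big_setD1 j0)//=.
set Q := \prod_(k in A :\ j0) (1 + a k)^-1 in IHA *.
have -> : \prod_(k in A | rho j0 <= rho k) (1 + a k)^-1 = (1 + a j0)^-1 * Q.
  rewrite -(big_setD1 j0)//=; apply: eq_bigl => k.
  by case: (boolP (k \in A)) => //= kA; rewrite jmin.
apply: (@le_trans _ _ (a j0 * ((1 + a j0)^-1 * Q) + (1 - Q))).
  rewrite lerD2l; apply: le_trans (IHA _); last first.
    by apply: leq_trans cA; rewrite (cardsD1 j0 A) j0A.
  apply: ler_sum => j _; apply: ler_wpM2l => //.
  rewrite big_mkcondr (big_setD1 j0)//= -big_mkcondr /=.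
  rewrite -[leRHS]mul1r; apply: ler_wpM2r; first by apply: prodr_ge0.
  by case: ifP.
have p : 1 + a j0 != 0 by rewrite gt_eqF// ltr_wpDr.
by rewrite le_eqVlt; apply/orP; left; apply/eqP; field.
Qed.

Lemma telescope_prodT (I : finType) (rho a : I -> R) : (forall i, 0 <= a i) ->
  \sum_j a j * \prod_(k | rho j <= rho k) (1 + a k)^-1 <= 1.
Proof.
move=> a0; apply: (@le_trans _ _ (1 - \prod_(k in (finset.setTfor I)) (1 + a k)^-1)); last first.
  by rewrite lerBlDr lerDl; apply: prodr_ge0 => k _; rewrite invr_ge0 addr_ge0.
apply: le_trans (telescope_prod rho (finset.setTfor I) a0).
rewrite le_eqVlt; apply/orP; left; apply/eqP; apply: eq_big => [j|j _]; first by rewrite inE.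
by congr (_ * _); apply: eq_bigl => k; rewrite inE.
Qed.

Lemma sqn_blaschke z w : 1 - z^* * w != 0 ->
  1 - sqn ((w - z) / (1 - z^* * w)) = (1 - sqn z) * (1 - sqn w) / sqn (1 - z^* * w).
Proof.
move=> nz; have n0 : sqn (1 - z^* * w) != 0 by rewrite sqn_eq0.
rewrite sqnM sqnV; apply: (mulIf n0); rewrite mulrBl !divfK// mul1r.
by rewrite !sqnE !cRI /=; ring.
Qed.

Lemma Re_cayley w : w != 1 -> Re ((1 + w) / (1 - w)) = (1 - sqn w) / sqn (1 - w).
Proof.
move=> w1; have n0 : sqn (1 - w) != 0 by rewrite sqn_eq0 subr_eq0 eq_sym.
rewrite cReM cReV cImV; apply: (mulIf n0); rewrite divfK//.
transitivity (Re (1 + w) * Re (1 - w) + Im (1 + w) * Im (1 - w)); first by field.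
by rewrite sqnE !cRI /=; ring.
Qed.

(** Equivalent to $(1-y)^2(1+2y)\ge0$. With $y=|b|^2$ it converts the additive quantity $1-|b|^2$
    into a power of a Blaschke factor, so that products can be compared with the separation
    constant. *)
Lemma le_inv_sqr (y : R) : 0 < y -> y <= 1 -> 1 + 2 * (1 - y) <= y^-1 ^+ 2.
Proof.
move=> y0 y1; rewrite exprVn -div1r ler_pdivlMr ?exprn_gt0//.
have : 0 <= (1 - y) ^+ 2 * (1 + 2 * y) by rewrite mulr_ge0 ?sqr_ge0//; lra.
by nra.
Qed.

Variables (N : nat) (lam : nat -> C) (d : R).
Hypothesis lam1 : forall n, sqn (lam n) < 1.
Hypothesis d0 : 0 < d.
Hypothesis sep : forall n, (n < N)%N ->
  d <= \prod_(k < N | k != n :> nat) modc ((lam n - lam k) / (1 - (lam k)^* * lam n)).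

Definition sdef k : R := 1 - sqn (lam k).
(** The term of the exponent in Jones's formula; its real part on the circle is [wt k]. *)
Definition cay k z : C := (sdef k)%:C * ((1 + (lam k)^* * z) / (1 - (lam k)^* * z)).
Definition bl k z : C := (z - lam k) / (1 - (lam k)^* * z).
(* Equals 1 at lam j and is at most (1 + Re (cay k (lam j))) / (1 + wt k z) on the circle: products
   of these replace the exponential factors of Jones's formula by rational functions. *)
Definition damp k j z : C :=
  (1 + Re (cay k (lam j)))%:C / (1 - Complex 0 (Im (cay k (lam j))) + cay k z).
Definition wt k z : R := sqn ((sdef k)%:C / (1 - (lam k)^* * z)).

Lemma sdef_gt0 k : 0 < sdef k. Proof. by rewrite subr_gt0. Qed.
Lemma sdef_le1 k : sdef k <= 1. Proof. by rewrite lerBlDr lerDl sqn_ge0. Qed.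
Lemma den_neq0 k z : modc z <= 1 -> 1 - (lam k)^* * z != 0.
Proof. exact: sub1_neq0. Qed.
Lemma lam_modc k : modc (lam k) <= 1. Proof. by rewrite ltW// modc_lt1. Qed.

Lemma Re_cay k z : modc z <= 1 ->
  Re (cay k z) = sdef k * (1 - sqn (lam k) * sqn z) / sqn (1 - (lam k)^* * z).
Proof.
move=> z1; rewrite /cay cReM cReC cImC mul0r subr0 Re_cayley.
  by rewrite sqnM sqnJ mulrA.
by rewrite eq_sym -subr_eq0 den_neq0.
Qed.
Lemma Re_cay_ge0 k z : modc z <= 1 -> 0 <= Re (cay k z).
Proof.
move=> z1; rewrite Re_cay// divr_ge0 ?sqn_ge0// mulr_ge0 ?(ltW (sdef_gt0 k))//.
rewrite subr_ge0 mulr_ile1 ?sqn_ge0 ?(ltW (lam1 k))//.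
by rewrite -modc_sqr expr_le1 ?modc_ge0.
Qed.
Lemma Re_cay_circle k z : modc z = 1 -> Re (cay k z) = wt k z.
Proof.
move=> z1; rewrite Re_cay ?z1// /wt sqnM sqnV sqnC.
have -> : sqn z = 1 by rewrite -modc_sqr z1 expr1n.
by rewrite mulr1 expr2.
Qed.
Lemma cay_den_neq0 k j z : modc z <= 1 -> 1 - Complex 0 (Im (cay k (lam j))) + cay k z != 0.
Proof.
move=> z1; apply: contraTneq (Re_cay_ge0 k z1) => /(congr1 (fun x : C => Re x)).
rewrite cReD cReD cReN /= => h; rewrite -ltNge; lra.
Qed.
Lemma damp_self k j : damp k j (lam j) = 1.
Proof.
rewrite /damp; have nz := cay_den_neq0 k j (lam_modc j).
move: (cay k (lam j)) nz => c nz; apply: (mulIf nz); rewrite divfK// mul1r.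
by case: c {nz} => a b; apply: cpxP => /=; ring.
Qed.
Lemma damp_le k j z : modc z = 1 -> modc (damp k j z) <= (1 + Re (cay k (lam j))) / (1 + wt k z).
Proof.
move=> z1; have R0 := Re_cay_ge0 k (lam_modc j).
have w0 : 0 <= wt k z by exact: sqn_ge0.
rewrite /damp modcM modcC ger0_norm ?addr_ge0// modcV ler_wpM2l ?addr_ge0//.
have h : 1 + wt k z <= modc (1 - Complex 0 (Im (cay k (lam j))) + cay k z).
  apply: le_trans (Re_le_modc _); apply: le_trans (ler_norm _).
  by rewrite cReD cReD cReN Re_cay_circle//= oppr0 addr0.
by rewrite lef_pV2// posrE; [apply: lt_le_trans h|]; rewrite ltr_wpDr.
Qed.

(** [damp] is a Moebius transformation in $z$ with no pole in the closed disk: [E] and [D] share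
    their imaginary part and $|1-s|\le1+s$, so $|q|\le1$ and $|m|<1$. The two formulas are compared
    only where no denominator vanishes. *)
Lemma holo_damp k j : exists2 g, holo g & forall z, modc z <= 1 -> g z = damp k j z.
Proof.
set tau := Im (cay k (lam j)); pose s := sdef k.
pose D : C := Complex (1 + s) (- tau); pose E : C := Complex (1 - s) (- tau).
have s0 := sdef_gt0 k; have s1 := sdef_le1 k; rewrite -/s in s0 s1.
have D0 : D != 0.
  by apply/eqP => /(congr1 (fun x : C => Re x)) /=; lra.
pose q := E / D; pose m := (q * (lam k)^* )^*.
have q1 : sqn q <= 1.
  rewrite /q sqnM sqnV ler_pdivrMr ?sqn_gt0// mul1r !sqnE /= lerD2r.
  by nra.
have m1 : sqn m < 1.
  rewrite /m sqnJ sqnM sqnJ; apply: le_lt_trans (lam1 k).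
  by rewrite ler_piMl ?sqn_ge0.
pose g z := (1 + Re (cay k (lam j)))%:C * D^-1 * ((1 - (lam k)^* * z) * (1 - m^* * z)^-1).
exists g.
  apply: holoZ; apply: holoM; last exact: holo_ker.
  by apply: holoB; [exact: holo_cst|apply: holoZ; exact: holo_id].
move=> z z1; rewrite /g /damp -mulrA; congr (_ * _).
have nz := den_neq0 k z1; have nm := sub1_neq0 m1 z1.
have nc := cay_den_neq0 k j z1.
apply: (mulIf nc); rewrite mulVf//.
have mE : D * (1 - m^* * z) = D - E * ((lam k)^* * z).
  by rewrite /m cjK /q; field.
have -> : D^-1 * ((1 - (lam k)^* * z) / (1 - m^* * z)) = (1 - (lam k)^* * z) / (D * (1 - m^* * z)).
  by rewrite invfM mulrCA.
rewrite mE [cay k z]/cay -/s -/tau mulrAC; apply: (@mulIf _ (D - E * ((lam k)^* * z))).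
  by rewrite -mE mulf_neq0.
rewrite divfK ?mul1r; last by rewrite -mE mulf_neq0.
clearbody tau s.
have -> : D = 1 - Complex 0 tau + s%:C by rewrite /D; apply: cpxP => /=; ring.
have -> : E = 1 - Complex 0 tau - s%:C by rewrite /E; apply: cpxP => /=; ring.
by field.
Qed.

Lemma bl_le1 k z : modc z <= 1 -> sqn (bl k z) <= 1.
Proof.
move=> z1; rewrite -subr_ge0 sqn_blaschke ?den_neq0// divr_ge0 ?sqn_ge0// mulr_ge0//.
  exact: ltW (sdef_gt0 k).
by rewrite subr_ge0 -modc_sqr expr_le1 ?modc_ge0.
Qed.

(** The ordering by modulus enters here: $1-|\lambda_k|^2|\lambda_j|^2\le2(1-|\lambda_j|^2)$ when
    $|\lambda_j|\le|\lambda_k|$. *)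
Lemma Re_cay_bl k j : k != j -> sqn (lam j) <= sqn (lam k) ->
  Re (cay k (lam j)) <= 2 * (1 - sqn (bl k (lam j))).
Proof.
move=> kj jk; rewrite sqn_blaschke ?den_neq0 ?lam_modc// Re_cay ?lam_modc//.
rewrite mulrA ler_wpM2r ?invr_ge0 ?sqn_ge0//.
have h := sdef_gt0 k; rewrite mulrCA ler_wpM2l ?(ltW h)//.
by have := sqn_ge0 (lam j); have := lam1 j; have := lam1 k; nra.
Qed.
Lemma Re_cay_self j : Re (cay j (lam j)) <= 2.
Proof.
rewrite Re_cay ?lam_modc//.
have -> : sqn (1 - (lam j)^* * lam j) = sdef j ^+ 2.
  by rewrite mulrC mulcJ -[1]/(1%:C) -rmorphB /= sqnC.
have h := sdef_gt0 j; rewrite ler_pdivrMr ?exprn_gt0//.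
rewrite /sdef in h *; have := sqn_ge0 (lam j) => h0.
have : 0 <= (1 - sqn (lam j)) ^+ 2 * (1 - sqn (lam j)) by rewrite mulr_ge0 ?sqr_ge0 ?ltW.
by nra.
Qed.

Lemma sep_pos n k : (n < N)%N -> (k < N)%N -> k != n -> 0 < modc (bl k (lam n)).
Proof.
move=> nN kN kn; rewrite lt0r modc_ge0 andbT; apply/eqP => h0.
have := sep nN; rewrite (bigD1 (Ordinal kN))//= -/(bl k (lam n)) h0 mul0r.
by rewrite leNgt d0.
Qed.

(** The factor 3 comes from $k=j$. Each other factor is at most the power $-4$ of the modulus of
    [bl k (lam j)]; these powers are at least 1, so the missing indices may be added to reach the
    separation product. *)
Lemma prod_damp j : (j < N)%N ->
  \prod_(k < N | sqn (lam j) <= sqn (lam k)) (1 + Re (cay k (lam j))) <= 3 * d^-1 ^+ 4.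
Proof.
move=> jN; rewrite (bigD1 (Ordinal jN))//=.
apply: ler_pM.
- by rewrite addr_ge0 ?Re_cay_ge0 ?lam_modc.
- by apply: prodr_ge0 => k _; rewrite addr_ge0 ?Re_cay_ge0 ?lam_modc.
- by have := Re_cay_self j; lra.
pose y k := sqn (bl k (lam j)).
have y0 (k : 'I_N) : k != Ordinal jN -> 0 < y k.
  by move=> kj; rewrite /y -modc_sqr exprn_gt0// sep_pos.
have y1 k : y k <= 1 by apply: bl_le1; exact: lam_modc.
apply: (@le_trans _ _ (\prod_(k < N | k != Ordinal jN) (y k)^-1 ^+ 2)).
  rewrite [leRHS]big_mkcond [leLHS]big_mkcond /=; apply: ler_prod => k _.
  have [jk|_] := boolP (sqn (lam j) <= sqn (lam k)); rewrite /= ?andbT.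
    case: ifP => kj; last by rewrite ler01 lexx.
    rewrite addr_ge0 ?Re_cay_ge0 ?lam_modc//=.
    apply: le_trans (le_inv_sqr (y0 k kj) (y1 k)).
    by rewrite lerD2l Re_cay_bl.
  case: ifP => kj; rewrite ler01//=.
  by rewrite exprn_ege1// invf_ge1 ?y0.
have -> : \prod_(k < N | k != Ordinal jN) (y k)^-1 ^+ 2 =
    (\prod_(k < N | k != j :> nat) modc (bl k (lam j)))^-1 ^+ 4.
  rewrite -prodfV -prodrXl; apply: eq_bigr => k _.
  by rewrite /y -modc_sqr -!exprVn -exprM.
have P0 : 0 < \prod_(k < N | k != j :> nat) modc (bl k (lam j)).
  exact: lt_le_trans (sep jN).
rewrite lerXn2r ?nnegrE ?invr_ge0 ?(ltW P0) ?(ltW d0)//.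
by rewrite lef_pV2 ?posrE//; exact: sep.
Qed.

(** Each [Fj] is the Blaschke product without its $j$-th factor, normalized at $\lambda_j$, times a
    squared kernel of modulus [wt j] on the circle and the damping product. The normalization costs
    $d^{-1}$ and [prod_damp] costs $3d^{-4}$; the sum over $j$ that remains is at most 1 by
    telescoping. *)
Theorem jones (eps : nat -> C) : (forall n, modc (eps n) <= 1) ->
  exists f : C -> C, [/\ holo f, forall t : R, modc (f (expi t)) <= 3 * d^-1 ^+ 5 &
    forall n, (n < N)%N -> f (lam n) = eps n].
Proof.
move=> eps1.
have [g hg] := @choice _ _ _ (fun p : nat * nat => let: ex_intro2 g h1 h2 := holo_damp p.1 p.2 in
  ex_intro (fun g => holo g /\ forall z, modc z <= 1 -> g z = damp p.1 p.2 z) g (conj h1 h2)).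
pose Bj (j : 'I_N) z := \prod_(k < N | k != j :> nat) bl k z.
pose Fj (j : 'I_N) z := eps j * (Bj j (lam j))^-1 * (Bj j z *
  ((sdef j)%:C * (1 - (lam j)^* * z)^-1 * ((sdef j)%:C * (1 - (lam j)^* * z)^-1) *
   \prod_(k < N | sqn (lam j) <= sqn (lam k)) g (k : nat, j : nat) z)).
have BjE (j : 'I_N) : modc (Bj j (lam j)) = \prod_(k < N | k != j :> nat) modc (bl k (lam j)).
  exact: modc_prod.
have Bj_ge (j : 'I_N) : d <= modc (Bj j (lam j)) by rewrite BjE; exact: sep.
have Bj0 (j : 'I_N) : Bj j (lam j) != 0 by rewrite -modc_gt0; exact: lt_le_trans (Bj_ge j).
exists (fun z => \sum_(j < N) Fj j z); split.
- apply: holo_sum => j _; apply: holoZ; apply: holoM.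
    apply: holo_prod => k _; apply: holoM; last exact: holo_ker.
    by apply: holoB; [exact: holo_id|exact: holo_cst].
  apply: holoM.
    by apply: holoM; apply: holoZ; exact: holo_ker.
  by apply: holo_prod => k _; case: (hg (k : nat, j : nat)).
- move=> t; set z := expi t; have z1 : modc z = 1 by exact: modc_expi.
  apply: le_trans (modc_sum _ _ _) _.
  have wt0 k : 0 <= wt k z by exact: sqn_ge0.
  apply: (@le_trans _ _ (\sum_(j < N) 3 * d^-1 ^+ 5 *
     (wt j z * \prod_(k < N | sqn (lam j) <= sqn (lam k)) (1 + wt k z)^-1))); last first.
    rewrite -mulr_sumr -[leRHS]mulr1; apply: ler_wpM2l.
      by rewrite mulr_ge0// exprn_ge0// invr_ge0 ltW.
    exact: (@telescope_prodT _ (fun k : 'I_N => sqn (lam k)) (fun k : 'I_N => wt k z) (fun k : 'I_N => wt0 k)).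
  apply: ler_sum => j _; rewrite /Fj !modcM modcV.
  have b1 : modc (Bj j z) = 1.
    rewrite /Bj modc_prod big1// => k _.
    have : 1 - sqn (bl k z) = 0.
      by rewrite sqn_blaschke ?den_neq0 ?z1// -(modc_sqr z) z1 expr1n subrr mulr0 mul0r.
    by move/eqP; rewrite subr_eq0 => /eqP h; rewrite modcE -h sqrtr1.
  rewrite b1 mul1r -modcM -modcM -expr2 modcX modc_sqr -/(wt j z).
  rewrite (modc_prod _ _ (fun k : 'I_N => g (k : nat, j : nat) z)).
  have pd : \prod_(k < N | sqn (lam j) <= sqn (lam k)) modc (g (k : nat, j : nat) z) <=
     3 * d^-1 ^+ 4 * \prod_(k < N | sqn (lam j) <= sqn (lam k)) (1 + wt k z)^-1.
    apply: (@le_trans _ _ (\prod_(k < N | sqn (lam j) <= sqn (lam k))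
       ((1 + Re (cay k (lam j))) * (1 + wt k z)^-1))).
      apply: ler_prod => k _; rewrite modc_ge0 /=.
      by have [_ ->] := hg (k : nat, j : nat); rewrite ?z1//; exact: damp_le.
    rewrite big_split /= ler_wpM2r ?prod_damp//.
    by apply: prodr_ge0 => k _; rewrite invr_ge0 addr_ge0.
  have e1 := eps1 j.
  have v1 : (modc (Bj j (lam j)))^-1 <= d^-1 by rewrite lef_pV2 ?posrE ?(lt_le_trans d0).
  have v0 : 0 <= (modc (Bj j (lam j)))^-1 by rewrite invr_ge0 modc_ge0.
  apply: (@le_trans _ _ (d^-1 * (wt j z * (3 * d^-1 ^+ 4 *
     \prod_(k < N | sqn (lam j) <= sqn (lam k)) (1 + wt k z)^-1)))).
    apply: ler_pM.
    - by rewrite mulr_ge0 ?modc_ge0.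
    - by rewrite mulr_ge0// prodr_ge0// => k _; exact: modc_ge0.
    - by rewrite -[leRHS]mul1r ler_pM ?modc_ge0.
    - by rewrite ler_wpM2l.
  by rewrite le_eqVlt; apply/orP; left; apply/eqP; rewrite [_ ^+ 5]exprS; ring.
- move=> n nN; rewrite (bigD1 (Ordinal nN))//= [X in _ + X]big1 ?addr0; last first.
    move=> j jn; have B0 : Bj j (lam n) = 0.
      rewrite /Bj (bigD1 (Ordinal nN)) /=; last first.
        by apply: contraNneq jn => h; apply/eqP/val_inj.
      by rewrite /bl subrr !mul0r.
    by rewrite /Fj B0 mul0r mulr0.
  rewrite /Fj /= big1 ?mulr1; last first.
    by move=> k _; have [_ ->] := hg (k : nat, n); rewrite ?damp_self ?lam_modc.
  have -> : (sdef n)%:C * (1 - (lam n)^* * lam n)^-1 = 1.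
    rewrite [_^* * _]mulrC mulcJ.
    have -> : (1 - (sqn (lam n))%:C : C) = (sdef n)%:C by rewrite /sdef rmorphB.
    by rewrite mulfV//; apply/eqP => /complexI h; have := sdef_gt0 n; rewrite h ltxx.
  by rewrite !mulr1 divfK//; exact: (Bj0 (Ordinal nN)).
Qed.

End Jones.

(** * Changing an integrand on a null set *)

Section NullSets.
Variable R : realType.
Local Notation C := R[i].
Local Notation Re := complex.Re.
Local Notation Im := complex.Im.
Local Notation T := (@Tdom R).
Local Notation mu := (@lebesgue_measure R).
Local Open Scope ereal_scope.
Import HBNNSimple.

(** Only the definition of the integral as a supremum over simple functions is used: one below [f]
    can be set to 0 on [A] at no cost and then lies below [g]. *)
Lemma ge0_integral_null_le (A : set R) (f g : R -> \bar R) : measurable A -> mu A = 0 ->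
  (forall x, 0 <= f x) -> (forall x, 0 <= g x) -> (forall x, ~ A x -> f x = g x) ->
  \int[mu]_x f x <= \int[mu]_x g x.
Proof.
move=> mA A0 f0 g0 fg; rewrite ge0_integralTE// ge0_integralTE//.
apply: ge_ereal_sup => _ [h /= hf <-].
have mAC : measurable (~` A) by exact: measurableC.
apply: (@le_trans _ _ (sintegral mu (h \_ (~` A)))).
  rewrite -integral_nnsfun// (_ : sintegral mu h = \int[mu]_(x in setT) (h x)%:E); last first.
    by rewrite integral_nnsfun// patch_setT.
  rewrite (@ge0_negligible_integral _ _ _ mu setT A)//.
  - by rewrite setTD.
  - by apply/measurable_EFinP.
  - by move=> x _; rewrite lee_fin.
apply: ereal_sup_ubound; exists (proj_nnsfun h mAC).
  move=> x /=; rewrite mindicE; case: (boolP (x \in ~` A)) => xA.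
    by rewrite mulr1 -fg ?hf//; move: xA; rewrite inE.
  by rewrite mulr0.
exact: (congr1 (sintegral mu) (esym (mrestrict h mAC))).
Qed.

Lemma integral_null_eq (D A : set R) (f g : R -> \bar R) : measurable A -> mu A = 0 ->
  (forall x, D x -> ~ A x -> f x = g x) -> \int[mu]_(x in D) f x = \int[mu]_(x in D) g x.
Proof.
move=> mA A0 fg; rewrite [LHS]integral_mkcond [RHS]integral_mkcond.
set F := f \_ D; set G := g \_ D.
have FG x : ~ A x -> F x = G x.
  by move=> xA; rewrite /F /G /patch; case: ifPn => //; rewrite inE => Dx; exact: fg.
rewrite [LHS]integralE [RHS]integralE; congr (_ - _); apply/eqP; rewrite eq_le; apply/andP; split;
  apply: (ge0_integral_null_le mA A0) => x; rewrite ?funepos_ge0 ?funeneg_ge0// => xA;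
  by rewrite ?funeposE ?funenegE FG.
Qed.

(* Measurability is not assumed, since blaschke_bd is defined pointwise by limits that may fail
   to exist on a null set. *)
Lemma rI_aeeq_nonmeas (f g : R -> R) : {ae mu, forall t, T t -> f t = g t} -> rI f = rI g.
Proof.
move=> [A [mA A0 sub]]; congr (_ / _)%R; congr fine; apply: (integral_null_eq mA A0) => x Tx xA.
congr EFin; apply: contrapT => ne; apply: xA; apply: sub => /= /(_ Tx); exact: ne.
Qed.

Lemma ip_aeeq_r (F G G' : R -> C) : {ae mu, forall t, T t -> G t = G' t} -> ip F G = ip F G'.
Proof.
move=> h; rewrite !ipE; apply: cpxP; rewrite ?cI_Re ?cI_Im; apply: rI_aeeq_nonmeas;
 by apply: aeS h => t /= h /h ->.
Qed.
End NullSets.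

(** * The Riesz basis of kernels *)

Section Riesz.
Variable R : realType.
Local Notation C := R[i].
Local Notation Re := complex.Re.
Local Notation Im := complex.Im.
Local Notation T := (@Tdom R).
Local Notation mu := (@lebesgue_measure R).
Implicit Types (F G H : R -> C) (z w : C).

(** Signs are chosen greedily in place of averaging: each new term adds [sqn (a M)] and a cross term
    whose sign can be prescribed. *)
Lemma sign_choice (v : nat -> R -> C) (N : nat) (a : nat -> C) :
  (forall n, L2 (v n)) -> (forall n, nsq (v n) = 1) ->
  (exists e : nat -> R, (forall n, e n ^+ 2 = 1) /\
    nsq (lcomb v N (fun n => (e n)%:C * a n)) <= \sum_(n < N) sqn (a n)) /\
  (exists e : nat -> R, (forall n, e n ^+ 2 = 1) /\
    \sum_(n < N) sqn (a n) <= nsq (lcomb v N (fun n => (e n)%:C * a n))).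
Proof.
move=> Lv v1.
have L0 e : nsq (lcomb v 0 e) = 0.
  by rewrite /nsq -[RHS](rI_cst 0); apply: rI_eq => t _; rewrite /lcomb big_ord0 sqn0.
have step (e : nat -> R) (s : R) M : s ^+ 2 = 1 ->
   nsq (lcomb v M.+1 (fun n => (if n == M then s else e n)%:C * a n)) =
   nsq (lcomb v M (fun n => (e n)%:C * a n)) + sqn (a M) +
   2 * (s * Re (ip (lcomb v M (fun n => (e n)%:C * a n)) (fun t => a M * v M t))).
  move=> s1; set X := lcomb v M _.
  have LX : L2 X by exact: lcomb_L2.
  have -> : lcomb v M.+1 (fun n => (if n == M then s else e n)%:C * a n) =
     (fun t => X t + s%:C * (a M * v M t)).
    apply: funext => t; rewrite /lcomb big_ord_recr /= eqxx mulrA; congr (_ + _).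
    by apply: eq_bigr => i _; rewrite ltn_eqF.
  rewrite nsqD//; [|by do 2 apply: L2Z].
  rewrite !nsqZ//; [|exact: L2Z]; rewrite v1 sqnC s1 mul1r mulr1; congr (_ + 2 * _).
  rewrite ipZr//; [|exact: L2Z]; by rewrite cjC cReM cReC cImC mul0r subr0.
split.
  elim: N => [|M [e [e1 IH]]]; first by exists (fun=> 1); rewrite L0 big_ord0; split => // n; rewrite expr1n.
  set r := Re (ip (lcomb v M (fun n => (e n)%:C * a n)) (fun t => a M * v M t)).
  pose s : R := if 0 <= r then -1 else 1.
  have s1 : s ^+ 2 = 1 by rewrite /s; case: ifP; rewrite ?sqrrN expr1n.
  have sr : s * r <= 0 by rewrite /s; case: (leP 0 r) => h; rewrite ?mulN1r ?mul1r ?oppr_le0// ltW.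
  exists (fun n => if n == M then s else e n); split; first by move=> n; case: ifP.
  by rewrite step// -/r big_ord_recr /=; lra.
elim: N => [|M [e [e1 IH]]]; first by exists (fun=> 1); rewrite L0 big_ord0; split => // n; rewrite expr1n.
set r := Re (ip (lcomb v M (fun n => (e n)%:C * a n)) (fun t => a M * v M t)).
pose s : R := if 0 <= r then 1 else -1.
have s1 : s ^+ 2 = 1 by rewrite /s; case: ifP; rewrite ?sqrrN expr1n.
have sr : 0 <= s * r by rewrite /s; case: (leP 0 r) => h; rewrite ?mulN1r ?mul1r ?oppr_ge0// ltW.
exists (fun n => if n == M then s else e n); split; first by move=> n; case: ifP.
by rewrite step// -/r big_ord_recr /=; lra.
Qed.

Variables (lam : nat -> C) (d : R).
Hypothesis lam1 : forall n, sqn (lam n) < 1.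
Hypothesis d0 : 0 < d.
Hypothesis sep : forall n N, d <= \prod_(k < N | k != n :> nat)
  modc ((lam n - lam k) / (1 - (lam k)^* * lam n)).

Definition khat n (t : R) : C := (Num.sqrt (sdef lam n))%:C * ker (lam n) t.
Lemma khat_bmeas n : bmeas (khat n).
Proof. by apply: bmeasM; [exact: bmeas_cst|exact: ker_bmeas]. Qed.
Lemma khat_L2 n : L2 (khat n). Proof. exact/bmeas_L2/khat_bmeas. Qed.
Lemma khat_H2 n : H2 (khat n). Proof. by apply: H2Z; exact: H2_ker. Qed.
Lemma sqr_sqrt_sdef n : Num.sqrt (sdef lam n) ^+ 2 = sdef lam n.
Proof. by rewrite sqr_sqrtr// ltW// sdef_gt0. Qed.
Lemma ip_khat G n : L2 G -> ip G (khat n) = (Num.sqrt (sdef lam n))%:C * ext G (lam n).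
Proof. by move=> LG; rewrite ipZr ?cjC//; exact: ker_L2. Qed.
Lemma ext_khat n z : sqn z < 1 -> ext (khat n) z = (Num.sqrt (sdef lam n))%:C / (1 - (lam n)^* * z).
Proof. by move=> z1; rewrite extZ ?ext_ker//; exact: H2_ker. Qed.
Lemma nsq_khat n : nsq (khat n) = 1.
Proof.
apply: (@complexI R); rewrite -ip_nsq ip_khat; last exact: khat_L2.
rewrite ext_khat// mulrA -expr2 -rmorphXn /= sqr_sqrt_sdef [_^* * _]mulrC mulcJ.
have -> : (1 - (sqn (lam n))%:C : C) = (sdef lam n)%:C by rewrite /sdef rmorphB.
by rewrite mulfV//; apply/eqP => /complexI h; have := sdef_gt0 lam1 n; rewrite h ltxx.
Qed.

(* On the span of the kernels the adjoint of multiplication by f acts diagonally, so |f| <= M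
   on the circle makes the multiplication of coefficients by f (lam n) a contraction up to M. *)
Lemma multiplier (f : C -> C) (e : nat -> R) (M : R) N (a : nat -> C) : holo f -> 0 <= M ->
  (forall t : R, modc (f (expi t)) <= M) -> (forall n, (n < N)%N -> f (lam n) = (e n)%:C) ->
  l2n (lcomb khat N (fun n => (e n)%:C * a n)) <= M * l2n (lcomb khat N a).
Proof.
move=> [bf Hf ef] M0 fM fe.
set G := lcomb khat N (fun n => _); set A := lcomb khat N a.
have LA : L2 A by exact: lcomb_L2 khat_L2 _ _.
have LG : L2 G by exact: lcomb_L2 khat_L2 _ _.
have HG : H2 G by apply: H2_sum => m _; apply: H2Z; exact: khat_H2.
have bJ : bmeas (fun t => (f (expi t))^* ) by exact: bmeasJ.
have LfA : L2 (fun t => (f (expi t))^* * A t) by exact: L2M.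
have LfG : L2 (fun t => f (expi t) * G t) by exact: L2M.
have key : ip G G = ip (fun t => (f (expi t))^* * A t) G.
  have -> : ip (fun t => (f (expi t))^* * A t) G = ip A (fun t => f (expi t) * G t).
    by rewrite !ipE; apply: cI_eq => t _; rewrite cjM; ring.
  rewrite !ip_lcombl//; [|exact: khat_L2|exact: khat_L2].
  apply: eq_bigr => n _.
  rewrite (ipJ LG (khat_L2 n)) (ipJ LfG (khat_L2 n)) !ip_khat//.
  rewrite ext_mul// ef// fe// !cjM !cjC; ring.
have : nsq G <= M * l2n A * l2n G.
  have : modc (ip G G) <= M * l2n A * l2n G.
    rewrite key; apply: le_trans (CS LfA LG) _; apply: ler_wpM2r; first exact: l2n_ge0.
    apply: l2nM => // t _; rewrite sqnJ -modc_sqr lerXn2r ?nnegrE ?modc_ge0//.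
  by rewrite ip_nsq modcC ger0_norm// nsq_ge0.
rewrite -l2n_sqr expr2 => h; have [g0|g0] := eqVneq (l2n G) 0.
  by rewrite g0 mulr_ge0// l2n_ge0.
by move: h; rewrite ler_pM2r// lt0r g0 l2n_ge0.
Qed.

Definition rconst : R := 3 * d^-1 ^+ 5.
Lemma rconst_ge0 : 0 <= rconst.
Proof. by rewrite mulr_ge0// exprn_ge0// invr_ge0 ltW. Qed.
Lemma sign_mult (e : nat -> R) N a : (forall n, e n ^+ 2 = 1) ->
  nsq (lcomb khat N (fun n => (e n)%:C * a n)) <= rconst ^+ 2 * nsq (lcomb khat N a).
Proof.
move=> e1; have em n : modc ((e n)%:C : C) <= 1.
  by rewrite modcC -(@ler_pXn2r _ 2) ?nnegrE// real_normK ?num_real// e1 expr1n.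
have [f [hf fM fe]] := jones lam1 d0 (fun n _ => sep n N) em.
rewrite -!l2n_sqr -exprMn lerXn2r ?nnegrE ?(mulr_ge0 rconst_ge0 (l2n_ge0 _)) ?l2n_ge0//.
by apply: (multiplier _ hf rconst_ge0) => //; exact: fe.
Qed.
Lemma riesz_lower N (a : nat -> C) : \sum_(n < N) sqn (a n) <= rconst ^+ 2 * nsq (lcomb khat N a).
Proof.
have [_ [e [e1 h]]] := sign_choice N a khat_L2 nsq_khat.
by apply: le_trans h _; exact: sign_mult.
Qed.
(** Multiplying twice by the same signs is the identity, so a signed combination of small norm
    controls the original one. *)
Lemma riesz_upper N (a : nat -> C) : nsq (lcomb khat N a) <= rconst ^+ 2 * \sum_(n < N) sqn (a n).
Proof.
have [[e [e1 h]] _] := sign_choice N a khat_L2 nsq_khat.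
apply: le_trans (_ : rconst ^+ 2 * nsq (lcomb khat N (fun n => (e n)%:C * a n)) <= _); last first.
  by rewrite ler_wpM2l// sqr_ge0.
apply: le_trans (sign_mult N _ e1); rewrite le_eqVlt; apply/orP; left; apply/eqP; congr nsq.
apply: funext => t; apply: eq_bigr => n _; congr (_ * _).
by rewrite mulrA -rmorphM /= -expr2 e1 mul1r.
Qed.

End Riesz.

(** * Blaschke products and model spaces *)

Section BlaschkeProduct.
Variable R : realType.
Local Notation C := R[i].
Local Notation Re := complex.Re.
Local Notation Im := complex.Im.
Local Notation T := (@Tdom R).
Local Notation mu := (@lebesgue_measure R).
Implicit Types (F G H : R -> C) (z w : C).

(** The inductive step is $y(2-y)\le1$. A lower bound on the product thus bounds the sum of the
    $1-y_k$. *)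
Lemma prod_sum_le (y : nat -> R) (P : pred nat) N : (forall k, 0 <= y k <= 1) ->
  (\prod_(k < N | P k) y k) * (1 + \sum_(k < N | P k) (1 - y k)) <= 1.
Proof.
move=> y01; elim: N => [|N IH]; first by rewrite !big_ord0 addr0 mulr1.
rewrite !(big_mkcond (fun k : 'I_N.+1 => P k)) !big_ord_recr /= -!big_mkcond /=.
case: (P N); last by rewrite mulr1 addr0.
set Q := \prod_(_ < _ | _) _ in IH *; set S := \sum_(_ < _ | _) _ in IH *.
have Q0 : 0 <= Q by apply: prodr_ge0 => k _; case/andP: (y01 k).
have S0 : 0 <= S by apply: sumr_ge0 => k _; rewrite subr_ge0; case/andP: (y01 k).
have /andP[a b] := y01 N; apply: le_trans IH.
rewrite -mulrA; apply: ler_wpM2l => //; nra.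
Qed.

Lemma prod_ge_sum (x : nat -> R) N M : (forall k, 0 <= x k <= 1) ->
  1 - \prod_(N <= k < M) x k <= \sum_(N <= k < M) (1 - x k).
Proof.
move=> x01; elim: M => [|M IH]; first by rewrite !big_geq// subrr.
have [NM|MN] := leqP N M; last by rewrite !big_geq// subrr.
rewrite !big_nat_recr//=; have /andP[a b] := x01 M.
have [Q0 Q1] : 0 <= \prod_(N <= k < M) x k /\ \prod_(N <= k < M) x k <= 1.
  apply/andP; elim/big_ind: _ => [|u v|k _]; [by rewrite ler01 lexx| |exact: x01].
  by move=> /andP[u0 u1] /andP[v0 v1]; rewrite mulr_ge0//= mulr_ile1.
nra.
Qed.

Lemma holo_bfac (a : C) : sqn a < 1 -> holo (bfac a).
Proof.
move=> a1; rewrite /bfac; case: eqP => [_|/eqP a0]; first exact: holo_id.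
apply: holoZ; apply: holoM; last exact: holo_ker.
by apply: holoB; [exact: holo_cst|exact: holo_id].
Qed.
Lemma modc_bfac (a : C) (t : R) : sqn a < 1 -> modc (bfac a (expi t)) = 1.
Proof.
move=> a1; rewrite /bfac; case: eqP => [_|/eqP a0]; first exact: modc_expi.
rewrite normrc modcM [modc (_ / a)]modcM modcC modcV ger0_norm ?modc_ge0// mulfV ?modc_eq0// mul1r.
have h : 1 - sqn ((expi t - a) / (1 - a^* * expi t)) = 0.
  by rewrite sqn_blaschke ?kerd_neq0// sqn_expi subrr mulr0 mul0r.
rewrite -[a - _]opprB mulNr modcN modcE.
by move/eqP: h; rewrite subr_eq0 => /eqP <-; rewrite sqrtr1.
Qed.
Lemma bfac0 (a : C) : bfac a 0 = (modc a)%:C.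
Proof.
rewrite /bfac; case: eqP => [->|/eqP a0]; first by rewrite modc0.
by rewrite normrc mulr0 !subr0 divr1 divfK.
Qed.
Lemma bfac_root (a : C) : bfac a a = 0.
Proof. by rewrite /bfac; case: eqP => [->//|_]; rewrite subrr mul0r mulr0. Qed.
Lemma bfac_neq0 (a z : C) : sqn a < 1 -> sqn z < 1 -> z != a -> bfac a z != 0.
Proof.
move=> a1 z1 za; rewrite /bfac; have [a0|a0] := boolP (a == 0); first by move: za; rewrite (eqP a0).
rewrite !mulf_neq0 ?normr_eq0 ?invr_eq0 ?subr_eq0//; first by rewrite eq_sym.
by rewrite -(subr_eq0 1) sub1_neq0// ltW// modc_lt1.
Qed.

Variables (lam : nat -> C) (d : R).
Hypothesis lamI : injective lam.
Hypothesis lam1 : forall n, sqn (lam n) < 1.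
Hypothesis d0 : 0 < d.
Hypothesis sep : forall n N, d <= \prod_(k < N | k != n :> nat)
  modc ((lam n - lam k) / (1 - (lam k)^* * lam n)).

(** The Blaschke condition, from the separation at the single point $\lambda_0$: [1 - y k] is at
    least [sdef lam k * sdef lam 0 / 4]. The summand 1 in the bound pays for $k=0$. *)
Lemma sum_sdef_bounded : exists M, forall N, \sum_(k < N) sdef lam k <= M.
Proof.
have s0 := sdef_gt0 lam1.
exists (1 + 4 * (d^-1 ^+ 2 / sdef lam 0)) => N.
case: N => [|N].
  by rewrite big_ord0 addr_ge0 ?mulr_ge0 ?divr_ge0 ?exprn_ge0 ?invr_ge0 ?(ltW d0) ?(ltW (s0 _)).
pose y k := sqn (bl lam k (lam 0%N)).
have y01 k : 0 <= y k <= 1 by rewrite sqn_ge0 bl_le1 ?lam_modc.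
have h := prod_sum_le (fun k => k != 0%N) N.+1 y01.
set SS := \sum_(_ < _ | _) _ in h.
have S0 : 0 <= SS by apply: sumr_ge0 => k _; rewrite subr_ge0; case/andP: (y01 k).
have P2 : d ^+ 2 <= \prod_(k < N.+1 | k != 0%N :> nat) y k.
  have -> : \prod_(k < N.+1 | k != 0%N :> nat) y k =
     (\prod_(k < N.+1 | k != 0%N :> nat) modc (bl lam k (lam 0%N))) ^+ 2.
    by rewrite -prodrXl; apply: eq_bigr => k _; rewrite modc_sqr.
  have dd := sep 0 N.+1; rewrite lerXn2r ?nnegrE ?(ltW d0)//.
  by apply: le_trans dd; exact: ltW.
have dS : d ^+ 2 * SS <= 1.
  by have := exprn_gt0 2 d0; have := h; nra.
have {}dS : SS <= d^-1 ^+ 2 by rewrite exprVn -div1r ler_pdivlMr ?exprn_gt0// mulrC.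
have le1 k : sdef lam k <= 4 * ((1 - y k) / sdef lam 0).
  rewrite /y sqn_blaschke ?den_neq0 ?lam_modc//.
  have nz := den_neq0 lam1 k (lam_modc lam1 0).
  have m4 : sqn (1 - (lam k)^* * lam 0%N) <= 4.
    have : modc (1 - (lam k)^* * lam 0%N) <= 2.
      apply: le_trans (modcD _ _) _; rewrite modc1 modcN modcM modcJ.
      have := lam_modc lam1 k; have := lam_modc lam1 0; have := modc_ge0 (lam k); have := modc_ge0 (lam 0%N).
      by nra.
    by rewrite -modc_sqr; have := modc_ge0 (1 - (lam k)^* * lam 0%N); nra.
  have p : 0 < sqn (1 - (lam k)^* * lam 0%N) by rewrite sqn_gt0.
  rewrite -/(sdef lam k) -/(sdef lam 0) mulrAC mulfK ?gt_eqF// mulrA ler_pdivlMr// mulrC.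
  by rewrite ler_wpM2r// ltW.
rewrite (bigD1 ord0)//= lerD ?sdef_le1//.
apply: le_trans (_ : \sum_(k < N.+1 | k != ord0) 4 * ((1 - y k) / sdef lam 0) <= _).
  by apply: ler_sum.
rewrite -mulr_sumr -mulr_suml ler_wpM2l// ler_wpM2r ?invr_ge0 ?(ltW (s0 _))//.
Qed.

Definition fbl N z : C := \prod_(k < N) bfac (lam k) z.
Definition tbl N M z : C := \prod_(N <= k < M) bfac (lam k) z.
Lemma holo_fbl N : holo (fbl N).
Proof. by apply: holo_prod => k _; exact: holo_bfac. Qed.
Lemma holo_tbl N M : holo (tbl N M).
Proof. by apply: holo_prod => k _; exact: holo_bfac. Qed.
Lemma fbl_split N M z : (N <= M)%N -> fbl M z = fbl N z * tbl N M z.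
Proof. by move=> NM; rewrite /fbl /tbl -!(big_mkord xpredT (fun k => bfac (lam k) z)) -big_cat_nat. Qed.
Lemma modc_fbl N (t : R) : modc (fbl N (expi t)) = 1.
Proof. by rewrite modc_prod big1// => k _; exact: modc_bfac. Qed.
Lemma fbl_root N n : (n < N)%N -> fbl N (lam n) = 0.
Proof. by move=> nN; rewrite /fbl (bigD1 (Ordinal nN))//= bfac_root mul0r. Qed.

Definition fbt N (t : R) : C := fbl N (expi t).
Lemma fbt_L2 N : L2 (fbt N). Proof. by have [_ /H2_L2] := holo_fbl N. Qed.
Lemma nsq_fbt N : nsq (fbt N) = 1.
Proof. by rewrite -[RHS](rI_cst 1); apply: rI_eq => t _; rewrite -modc_sqr modc_fbl expr1n. Qed.

(** On the circle $B_n\overline{B_m}$ is the block of factors from $m$ to $n$, so the inner product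
    is the value of that block at 0, which the normalization of [bfac] makes the nonnegative number
    $\prod|\lambda_k|$. *)
Lemma fbt_cauchy : l2cauchy fbt.
Proof.
have [M hM] := sum_sdef_bounded.
apply: (@l2cauchy_mono _ fbt (fun N => 2 * \sum_(k < N) sdef lam k) (2 * M)).
  move=> m n mn; rewrite l2n_sqr nsqB; [|exact: fbt_L2|exact: fbt_L2].
  rewrite !nsq_fbt.
  have -> : ip (fbt n) (fbt m) = tbl m n 0.
    have [_ Ht /(_ 0)] := holo_tbl m n; rewrite sqn0 => /(_ ltr01) <-.
    rewrite extE !ipE; apply: cI_eq => t _; rewrite ker0 cj1 mulr1 /fbt (fbl_split _ mn) mulrAC mulcJ.
    by rewrite -modc_sqr modc_fbl expr1n mul1r.
  have -> : tbl m n 0 = (\prod_(m <= k < n) modc (lam k))%:C.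
    by rewrite /tbl rmorph_prod /=; apply: eq_bigr => k _; exact: bfac0.
  rewrite cReC; have := @prod_ge_sum (fun k => modc (lam k)) m n _.
  have l01 k : 0 <= modc (lam k) <= 1 by rewrite modc_ge0 lam_modc.
  move=> /(_ l01) h.
  have : \sum_(m <= k < n) (1 - modc (lam k)) <= \sum_(m <= k < n) sdef lam k.
    by apply: ler_sum => k _; rewrite /sdef -modc_sqr; have /andP[] := l01 k; nra.
  rewrite -!(big_mkord xpredT (fun k => sdef lam k)) [in X in _ -> X](big_cat_nat (leq0n m) mn)/=.
  by move=> h2; lra.
by move=> n; rewrite ler_pM2l.
Qed.

Lemma blaschke_limit : exists b : R -> C,
  [/\ H2 b, l2cvg fbt b, {ae mu, forall t, T t -> sqn (b t) = 1} &
   forall z, sqn z < 1 -> ccvg (fun N => fbl N z) (ext b z)].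
Proof.
have [b [Lb cb [n_ [_ ab]]]] := L2_complete fbt_L2 fbt_cauchy.
have Hb : H2 b by apply: H2_lim cb => // k; have [_] := holo_fbl k.
exists b; split => //.
  apply: aeS ab => t /= h /h /ccvg_sqn.
  rewrite (_ : (fun k => _) = fun=> (1 : R)).
    by move=> c; apply/esym; apply: (cvg_unique (@Rhausdorff R) _ c); exact: cvg_cst.
  by apply: funext => k; rewrite /fbt -modc_sqr modc_fbl expr1n.
move=> z z1; have := ext_cvg fbt_L2 Lb cb z1.
rewrite (_ : (fun k => ext (fbt k) z) = (fun N => fbl N z))//.
by apply: funext => N; have [_ _] := holo_fbl N; apply.
Qed.

(** The definition by pointwise radial limits and the $L^2$ limit of the finite products meet here,
    through [radial_limit]. *)
Lemma blaschke_bd_ae b : H2 b -> (forall z, sqn z < 1 -> ccvg (fun N => fbl N z) (ext b z)) ->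
  {ae mu, forall t, T t -> blaschke_bd lam t = b t}.
Proof.
move=> Hb cb.
have bE z : sqn z < 1 -> blaschke lam z = ext b z.
  move=> /cb [c1 c2]; apply: cpxP; rewrite /blaschke /=; exact: cvg_lim.
have := radial_limit Hb; apply: aeS => t h Tt.
have key (p : C -> R) : (forall x y, p (x - y) = p x - p y) -> (forall x, `|p x| <= modc x) ->
   lim (p (blaschke lam (r%:C * expi t)) @[r --> (1:R)^'-]) = p (b t).
  move=> pB pM; apply: cvg_lim => //; apply/cvgrPdist_le => e e0.
  have [dd dd0 hd] := h Tt e e0.
  exists (Num.min 1 dd) => /=; first by rewrite lt_min ltr01.
  move=> r /=; rewrite lt_min => /andP[h1 h2] r1.
  have rp : 0 < 1 - r by rewrite subr_gt0.
  rewrite ger0_norm ?(ltW rp)// in h1 h2.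
  rewrite bE; last by rewrite sqnM sqn_expi mulr1 sqnC; nra.
  rewrite -pB; apply: le_trans (pM _) _; apply: hd => //; lra.
apply: cpxP; rewrite /blaschke_bd /=; apply: key => [x y|x].
- by rewrite cReD cReN.
- exact: Re_le_modc.
- by rewrite cImD cImN.
- exact: Im_le_modc.
Qed.

Lemma KI_iff b : {ae mu, forall t, T t -> blaschke_bd lam t = b t} ->
  forall F, KI lam F <-> H2 F /\ forall G, H2 G -> ip F (fun t => b t * G t) = 0.
Proof.
move=> ab F.
have E G : ip F (fun t => blaschke_bd lam t * G t) = ip F (fun t => b t * G t).
  by apply: ip_aeeq_r; apply: aeS ab => t /= h /h ->.
by split => -[HF h]; split => // G HG; [rewrite -E|rewrite E]; exact: h.
Qed.

Lemma L2_ae F G : cmeas G -> L2 F -> {ae mu, forall t, T t -> sqn (G t) = sqn (F t)} -> L2 G.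
Proof.
move=> mG LF h; have [m1 m2 i] := LF; split; [exact: mG.1|exact: mG.2|].
rewrite (@ae_eq_integral _ _ _ mu T (fun t => (sqn (F t))%:E))//.
- exact: mT.
- by apply/measurable_EFinP; exact: cmeas_sqn.
- by apply/measurable_EFinP; apply: cmeas_sqn; exact: L2_meas.
- by apply: aeS h => t /= h' /h' ->.
Qed.
Lemma L2_unimod b G : cmeas b -> {ae mu, forall t, T t -> sqn (b t) = 1} -> L2 G ->
  L2 (fun t => b t * G t).
Proof.
move=> mb ub LG; apply: (@L2_ae G) => //; first by apply: cmeasM => //; exact: L2_meas.
by apply: aeS ub => t /= h /h e; rewrite sqnM e mul1r.
Qed.

Lemma KI_lim (Fk : nat -> R -> C) F : (forall k, KI lam (Fk k)) -> L2 F -> l2cvg Fk F -> KI lam F.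
Proof.
have [b [Hb cb ub eb]] := blaschke_limit; have ab := blaschke_bd_ae Hb eb.
move=> h LF c; apply/(KI_iff ab).
have hH k : H2 (Fk k) by case: (h k).
split; first exact: H2_lim c.
move=> G HG; have LbG : L2 (fun t => b t * G t).
  by apply: L2_unimod ub _; [exact: L2_meas (H2_L2 Hb)|exact: H2_L2].
apply: (ccvg_unique (ip_cvgl (fun k => H2_L2 (hH k)) LF LbG c)).
rewrite (_ : (fun k => _) = fun=> 0); first exact: ccvg_cst.
by apply: funext => k; have /(KI_iff ab)[_] := h k; apply.
Qed.

(** The inner product of the kernel with $bG$ is the conjugate of $b(\lambda_n)G(\lambda_n)$, and
    $b(\lambda_n)=0$. *)
Lemma KI_ker n : KI lam (ker (lam n)).
Proof.
have [b [Hb cb ub eb]] := blaschke_limit; have ab := blaschke_bd_ae Hb eb.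
apply/(KI_iff ab); split; first exact: H2_ker.
move=> G HG; have LbG : L2 (fun t => b t * G t).
  by apply: L2_unimod ub _; [exact: L2_meas (H2_L2 Hb)|exact: H2_L2].
rewrite (ipJ LbG (ker_L2 (lam1 n))) -extE ext_mul//.
suff -> : ext b (lam n) = 0 by rewrite mul0r cj0.
apply: (ccvg_unique (eb _ (lam1 n))).
(* The shift makes $\lambda_n$ a zero of every product in the sequence. *)
have : ccvg (fun k => fbl (k + n.+1)%N (lam n)) 0.
  rewrite (_ : (fun k => _) = fun=> 0); first exact: ccvg_cst.
  by apply: funext => k; apply: fbl_root; rewrite addnS ltnS leq_addl.
move=> c; have c' := ccvg_sub (eb _ (lam1 n)) (fun k => leq_addr n.+1 k).
by rewrite -(ccvg_unique c' c); exact: eb.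
Qed.

Lemma KID F G : KI lam F -> KI lam G -> KI lam (fun t => F t + G t).
Proof.
have [b [Hb cb ub eb]] := blaschke_limit; have ab := blaschke_bd_ae Hb eb.
move=> /(KI_iff ab)[h1 h2] /(KI_iff ab)[h3 h4]; apply/(KI_iff ab); split; first exact: H2D.
move=> K HK; rewrite ipDl ?h2 ?h4 ?addr0//; [exact: H2_L2|exact: H2_L2|].
by apply: L2_unimod ub _; [exact: L2_meas (H2_L2 Hb)|exact: H2_L2].
Qed.
Lemma KIZ c F : KI lam F -> KI lam (fun t => c * F t).
Proof.
have [b [Hb cb ub eb]] := blaschke_limit; have ab := blaschke_bd_ae Hb eb.
move=> /(KI_iff ab)[h1 h2]; apply/(KI_iff ab); split; first exact: H2Z.
move=> K HK; rewrite ipZl ?h2 ?mulr0//; first exact: H2_L2.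
by apply: L2_unimod ub _; [exact: L2_meas (H2_L2 Hb)|exact: H2_L2].
Qed.
Lemma KIN F : KI lam F -> KI lam (fun t => - F t).
Proof.
move=> h; have := KIZ (-1) h; congr KI; apply: funext => t; by rewrite mulN1r.
Qed.
Lemma KIB F G : KI lam F -> KI lam G -> KI lam (fun t => F t - G t).
Proof. by move=> a b; apply: KID => //; exact: KIN. Qed.
Lemma KI_lcomb N a : KI lam (lcomb (khat lam) N a).
Proof.
elim: N => [|N IH].
  have := KIZ 0 (KI_ker 0); congr KI; apply: funext => t; by rewrite mul0r /lcomb big_ord0.
have := KID IH (KIZ (a N) (KIZ (Num.sqrt (sdef lam N))%:C (KI_ker N))).
by congr KI; apply: funext => t; rewrite /lcomb big_ord_recr.
Qed.

Lemma cI_root E z (q : C -> C) : H2 E -> sqn z < 1 -> ext E z = 0 -> holo q ->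
  cI (fun t => E t * (q (expi t) * (ker z t)^* )) = 0.
Proof.
move=> HE z1 E0 [bq Hq eq]; have := ext_mul Hq HE z1; rewrite E0 mulr0 => <-.
by rewrite extE ipE; apply: cI_eq => t _; ring.
Qed.

(** On the circle, division by the factor is multiplication by its conjugate. Times $e^{i(n+1)t}$
    this conjugate is a polynomial times the conjugate kernel at [a], so the negative coefficients
    are values at [a] of multiples of [E]. *)
Lemma H2_divbfac E a : H2 E -> sqn a < 1 -> ext E a = 0 ->
  H2 (fun t => E t * (bfac a (expi t))^* ) /\
  forall z, sqn z < 1 -> ext E z = bfac a z * ext (fun t => E t * (bfac a (expi t))^* ) z.
Proof.
move=> HE a1 E0; have [bb Hb eb] := holo_bfac a1.
have H : H2 (fun t => E t * (bfac a (expi t))^* ).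
  apply/H2P; split.
    have := L2M (bmeasJ bb) (H2_L2 HE); congr Defs.L2; apply: funext => t; exact: mulrC.
  case=> // n _.
  have [q hq qE] : exists2 q : C -> C, holo q & forall t : R,
      (bfac a (expi t))^* * expi t ^+ n.+1 = q (expi t) * (ker a t)^*.
    rewrite /bfac; case: eqP => [->|/eqP a0].
      exists (fun z => \prod_(k < n) id z); first by apply: holo_prod => k _; exact: holo_id.
      move=> t; rewrite ker0 cj1 mulr1 exprS mulrA [_^* * _]mulrC expi_mulJ mul1r.
      by rewrite prodr_const card_ord.
    exists (fun z => (`|a| / a)^* * ((a^* * z - 1) * \prod_(k < n) id z)).
      apply: holoZ; apply: holoM; last by apply: holo_prod => k _; exact: holo_id.
      by apply: holoB; [apply: holoZ; exact: holo_id|exact: holo_cst].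
    move=> t; rewrite prodr_const card_ord cjM -!mulrA; congr (_ * _).
    rewrite cjM cjV.
    rewrite cjD cjN exprS; have := expi_mulJ t; set e := expi t; set X := _^-1 => h.
    have -> : (a^* + - e^* ) * X * (e * e ^+ n) = (a^* * e - e * e^* ) * (e ^+ n * X) by ring.
    by rewrite h.
  rewrite -[RHS](cI_root HE a1 E0 hq); apply: cI_eq => t _; by rewrite -mulrA qE.
split => // z z1; rewrite -(eb z z1) -ext_mul//; apply: ip_eq => // t.
by rewrite mulrCA mulcJ -modc_sqr modc_bfac// expr1n mulr1.
Qed.

(** Distinctness of the zeros is what keeps the later ones: the factor just divided out does not
    vanish there. *)
Lemma H2_divfbl E N : H2 E -> (forall n, ext E (lam n) = 0) ->
  H2 (fun t => E t * (fbt N t)^* ) /\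
  forall n, (N <= n)%N -> ext (fun t => E t * (fbt N t)^* ) (lam n) = 0.
Proof.
move=> HE E0; elim: N => [|N [IH1 IH2]].
  have e t : E t = E t * (fbt 0 t)^* by rewrite /fbt /fbl big_ord0 cj1 mulr1.
  split; first exact: (H2_eq e HE).
  by move=> n _; rewrite -(E0 n); apply: ip_eq => // t.
have [h1 h2] := H2_divbfac IH1 (lam1 N) (IH2 N (leqnn N)).
have e t : E t * (fbt N t)^* * (bfac (lam N) (expi t))^* = E t * (fbt N.+1 t)^*.
  by rewrite /fbt /fbl big_ord_recr /= cjM mulrA.
split; first exact: (H2_eq e h1).
move=> n Nn; have := h2 (lam n) (lam1 n); rewrite (IH2 n (ltnW Nn)) => /esym/eqP.
rewrite mulf_eq0 (negbTE (bfac_neq0 (lam1 N) (lam1 n) _)) /=; last first.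
  by apply: contraTneq Nn => /lamI ->; rewrite ltnn.
by move=> /eqP <-; apply: ip_eq => // t.
Qed.

(** Dividing by the finite products and passing to the limit puts $E\bar b$ in $H^2$; then
    $E=b\,(E\bar b)$ almost everywhere lies in $bH^2$, so [E] is orthogonal to itself. *)
Lemma KI_zero E : KI lam E -> (forall n, ext E (lam n) = 0) -> nsq E = 0.
Proof.
have [b [Hb cb ub eb]] := blaschke_limit; have ab := blaschke_bd_ae Hb eb.
move=> /(KI_iff ab)[HE oE] E0; have LE := H2_L2 HE; have Lb := H2_L2 Hb.
have LJ : L2 (fun t => E t * (b t)^* ).
  have : L2 (fun t => (b t)^* * E t).
    apply: L2_unimod => //; first by apply: cmeasJ; exact: L2_meas.
    by apply: aeS ub => t /= h /h; rewrite sqnJ.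
  by congr Defs.L2; apply: funext => t; exact: mulrC.
have HJ : H2 (fun t => E t * (b t)^* ).
  apply/H2P; split => // n n0.
  pose K t := E t * expi t ^+ n.
  have LK : L2 K by have := H2_L2 (H2_mulX n HE).
  have c := ip_cvgl fbt_L2 Lb LK cb.
  have z0 N : ip (fbt N) K = 0.
    rewrite (ipJ LK (fbt_L2 N)) -[RHS](cj0 R); congr (_^* ).
    have [/H2P[_ /(_ n n0) <-] _] := H2_divfbl N HE E0.
    by rewrite ipE; apply: cI_eq => t _; rewrite /K; ring.
  have : ip b K = 0.
    by apply: (ccvg_unique c); rewrite (_ : (fun k => _) = fun=> 0); [exact: ccvg_cst|exact: funext].
  move=> h; rewrite -[RHS](cj0 R) -h -(ipJ Lb LK) ipE; apply: cI_eq => t _; rewrite /K; ring.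
apply: (@complexI R); rewrite -ip_nsq -[RHS](oE _ HJ); apply: ip_aeeq_r.
apply: aeS ub => t /= h /h e; by rewrite mulrCA mulcJ e mulr1.
Qed.

(** What the projections onto the kernels miss vanishes at every $\lambda_n$, hence is null by
    [KI_zero]. The norm bound makes later estimates uniform in [N]. *)
Lemma KI_density F : KI lam F -> exists a : nat -> nat -> C,
  l2cvg (fun N => lcomb (khat lam) N (a N)) F /\
  forall N, l2n (lcomb (khat lam) N (a N)) <= l2n F.
Proof.
move=> KF; have LF : L2 F by case: KF => /H2_L2.
have Lk := khat_L2 lam1.
have [a [P [LP cP oP lP]]] := proj_lim Lk LF; exists a; split => //.
have KP : KI lam P by apply: KI_lim cP => // N; exact: KI_lcomb.
have KE := KIB KF KP; have LE : L2 (fun t => F t - P t) by exact: L2B.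
have z0 : nsq (fun t => F t - P t) = 0.
  apply: KI_zero KE _ => n; have := oP n; rewrite ip_khat// => /eqP.
  rewrite mulf_eq0 => /orP[/eqP h|/eqP //]; exfalso.
  have := sdef_gt0 lam1 n; rewrite -sqrtr_gt0; move/complexI: h => ->.
  by rewrite ltxx.
apply/cvgrPdist_le => e e0; move/cvgrPdist_le: cP => /(_ e e0); apply: filterS => N.
rewrite !sub0r !normrN !ger0_norm ?l2n_ge0//; apply: le_trans.
have LS : L2 (lcomb (khat lam) N (a N)) by exact: lcomb_L2.
have := l2nD (L2B LS LP) (L2B LP LF).
have -> : l2n (fun t => P t - F t) = 0 by rewrite l2n_sub /l2n -/(rI _) -/(nsq _) z0 sqrtr0.
rewrite addr0; congr (l2n _ <= _); apply: funext => t; ring.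
Qed.

End BlaschkeProduct.

(** * The truncated Toeplitz operator *)

Section Toeplitz.
Variable R : realType.
Local Notation C := R[i].
Local Notation Re := complex.Re.
Local Notation Im := complex.Im.
Local Notation T := (@Tdom R).
Local Notation mu := (@lebesgue_measure R).
Implicit Types (F G H V : R -> C) (z : C).

Lemma CS_sum (a b : nat -> C) N :
  sqn (\sum_(n < N) a n * b n) <= (\sum_(n < N) sqn (a n)) * \sum_(n < N) sqn (b n).
Proof.
elim: N => [|N IH]; first by rewrite !big_ord0 sqn0 mulr0.
rewrite !big_ord_recr /=.
set X := \sum_(_ < _) _ * _ in IH *; set A := \sum_(_ < _) sqn (a _) in IH *.
set B := \sum_(_ < _) sqn (b _) in IH *.
have A0 : 0 <= A by apply: sumr_ge0 => n _; exact: sqn_ge0.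
have B0 : 0 <= B by apply: sumr_ge0 => n _; exact: sqn_ge0.
have h := modcD X (a N * b N).
rewrite -modc_sqr -!(modc_sqr (a N)) -!(modc_sqr (b N)).
apply: le_trans (_ : (modc X + modc (a N) * modc (b N)) ^+ 2 <= _).
  by rewrite -modcM ler_sqr ?nnegrE ?addr_ge0 ?modc_ge0.
rewrite -modc_sqr in IH; have X0 := modc_ge0 X.
set x := modc X in IH X0 *; set p := modc (a N); set q := modc (b N).
have p0 : 0 <= p by exact: modc_ge0.
have q0 : 0 <= q by exact: modc_ge0.
suff : 2 * x * (p * q) <= A * q ^+ 2 + B * p ^+ 2 by nra.
rewrite -(@ler_pXn2r _ 2) ?nnegrE ?addr_ge0 ?mulr_ge0 ?sqr_ge0//.
apply: le_trans (_ : 4 * (A * B) * (p * q) ^+ 2 <= _).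
  by rewrite [leLHS]exprMn ler_wpM2r ?sqr_ge0// exprMn -natrX ler_wpM2l.
by have := sqr_ge0 (A * q ^+ 2 - B * p ^+ 2); rewrite sqrrB sqrrD; nra.
Qed.

Lemma L2_ess F H : ess_bdd F -> L2 F -> L2 H -> L2 (fun t => (H t)^* * F t).
Proof.
move=> [M hM] LF LH; have mm : cmeas (fun t => (H t)^* * F t).
  by apply: cmeasM; [apply: cmeasJ|]; exact: L2_meas.
split; [exact: mm.1|exact: mm.2|].
have M0 : 0 <= Num.max M 0 by rewrite le_max lexx orbT.
apply: (@le_lt_trans _ _ (\int[mu]_(t in T) (Num.max M 0 * sqn (H t))%:E)%E).
  apply: ae_ge0_le_integral.
  - exact: mT.
  - by move=> t _; rewrite lee_fin sqn_ge0.
  - by apply/measurable_EFinP; exact: cmeas_sqn.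
  - by move=> t _; rewrite lee_fin mulr_ge0 ?sqn_ge0.
  - apply/measurable_EFinP; apply: measurable_funM; first exact: measurable_cst.
    by apply: cmeas_sqn; exact: L2_meas.
  - apply: aeS hM => t /= h /h h'; rewrite lee_fin sqnM sqnJ mulrC ler_wpM2r ?sqn_ge0//.
    by rewrite le_max h'.
have /rinteP[_] := rinteZ (Num.max M 0) (L2_sqn LH); congr (_ < _)%E.
by apply: eq_integral => t _; rewrite ger0_norm// mulr_ge0 ?sqn_ge0.
Qed.

Lemma ess_bddB F G : ess_bdd F -> ess_bdd G -> ess_bdd (fun t => F t - G t).
Proof.
move=> [M hM] [N hN]; exists (2 * (M + N)); apply: aeS (aeI hM hN) => t /= [h h'] Tt.
have := h Tt; have := h' Tt; rewrite !sqnE !cRI.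
set x := Re _; set y := Im _; set x' := Re _; set y' := Im _ => a b.
have := sqr_ge0 (x + x'); have := sqr_ge0 (y + y'); nra.
Qed.

Lemma bmeas_ess F : bmeas F -> ess_bdd F.
Proof. by move=> [_ [M hM]]; exists M; exact: aeT. Qed.

Lemma bmeas_sum (I : Type) (r : seq I) (P : pred I) (f : I -> R -> C) :
  (forall i, bmeas (f i)) -> bmeas (fun t => \sum_(i <- r | P i) f i t).
Proof.
move=> h; elim: r => [|i r IH].
  by under eq_fun do rewrite big_nil; exact: bmeas_cst.
under eq_fun do rewrite big_cons; case: (P i) => //; exact: bmeasD.
Qed.

Variables (lam : nat -> C) (d : R) (H : R -> C) (K0 : R).
Hypothesis lamI : injective lam.
Hypothesis lam1 : forall n, sqn (lam n) < 1.
Hypothesis d0 : 0 < d.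
Hypothesis sep : forall n N, d <= \prod_(k < N | k != n :> nat)
  modc ((lam n - lam k) / (1 - (lam k)^* * lam n)).
Hypothesis HH : H2 H.
Hypothesis K00 : 0 <= K0.
Hypothesis bdd : forall F V, KI lam F -> ess_bdd F -> tto_val lam H F V -> l2n V <= K0 * l2n F.

Local Notation c := (fun n => ext H (lam n)).
Local Notation khat := (khat lam).
Local Notation kcomb N a := (lcomb khat N a).

Lemma kcomb_bmeas N a : bmeas (kcomb N a).
Proof. by apply: bmeas_sum => n; apply: bmeasM; [exact: bmeas_cst|exact: khat_bmeas]. Qed.

Lemma kcomb_H2 N a : H2 (kcomb N a).
Proof. by apply: H2_sum => n _; apply: H2Z; exact: khat_H2. Qed.

Lemma kcomb_L2 N a : L2 (kcomb N a).
Proof. exact: H2_L2 (kcomb_H2 N a). Qed.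

Lemma ext_kcomb N a z : sqn z < 1 ->
  ext (kcomb N a) z = \sum_(n < N) a n * ((Num.sqrt (sdef lam n))%:C / (1 - (lam n)^* * z)).
Proof.
move=> z1; rewrite /lcomb ext_sum//; last by move=> n _; apply: H2Z; exact: khat_H2.
by apply: eq_bigr => n _; rewrite extZ ?ext_khat//; exact: khat_H2.
Qed.

Definition adj (a : nat -> C) n := (c n)^* * a n.

(* The kernels at the zeros are eigenvectors of A_{conj h}. *)
Lemma tto_kcomb N a : tto_val lam H (kcomb N a) (kcomb N (adj a)).
Proof.
split; first exact: (KI_lcomb lam1 d0 sep).
move=> G [HG _]; have LG := H2_L2 HG.
pose u n t := (H t)^* * ker (lam n) t - (c n)^* * ker (lam n) t.
have L1 n : L2 (fun t => (H t)^* * ker (lam n) t).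
  have := L2M (ker_bmeas (lam1 n)) (L2J (H2_L2 HH)); congr Defs.L2.
  by apply: funext => t; exact: mulrC.
have L2' n : L2 (fun t => (c n)^* * ker (lam n) t) by apply: L2Z; exact: ker_L2.
have Lu n : L2 (u n) by exact: L2B.
have -> : (fun t => (H t)^* * kcomb N a t - kcomb N (adj a) t) =
    lcomb u N (fun n => a n * (Num.sqrt (sdef lam n))%:C).
  apply: funext => t; rewrite /lcomb mulr_sumr -sumrB; apply: eq_bigr => n _.
  by rewrite /u /khat /adj; ring.
rewrite ip_lcombl//; apply: big1 => n _.
rewrite (_ : ip (u n) G = 0) ?mulr0//.
rewrite (ipJ LG (Lu n)) -[RHS](cj0 R); congr (_^* ); rewrite ipBr//.
have -> : ip G (fun t => (H t)^* * ker (lam n) t) = c n * ext G (lam n).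
  rewrite -ext_mul// extE !ipE; apply: cI_eq => t _.
  by rewrite cjM cjK; ring.
by rewrite ipZr ?cjK -?extE ?subrr//; exact: ker_L2.
Qed.

(** The difference of two values is a value at the difference, so boundedness becomes a Lipschitz
    estimate. *)
Lemma tto_dist F1 V1 F2 V2 : KI lam F1 -> ess_bdd F1 -> tto_val lam H F1 V1 ->
  KI lam F2 -> ess_bdd F2 -> tto_val lam H F2 V2 ->
  l2n (fun t => V1 t - V2 t) <= K0 * l2n (fun t => F1 t - F2 t).
Proof.
move=> k1 e1 [v1 t1] k2 e2 [v2 t2]; apply: bdd.
- exact: (KIB lam1 d0 sep).
- exact: ess_bddB.
split; first exact: (KIB lam1 d0 sep).
move=> G KG; have LG := H2_L2 KG.1; have LH := H2_L2 HH.
have L1 := L2B (L2_ess e1 (H2_L2 k1.1) LH) (H2_L2 v1.1).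
have L2' := L2B (L2_ess e2 (H2_L2 k2.1) LH) (H2_L2 v2.1).
have := ipBl L1 L2' LG; rewrite t1// t2// subrr => <-.
by apply: ip_eq => // t; ring.
Qed.

(** * Oscillation of functions in the range *)

Local Notation Kr := (rconst d).

(** This is $|w_n(z)-w_n(z')|^2$; the formula makes sense on the circle too, and [zeta] is later
    used as second point. *)
Definition osc z z' n : R :=
  sdef lam n * sqn (c n) * sqn ((1 - (lam n)^* * z)^-1 - (1 - (lam n)^* * z')^-1).

Lemma kcomb_osc N a z z' Om : sqn z < 1 -> sqn z' < 1 -> \sum_(n < N) osc z z' n <= Om ->
  modc (ext (kcomb N (adj a)) z - ext (kcomb N (adj a)) z') <= Kr * l2n (kcomb N a) * Num.sqrt Om.
Proof.
move=> z1 z1' hO; rewrite !ext_kcomb// -sumrB.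
have Om0 : 0 <= Om.
  apply: le_trans hO; apply: sumr_ge0 => n _; rewrite !mulr_ge0 ?sqn_ge0//.
  exact: ltW (sdef_gt0 lam1 n).
pose b n : C := (c n)^* * (Num.sqrt (sdef lam n))%:C *
  ((1 - (lam n)^* * z)^-1 - (1 - (lam n)^* * z')^-1).
rewrite (eq_bigr (fun n : 'I_N => a n * b n)); last by move=> n _; rewrite /adj /b; ring.
rewrite modc_le_sqn; last exact: mulr_ge0 (mulr_ge0 (rconst_ge0 d0) (l2n_ge0 _)) (sqrtr_ge0 _).
apply: le_trans (CS_sum a b N) _; rewrite (exprMn 2 (Kr * _)) (exprMn 2 Kr) l2n_sqr sqr_sqrtr//.
apply: ler_pM.
- by apply: sumr_ge0 => n _; exact: sqn_ge0.
- by apply: sumr_ge0 => n _; exact: sqn_ge0.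
- exact: (riesz_lower lam1 d0 sep).
apply: le_trans hO; apply: ler_sum => n _.
by rewrite /b /osc !sqnM sqnJ sqnC sqr_sqrt_sdef// [sqn (c n) * _]mulrC.
Qed.

(** The estimate for kernel combinations passes to each [Vk k] by [tto_dist], since the combinations
    converge to [Fk k], and then to [V] by continuity of point evaluations. *)
Lemma range_osc V : tto_range lam H V -> exists2 A, 0 <= A & forall z z' Om,
  sqn z < 1 -> sqn z' < 1 -> (forall N, \sum_(n < N) osc z z' n <= Om) ->
  modc (ext V z - ext V z') <= A * Num.sqrt Om.
Proof.
move=> [LV [F [KF [Fk [Vk [h cF cV]]]]]].
have LF := H2_L2 KF.1.
have LFk k : L2 (Fk k) by have [[/H2_L2]] := h k.
have LVk k : L2 (Vk k) by have [_ [_ [[/H2_L2]]]] := h k.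
have Kr0 : 0 <= Kr by exact: rconst_ge0.
exists (Kr * l2n F) => [|z z' Om z1 z1' hO]; first by rewrite mulr_ge0 ?l2n_ge0.
have step k : modc (ext (Vk k) z - ext (Vk k) z') <= Kr * l2n (Fk k) * Num.sqrt Om.
  have [KFk [eFk tFk]] := h k.
  have [a [ca la]] := KI_density lamI lam1 d0 sep KFk.
  have cW : l2cvg (fun N => kcomb N (adj (a N))) (Vk k).
    apply: (@squeeze_cvgr _ _ _ _ (fun=> 0)
      (fun N => K0 * l2n (fun t => kcomb N (a N) t - Fk k t))).
    - apply: nearW => N; rewrite l2n_ge0 /=; apply: tto_dist => //.
      + exact: (KI_lcomb lam1 d0 sep).
      + exact: bmeas_ess (kcomb_bmeas N (a N)).
      + exact: tto_kcomb.
    - exact: cvg_cst.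
    - by rewrite -(mulr0 K0); apply: cvgM => //; exact: cvg_cst.
  have LW N : L2 (kcomb N (adj (a N))) by exact: kcomb_L2.
  have := ccvg_modc (ccvgB (ext_cvg LW (LVk k) cW z1) (ext_cvg LW (LVk k) cW z1')).
  move=> /ler_cvg_to /(_ (cvg_cst (Kr * l2n (Fk k) * Num.sqrt Om))); apply.
  apply: nearW => N; apply: le_trans (kcomb_osc (a N) z1 z1' (hO N)) _.
  by rewrite ler_wpM2r ?sqrtr_ge0// ler_wpM2l.
have := ccvg_modc (ccvgB (ext_cvg LVk LV cV z1) (ext_cvg LVk LV cV z1')).
move=> /ler_cvg_to; apply; last exact: nearW step.
apply: cvgM; last exact: cvg_cst.
by apply: cvgM; [exact: cvg_cst|exact: l2n_cvg].
Qed.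

(** * From the summability condition to non-tangential limits *)

Variable zeta : C.
Hypothesis zeta1 : sqn zeta = 1.

Definition om n : R := (1 - sqn (lam n)) * (sqn (ext H (lam n)) / sqn (zeta - lam n)).

Lemma modc_zeta : modc zeta = 1. Proof. by rewrite modcE zeta1 sqrtr1. Qed.

Lemma sqn_den n : sqn (1 - (lam n)^* * zeta) = sqn (zeta - lam n).
Proof.
have -> : 1 - (lam n)^* * zeta = zeta * (zeta - lam n)^*.
  by rewrite cjD cjN mulrDr mulcJ zeta1 mulrN [_ * (lam n)^* ]mulrC.
by rewrite sqnM sqnJ zeta1 mul1r.
Qed.

Lemma om_ge0 n : 0 <= om n.
Proof. by rewrite !mulr_ge0 ?invr_ge0 ?sqn_ge0// ltW// subr_gt0. Qed.

Lemma om_sumP : (\sum_(0 <= n <oo) (om n)%:E < +oo)%E <->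
  exists B, forall N, \sum_(n < N) om n <= B.
Proof.
have o0 n : (0 <= n)%N -> (true : bool) -> (0 <= (om n)%:E)%E by rewrite lee_fin om_ge0.
split=> [fin|[B hB]].
  set s := (\sum_(0 <= n <oo) _)%E in fin.
  have s0 : (0 <= s)%E by apply: nneseries_ge0 => n _ _; rewrite lee_fin om_ge0.
  have sf : s \is a fin_num by rewrite ge0_fin_numE.
  exists (fine s) => N; rewrite -lee_fin fineK// -sumEFin -(big_mkord xpredT (fun n => (om n)%:E)).
  by apply: nneseries_lim_ge => n _ _; rewrite lee_fin om_ge0.
apply: (@le_lt_trans _ _ B%:E); last exact: ltry.
apply: lime_le; first by apply: is_cvg_nneseries => n _ _; rewrite lee_fin om_ge0.
by apply: nearW => N; rewrite big_mkord sumEFin lee_fin.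
Qed.

(** In a Stolz angle $|1-\bar\lambda_n\zeta|\le(1+M)|1-\bar\lambda_nz|$ and $|\zeta-z|\le
    M|1-\bar\lambda_nz|$. The first estimate is uniform in $z$ and serves the tail of the series;
    the second tends to 0 with $\zeta-z$ and serves finitely many terms. *)
Lemma osc_stolz M z n : 1 < M -> sqn z < 1 -> modc (zeta - z) <= M * (1 - modc z) ->
  osc z zeta n <= om n * M ^+ 2 /\
  osc z zeta n <= (1 + M) ^+ 2 * (om n / sqn (zeta - lam n)) * sqn (zeta - z).
Proof.
move=> M1 z1 hz; have mz : modc z < 1 by rewrite modc_lt1.
have nz : 1 - (lam n)^* * z != 0 by rewrite sub1_neq0 ?ltW.
have nze : 1 - (lam n)^* * zeta != 0 by rewrite sub1_neq0 ?modc_zeta.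
have E : (1 - (lam n)^* * z)^-1 - (1 - (lam n)^* * zeta)^-1 =
   (lam n)^* * (z - zeta) / ((1 - (lam n)^* * z) * (1 - (lam n)^* * zeta)) by field; rewrite nz nze.
have l1 : modc (lam n) < 1 by rewrite modc_lt1.
have l0 := modc_ge0 (lam n); have z0 := modc_ge0 z.
set p := modc (1 - (lam n)^* * z).
have p0 : 0 < p by rewrite modc_gt0.
have pz : 1 - modc z <= p.
  apply: (le_trans _ (modc_subr _ _)); rewrite modc1 modcM modcJ lerD2l lerN2.
  by rewrite ler_piMl// ltW.
set q := modc (1 - (lam n)^* * zeta).
have q0 : 0 < q by rewrite modc_gt0.
have q2 : q ^+ 2 = sqn (zeta - lam n) by rewrite modc_sqr sqn_den.
have qp : q <= (1 + M) * p.
  have -> : q = modc ((1 - (lam n)^* * z) - (lam n)^* * (zeta - z)) by congr modc; ring.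
  apply: le_trans (modcD _ _) _; rewrite modcN modcM modcJ -/p.
  have : modc (lam n) * modc (zeta - z) <= modc (zeta - z) by rewrite ler_piMl ?modc_ge0 ?ltW.
  by move=> h; nra.
set x := modc (zeta - z) in hz *; have x0 : 0 <= x by exact: modc_ge0.
have sE : sqn ((1 - (lam n)^* * z)^-1 - (1 - (lam n)^* * zeta)^-1) <= (x / (p * q)) ^+ 2.
  rewrite E -modc_sqr lerXn2r ?nnegrE ?modc_ge0 ?divr_ge0 ?mulr_ge0 ?(ltW p0) ?(ltW q0)//.
  rewrite !modcM modcV modcM modcJ -/p -/q ler_wpM2r ?invr_ge0 ?mulr_ge0 ?(ltW p0) ?(ltW q0)//.
  by rewrite modcB -/x ler_piMl// ltW.
have s0 := sdef_gt0 lam1 n.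
have O y : x / (p * q) <= y -> 0 <= y -> osc z zeta n <= sdef lam n * sqn (c n) * y ^+ 2.
  move=> xy y0; rewrite /osc ler_wpM2l ?mulr_ge0 ?sqn_ge0 ?(ltW s0)//.
  apply: le_trans sE _; rewrite lerXn2r ?nnegrE ?divr_ge0 ?mulr_ge0 ?(ltW p0) ?(ltW q0)//.
split.
  apply: le_trans (O (M / q) _ _) _.
  - rewrite invfM mulrA ler_wpM2r ?invr_ge0 ?(ltW q0)// ler_pdivrMr//; nra.
  - by rewrite divr_ge0 ?(ltW q0)//; lra.
  by rewrite /om -/(sdef lam n) expr_div_n q2 le_eqVlt; apply/orP; left; apply/eqP; ring.
apply: le_trans (O ((1 + M) * x / q ^+ 2) _ _) _.
- rewrite invfM mulrA ler_pdivrMr// ler_pdivrMr// -mulrA -mulrA.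
  have -> : (1 + M) * (x / q ^+ 2) * (q * p) = x * ((1 + M) * p / q).
    by field; rewrite gt_eqF.
  by rewrite ler_peMr// ler_pdivlMr// mul1r.
- by rewrite divr_ge0 ?sqr_ge0// mulr_ge0//; lra.
rewrite /om -/(sdef lam n) -q2 -(modc_sqr (zeta - z)) -/x; rewrite le_eqVlt; apply/orP; left; apply/eqP.
by field; rewrite gt_eqF.
Qed.

Lemma osc_small M eps : 1 < M -> 0 < eps -> (exists B, forall N, \sum_(n < N) om n <= B) ->
  exists2 delta, 0 < delta & forall z, sqn z < 1 -> modc (zeta - z) <= M * (1 - modc z) ->
    modc (zeta - z) < delta -> forall N, \sum_(n < N) osc z zeta n <= eps.
Proof.
move=> M1 e0 [B hB]; have M0 : 0 < M by lra.
have mono m n : (m <= n)%N -> \sum_(k < m) om k <= \sum_(k < n) om k.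
  move=> mn; rewrite -!(big_mkord xpredT om) (big_cat_nat (leq0n m) mn)/= lerDl.
  by apply: sumr_ge0 => k _; exact: om_ge0.
have M20 : 0 < M ^+ 2 by exact: exprn_gt0.
have e2 : 0 < eps / 2 / M ^+ 2 by rewrite !divr_gt0.
(* Beyond [N0] the [om] add up to at most $\varepsilon/(2M^2)$, which the uniform estimate turns
   into $\varepsilon/2$. *)
have [N0 hN0] := mono_cauchy mono hB e2.
pose D := \sum_(n < N0) om n / sqn (zeta - lam n).
have D0 : 0 <= D by apply: sumr_ge0 => n _; rewrite divr_ge0 ?om_ge0 ?sqn_ge0.
pose E := (1 + M) ^+ 2 * (D + 1).
have E0 : 0 < E by rewrite mulr_gt0 ?exprn_gt0; lra.
(* The bound 1 gives $|\zeta-z|^2\le|\zeta-z|$, so a linear condition suffices for the first [N0]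
   terms. *)
exists (Num.min 1 (eps / 2 / E)); first by rewrite lt_min ltr01 !divr_gt0.
move=> z z1 hz; rewrite lt_min => /andP[x1 x2] N.
have osc0 n : 0 <= osc z zeta n by rewrite !mulr_ge0 ?sqn_ge0// ltW// sdef_gt0.
apply: le_trans (_ : \sum_(n < N0 + N) osc z zeta n <= _).
  rewrite -!(big_mkord xpredT (osc z zeta)) (big_cat_nat (leq0n N) (leq_addl N0 N))/= lerDl.
  by apply: sumr_ge0 => k _; exact: osc0.
rewrite -(big_mkord xpredT (osc z zeta)) (big_cat_nat (leq0n N0) (leq_addr N N0))/=.
have P1 : \sum_(0 <= n < N0) osc z zeta n <= eps / 2.
  rewrite big_mkord; apply: le_trans (_ : (1 + M) ^+ 2 * D * sqn (zeta - z) <= _).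
    rewrite /D mulr_sumr mulr_suml; apply: ler_sum => n _.
    by have [_] := osc_stolz n M1 z1 hz.
  rewrite ltr_pdivlMr// in x2; apply: le_trans (ltW x2).
  have x0 := modc_ge0 (zeta - z); rewrite -modc_sqr; set x := modc _ in x0 x1 *.
  have xx : x ^+ 2 <= x by rewrite expr2 ler_piMl// ltW.
  have Q0 : 0 <= (1 + M) ^+ 2 by exact: sqr_ge0.
  rewrite /E mulrC; apply: ler_pM => //; [exact: sqr_ge0|exact: mulr_ge0|].
  by rewrite ler_wpM2l// lerDl.
have P2 : \sum_(N0 <= n < N0 + N) osc z zeta n <= eps / 2.
  apply: le_trans (_ : \sum_(N0 <= n < N0 + N) om n * M ^+ 2 <= _).
    by apply: ler_sum => n _; have [] := osc_stolz n M1 z1 hz.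
  rewrite -mulr_suml -ler_pdivlMr//.
  have := hN0 _ _ (leqnn N0) (leq_addr N N0).
  rewrite -!(big_mkord xpredT om) [in X in X -> _](big_cat_nat (leq0n N0) (leq_addr N N0))/=.
  by rewrite addrAC subrr add0r.
by rewrite (splitr eps) lerD.
Qed.

Lemma osc_pair z z' n : osc z z' n <= 2 * (osc z zeta n + osc z' zeta n).
Proof.
rewrite -mulrDr mulrCA /osc ler_wpM2l ?mulr_ge0 ?sqn_ge0 ?(ltW (sdef_gt0 lam1 n))//.
set x := _^-1; set y := _^-1; set w := (1 - _ * zeta)^-1.
rewrite !sqnE !cRI; have := sqr_ge0 (Re x + Re y - 2 * Re w).
have := sqr_ge0 (Im x + Im y - 2 * Im w); nra.
Qed.

Lemma range_cauchy V M e : (exists B, forall N, \sum_(n < N) om n <= B) ->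
  tto_range lam H V -> 1 < M -> 0 < e ->
  exists2 delta, 0 < delta & forall z z',
    [/\ sqn z < 1, modc (zeta - z) <= M * (1 - modc z) & modc (zeta - z) < delta] ->
    [/\ sqn z' < 1, modc (zeta - z') <= M * (1 - modc z') & modc (zeta - z') < delta] ->
    modc (ext V z - ext V z') <= e.
Proof.
move=> hB rV M1 e0; have [A A0 hA] := range_osc rV.
(* Chosen so that $A\sqrt{4q^2}=eA/(A+1)\le e$; the 4 comes from [osc_pair] applied with two
   oscillations of at most $q^2$. *)
pose q := e / (2 * (A + 1)).
have q0 : 0 < q by rewrite divr_gt0// mulr_gt0//; lra.
have [dl dl0 hd] := osc_small M1 (exprn_gt0 2 q0) hB.
exists dl => // z z' [a1 a2 a3] [b1 b2 b3].
apply: le_trans (hA z z' (4 * q ^+ 2) a1 b1 _) _.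
  move=> N; apply: le_trans (_ : \sum_(n < N) 2 * (osc z zeta n + osc z' zeta n) <= _).
    by apply: ler_sum => n _; exact: osc_pair.
  rewrite -mulr_sumr big_split /=; have := hd z a1 a2 a3 N; have := hd z' b1 b2 b3 N; lra.
have -> : Num.sqrt (4 * q ^+ 2) = 2 * q.
  have -> : 4 * q ^+ 2 = (2 * q) ^+ 2 by ring.
  by rewrite sqrtr_sqr ger0_norm// mulr_ge0// ltW.
have -> : A * (2 * q) = e * (A / (A + 1)) by rewrite /q; field; rewrite gt_eqF//; lra.
by rewrite ler_piMr ?(ltW e0)// ler_pdivrMr; lra.
Qed.

(** The limit is built along the radius, whose points lie in the Stolz angle of every aperture
    $M>1$; one [L] therefore serves all apertures. *)
Lemma nt_of_sum V : (exists B, forall N, \sum_(n < N) om n <= B) ->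
  tto_range lam H V -> nt_limit (ext V) zeta.
Proof.
move=> hB rV.
pose r (k : nat) : R := (k.+2%:R)^-1.
have r0 k : 0 < r k by rewrite invr_gt0 ltr0n.
have r1 k : r k < 1 by rewrite invf_lt1 ?ltr0n// ltr1n.
pose zk k : C := (1 - r k)%:C * zeta.
have dz k : modc (zeta - zk k) = r k.
  have -> : zeta - zk k = (r k)%:C * zeta by rewrite /zk rmorphB /= rmorph1; ring.
  by rewrite modcM modcC modc_zeta mulr1 ger0_norm// ltW.
have mz k : modc (zk k) = 1 - r k.
  by rewrite modcM modcC modc_zeta mulr1 ger0_norm// subr_ge0 ltW.
have zk1 k : sqn (zk k) < 1 by rewrite -modc_lt1 mz; have := r0 k; lra.
have near dl : 0 < dl -> exists N, forall k, (N <= k)%N -> r k < dl.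
  move=> dl0; exists (Num.bound dl^-1) => k Nk.
  rewrite /r invf_plt ?posrE ?ltr0n//.
  apply: lt_le_trans (archi_boundP (ltW _)) _; rewrite ?invr_gt0// ler_nat.
  by apply: leq_trans Nk _; rewrite -addn2 leq_addr.
have stz M k : 1 < M -> modc (zeta - zk k) <= M * (1 - modc (zk k)).
  by move=> M1; rewrite dz mz opprB addrC subrK ler_peMl ?ltW.
have cau e : 0 < e -> exists N, forall m n, (N <= m)%N -> (N <= n)%N ->
    modc (ext V (zk m) - ext V (zk n)) <= e.
  move=> e0; have M2 : (1 : R) < 2 by lra.
  have [dl dl0 hd] := range_cauchy hB rV M2 e0; have [N hN] := near _ dl0.
  by exists N => m n Nm Nn; apply: hd; split; rewrite ?stz ?dz ?hN.
have cvp (p : C -> R) : (forall x y, p (x - y) = p x - p y) -> (forall x, `|p x| <= modc x) ->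
   cvgn (fun k => p (ext V (zk k))).
  move=> pB pM; apply: cauchy_cvg; apply: cauchy_exP => e e0.
  have e2 : 0 < e / 2 by lra.
  have [N hN] := cau _ e2; exists (p (ext V (zk N))), N => // n /= Nn.
  rewrite /ball /= -pB; apply: le_lt_trans (pM _) _; apply: le_lt_trans (hN _ _ (leqnn N) Nn) _; lra.
pose L : C := Complex (limn (fun k => Re (ext V (zk k)))) (limn (fun k => Im (ext V (zk k)))).
have cL : ccvg (fun k => ext V (zk k)) L.
  by split; apply: cvp => [x y|x]; rewrite ?cReD ?cReN ?cImD ?cImN ?Re_le_modc ?Im_le_modc.
exists L => M M1 e e0; have e2 : 0 < e / 2 by lra.
have [dl dl0 hd] := range_cauchy hB rV M1 e2; have [N hN] := near _ dl0.
exists dl => // z z1 hz hzd; apply: (@le_lt_trans _ _ (e / 2)); last lra.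
have := ccvg_modc (ccvgB (ccvg_cst (ext V z)) cL).
move=> /ler_cvg_to /(_ (cvg_cst (e / 2))); apply.
by exists N => // k /= Nk; apply: hd; split; rewrite ?stz ?dz ?hN.
Qed.

(** * From non-tangential limits to the summability condition *)

Definition tl n : R := 1 + \sum_(m < n) om m.
Definition wk n : C := (c n)^* * ((Num.sqrt (sdef lam n))%:C / (1 - (lam n)^* * zeta)).
(** The shift to [tl n.+1] puts [om n] itself in the denominator, and the 1 in [tl] keeps that
    denominator positive even while the first [om] vanish. *)
Definition ak n : C := (wk n)^* / (tl n.+1)%:C.

Lemma sqn_wk n : sqn (wk n) = om n.
Proof.
rewrite /wk !sqnM sqnJ sqnV sqn_den sqnC sqr_sqrt_sdef// /om -/(sdef lam n); ring.
Qed.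

Lemma tl_gt0 n : 0 < tl n.
Proof. by rewrite ltr_pwDl// sumr_ge0// => k _; exact: om_ge0. Qed.

Lemma tlS n : tl n.+1 = tl n + om n.
Proof. by rewrite /tl big_ord_recr /= addrA. Qed.

Lemma sqn_ak n : sqn (ak n) = om n / tl n.+1 ^+ 2.
Proof. by rewrite /ak sqnM sqnJ sqnV sqnC sqn_wk. Qed.

(** Each term is at most [(tl n)^-1 - (tl n.+1)^-1], and the differences telescope from
    [tl 0 = 1]. *)
Lemma sum_ak_le N : \sum_(n < N) sqn (ak n) <= 1 - (tl N)^-1.
Proof.
elim: N => [|N IH]; first by rewrite /tl !big_ord0 addr0 invr1 subrr.
rewrite big_ord_recr /=; apply: le_trans (lerD IH (lexx _)) _.
rewrite sqn_ak; have := tl_gt0 N; have := tl_gt0 N.+1; rewrite tlS.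
set x := tl N; set y := om N => xy0 x0; have y0 : 0 <= y by exact: om_ge0.
have -> : 1 - (x + y)^-1 = (1 - x^-1) + y / (x * (x + y)) by field; rewrite !gt_eqF.
rewrite lerD2l ler_wpM2l// lef_pV2 ?posrE ?exprn_gt0 ?mulr_gt0// expr2 ler_wpM2r ?(ltW xy0)//.
by rewrite lerDl.
Qed.

(* Abel-Dini: sum om_n / S_n diverges with sum om_n, while sum om_n / S_n^2 converges. *)
Lemma abel_dini (B : R) : (forall B, exists N, B < \sum_(n < N) om n) ->
  exists N, B <= \sum_(n < N) om n / tl n.+1.
Proof.
move=> unb.
have t0 n : 0 <= om n / tl n.+1 by rewrite divr_ge0 ?om_ge0 ?(ltW (tl_gt0 _)).
have tmono m n : (m <= n)%N -> tl m <= tl n.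
  move=> mn; rewrite lerD2l -!(big_mkord xpredT om) (big_cat_nat (leq0n m) mn)/= lerDl.
  by apply: sumr_ge0 => k _; exact: om_ge0.
have step j : exists N, j%:R / 2 <= \sum_(n < N) om n / tl n.+1.
  elim: j => [|j [N IH]]; first by exists 0%N; rewrite big_ord0 mul0r.
  (* [N'] is chosen so that [tl] at least doubles; each doubling contributes at least $1/2$. *)
  have [N' hN'] := unb (2 * tl N); exists (N + N')%N.
  have h : 2 * tl N <= tl (N + N')%N.
    apply: le_trans (tmono _ _ (leq_addl N N')); apply: ltW.
    by apply: lt_le_trans hN' _; rewrite /tl lerDr.
  rewrite -(big_mkord xpredT (fun n => om n / tl n.+1)).
  rewrite (big_cat_nat (leq0n N) (leq_addr N' N))/= big_mkord -natr1 mulrDl lerD//.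
  have p := tl_gt0 (N + N')%N.
  apply: le_trans (_ : \sum_(N <= n < N + N') om n / tl (N + N')%N <= _); last first.
    rewrite !big_seq; apply: ler_sum => n; rewrite mem_index_iota => /andP[_ nN].
    by rewrite ler_wpM2l ?om_ge0// lef_pV2 ?posrE ?tl_gt0// tmono.
  rewrite -mulr_suml ler_pdivlMr//.
  have : tl (N + N')%N = tl N + \sum_(N <= n < N + N') om n.
    by rewrite /tl -!(big_mkord xpredT om) (big_cat_nat (leq0n N) (leq_addr N' N))/= addrA.
  by move: h p; set x := tl N; set y := tl (N + N')%N => h p e; lra.
have [N hN] := step (Num.bound `|2 * B|); exists N; apply: le_trans hN.
have := archi_boundP (normr_ge0 (2 * B)); have := ler_norm (2 * B); lra.
Qed.

Lemma kcomb_cauchy : l2cauchy (fun N => kcomb N ak).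
Proof.
apply: (@l2cauchy_mono _ _ (fun N => Kr ^+ 2 * \sum_(n < N) sqn (ak n)) (Kr ^+ 2)); last first.
  move=> N; apply: ler_piMr; first exact: sqr_ge0.
  by apply: le_trans (sum_ak_le N) _; rewrite lerBlDr lerDl invr_ge0 ltW// tl_gt0.
move=> m n mn; rewrite l2n_sqr.
(* Zeroing the first coefficients turns the difference into a kernel combination, to which
   [riesz_upper] applies. *)
pose b k := if (m <= k)%N then ak k else 0.
have b0 k : (0 <= k < m)%N -> b k = 0 by move=> /andP[_ km]; rewrite /b leqNgt km.
have -> : (fun t => kcomb n ak t - kcomb m ak t) = kcomb n b.
  apply: funext => t; rewrite /lcomb -!(big_mkord xpredT (fun k => _ k * khat k t)).
  rewrite !(big_cat_nat (leq0n m) mn)/= addrAC subrr add0r.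
  have -> : \sum_(0 <= k < m) b k * khat k t = 0.
    by rewrite big_nat; apply: big1 => k /b0 ->; rewrite mul0r.
  rewrite add0r.
  by rewrite !big_nat; apply: eq_bigr => k /andP[mk _]; rewrite /b mk.
apply: le_trans (riesz_upper lam1 d0 sep n b) _; rewrite -mulrBr ler_wpM2l ?sqr_ge0//.
rewrite -(big_mkord xpredT (fun k => sqn (b k))) -!(big_mkord xpredT (fun k => sqn (ak k))) !(big_cat_nat (leq0n m) mn)/=.
have -> : \sum_(0 <= k < m) sqn (b k) = 0.
  by rewrite big_nat; apply: big1 => k /b0 ->; rewrite sqn0.
rewrite add0r [X in _ <= X]addrAC subrr add0r.
by rewrite !big_nat; apply: ler_sum => k /andP[mk _]; rewrite /b mk.
Qed.

(** Square summability gives convergence of the kernel series in $K_I$, and boundedness of the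
    operator makes the images converge as well, so their limit is in the range. *)
Lemma witness : exists2 V, tto_range lam H V &
  l2cvg (fun N => kcomb N (adj ak)) V.
Proof.
have LF N : L2 (kcomb N ak) by exact: kcomb_L2.
have LV N : L2 (kcomb N (adj ak)) by exact: kcomb_L2.
have [F [LFl cF _]] := L2_complete LF kcomb_cauchy.
have KF N a : KI lam (kcomb N a) by exact: (KI_lcomb lam1 d0 sep).
have cV : l2cauchy (fun N => kcomb N (adj ak)).
  move=> e e0; have K1 : 0 < K0 + 1 by rewrite ltr_wpDl.
  have [N hN] := kcomb_cauchy (divr_gt0 e0 K1); exists N => m n Nm Nn.
  apply: le_trans (tto_dist (KF m ak) (bmeas_ess (kcomb_bmeas m ak)) (tto_kcomb m ak)
    (KF n ak) (bmeas_ess (kcomb_bmeas n ak)) (tto_kcomb n ak)) _.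
  have := hN m n Nm Nn; rewrite ler_pdivlMr//.
  by have := l2n_ge0 (fun t => kcomb m ak t - kcomb n ak t); set x := l2n _; nra.
have [V [LVl cVl _]] := L2_complete LV cV; exists V => //; split=> //.
exists F; split; first exact: (KI_lim lam1 d0 sep) (fun N => KF N ak) LFl cF.
exists (fun N => kcomb N ak), (fun N => kcomb N (adj ak)); split => // k.
by split=> //; split; [exact: bmeas_ess (kcomb_bmeas k ak)|exact: tto_kcomb].
Qed.

(** Applied with $u=\bar\lambda_n\zeta$: all terms of the real part of the series at $r\zeta$ are
    nonnegative, so truncation only lowers it. *)
Lemma Re_ratio_ge0 (u : C) (r : R) : modc u <= 1 -> 0 <= r -> r <= 1 ->
  0 <= Re ((1 - u) / (1 - r%:C * u)).
Proof.
move=> u1 r0 r1; rewrite cReM cReV cImV mulrN opprK !mulrA -mulrDl divr_ge0 ?sqn_ge0//.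
rewrite !cRI /=; have := u1; rewrite modc_le_sqn// expr1n sqnE => h.
have x := le_trans (ler_norm _) (le_trans (Re_le_modc u) u1).
set a := Re u in h x *; set b := Im u in h *.
have : 0 <= (1 - a) * (1 - r * a) + r * b ^+ 2; last by nra.
have ra : r * a <= 1 by nra.
by apply: addr_ge0; apply: mulr_ge0; rewrite ?subr_ge0 ?sqr_ge0.
Qed.

(** From $(1-u)/(1-ru)=1-(1-r)u/(1-ru)$: for fixed $u$ the ratio tends to 1 as $r\to1$, with an
    explicit error. *)
Lemma Re_ratio_lower (u : C) (r : R) : modc u < 1 -> 0 <= r -> r <= 1 ->
  1 - (1 - r) / (1 - modc u) <= Re ((1 - u) / (1 - r%:C * u)).
Proof.
move=> u1 r0 r1; have u0 := modc_ge0 u.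
have ru : 1 - modc u <= modc (1 - r%:C * u).
  apply: (le_trans _ (modc_subr _ _)); rewrite modc1 modcM modcC ger0_norm// lerD2l lerN2.
  by rewrite ler_piMl.
have p : 0 < 1 - modc u by rewrite subr_gt0.
have nz : 1 - r%:C * u != 0 by rewrite -modc_gt0; exact: lt_le_trans ru.
have -> : (1 - u) / (1 - r%:C * u) = 1 - (1 - r)%:C * u / (1 - r%:C * u).
  by rewrite rmorphB rmorph1; field.
rewrite cReD cReN lerD2l lerN2; apply: le_trans (ler_norm _) _; apply: le_trans (Re_le_modc _) _.
rewrite modcM modcM modcV modcC ger0_norm ?subr_ge0//.
apply: ler_pM; rewrite ?mulr_ge0 ?invr_ge0 ?modc_ge0 ?subr_ge0//.
  by rewrite ler_piMr ?subr_ge0// ltW.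
by rewrite lef_pV2 ?posrE// (lt_le_trans p).
Qed.

Lemma sum_of_nt : (forall V, tto_range lam H V -> nt_limit (ext V) zeta) ->
  exists B, forall N, \sum_(n < N) om n <= B.
Proof.
move=> hV; apply: contrapT => nB.
have unb (B : R) : exists N, B < \sum_(n < N) om n.
  apply: contrapT => h; apply: nB; exists B => N; rewrite leNgt; apply/negP => lt.
  by apply: h; exists N.
have [V rV cV] := witness; have [L /(_ 2 _ 1 ltr01)[|dl dl0 hL]] := hV V rV; first lra.
(* One unit covers the distance from [V] to [L], one the error [s * D], and the third leaves a
   strict gap. *)
have [N hN] := abel_dini (modc L + 3) unb.
have u1 n : modc ((lam n)^* * zeta) < 1 by rewrite modcM modcJ modc_zeta mulr1 modc_lt1.
pose D := \sum_(n < N) (om n / tl n.+1) / (1 - modc ((lam n)^* * zeta)).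
have t0 n : 0 <= om n / tl n.+1 by rewrite divr_ge0 ?om_ge0 ?(ltW (tl_gt0 _)).
have D0 : 0 <= D by apply: sumr_ge0 => n _; rewrite divr_ge0// subr_ge0 ltW.
(* The three bounds give $r\ge0$, a point strictly within [dl] of [zeta], and $sD\le1$. *)
pose s := Num.min (2^-1) (Num.min (dl / 2) (D + 1)^-1).
have s0 : 0 < s by rewrite !lt_min !invr_gt0 ltr0n divr_gt0//= ltr_wpDl.
have : s <= s by []; rewrite {2}/s !le_min => /andP[s1 /andP[s2 s3]].
pose r := 1 - s.
have hr : 0 <= r /\ r < 1 by rewrite /r; split; lra.
have [r0 r1] := hr.
pose z : C := r%:C * zeta.
have mz : modc z = r by rewrite modcM modcC modc_zeta mulr1 ger0_norm.
have z1 : sqn z < 1 by rewrite -modc_lt1 mz.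
have dz : modc (zeta - z) = s.
  have -> : zeta - z = s%:C * zeta by rewrite /z /r rmorphB /= rmorph1; ring.
  by rewrite modcM modcC modc_zeta mulr1 ger0_norm// ltW.
have up : modc (ext V z - L) < 1 by apply: hL => //; rewrite dz ?mz /r; lra.
(* The conjugate in [ak] makes the term real at the boundary point, so only the ratio of the two
   denominators depends on [r]. *)
have term n : ak n * ((c n)^* * ((Num.sqrt (sdef lam n))%:C / (1 - (lam n)^* * z))) =
    (om n / tl n.+1)%:C * ((1 - (lam n)^* * zeta) / (1 - r%:C * ((lam n)^* * zeta))).
  have E : (om n / tl n.+1)%:C = wk n * ak n.
    by rewrite /ak mulrA mulcJ sqn_wk rmorphM /= CVr.
  have e1 : 1 - (lam n)^* * zeta != 0 by rewrite sub1_neq0 ?modc_zeta.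
  have e2 : 1 - (lam n)^* * z != 0 by rewrite sub1_neq0// mz ltW.
  rewrite E /wk /z in e2 *; rewrite -[(lam n)^* * (r%:C * _)]mulrCA in e2 *.
  by field; rewrite e1 e2.
have reE M : Re (ext (kcomb M (adj ak)) z) = \sum_(n < M) om n / tl n.+1 *
    Re ((1 - (lam n)^* * zeta) / (1 - r%:C * ((lam n)^* * zeta))).
  rewrite ext_kcomb// (eq_bigr (fun n : 'I_M => (om n / tl n.+1)%:C *
    ((1 - (lam n)^* * zeta) / (1 - r%:C * ((lam n)^* * zeta))))); last first.
    by move=> n _; rewrite -term /adj; ring.
  rewrite (big_morph (fun x : C => Re x) (@cReD R) (erefl : Re (0 : C) = 0)).
  by apply: eq_bigr => n _; rewrite cReM cReC cImC mul0r subr0.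
have low : Re (ext (kcomb N (adj ak)) z) <= Re (ext V z).
  have LV M : L2 (kcomb M (adj ak)) by exact: kcomb_L2.
  have [h _] := ext_cvg LV rV.1 cV z1.
  apply: (ler_cvg_to (cvg_cst _) h).
  exists N => // M NM; rewrite -/(Re (ext (kcomb M (adj ak)) z)) (reE N) (reE M).
  rewrite -!(big_mkord xpredT (fun n => om n / tl n.+1 *
    Re ((1 - (lam n)^* * zeta) / (1 - r%:C * ((lam n)^* * zeta))))).
  rewrite (big_cat_nat (leq0n N) NM)/= lerDl; apply: sumr_ge0 => n _.
  by rewrite mulr_ge0// Re_ratio_ge0// ltW.
have low2 : \sum_(n < N) om n / tl n.+1 - s * D <= Re (ext (kcomb N (adj ak)) z).
  rewrite reE /D mulr_sumr -sumrB; apply: ler_sum => n _.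
  have := Re_ratio_lower (u1 n) r0 (ltW r1); move/(ler_wpM2l (t0 n)); apply: le_trans.
  have -> : 1 - r = s by rewrite /r; ring.
  by rewrite mulrBr mulr1 mulrCA mulrA.
have sD : s * D <= 1.
  have D1 : 0 < D + 1 by rewrite ltr_wpDl.
  by move: s3; rewrite -div1r ler_pdivlMr// => h; apply: le_trans h; rewrite ler_wpM2l ?(ltW s0)// lerDl.
have := le_trans (ler_norm _) (Re_le_modc (ext V z)).
have := modc_subr (ext V z) L; lra.
Qed.

End Toeplitz.

Theorem theorem1p9 (R : realType) (lam : nat -> R[i]) (H : R -> R[i]) (zeta : R[i]) :
  interpolating lam -> H2 H -> tto_bounded lam H -> sqn zeta = 1 ->
  ((forall V, tto_range lam H V -> nt_limit (ext V) zeta) <->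
   (\sum_(0 <= n <oo)
      ((1 - sqn (lam n)) * (sqn (ext H (lam n)) / sqn (zeta - lam n)))%:E < +oo)%E).
Proof.
move=> [lamI lam1 [d d0 sep]] HH [K hK] zeta1.
(* The given constant may be negative, whereas the estimates multiply inequalities by it. *)
pose K0 := Num.max K 0.
have K00 : 0 <= K0 by rewrite le_max lexx orbT.
have bdd F V : KI lam F -> ess_bdd F -> tto_val lam H F V -> l2n V <= K0 * l2n F.
  move=> KF eF tF; apply: le_trans (hK F V KF eF tF) _.
  by rewrite ler_wpM2r ?l2n_ge0// le_max lexx.
have e := om_sumP H lam1 zeta; split=> [h|h V].
  by apply/e; exact: (sum_of_nt lam1 d0 sep HH K00 bdd zeta1 h).
by move/e: h => h rV; exact: (nt_of_sum lamI lam1 d0 sep HH bdd zeta1 h).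
Qed.
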